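(* Consider the quantum (1+1) centrally extended Poincaré group, i.e. the Hopf algebra generated by $\theta,a_0,a_1,\chi$ with coproducts $$\begin{aligned} \Delta(\theta)&=\theta\otimes1+1\otimes\theta+(\cosh\chi-1)\otimes a_0+\sinh\chi\otimes a_1,\\ \Delta(a_0)&=a_0\otimes1+\cosh\chi\otimes a_0+\sinh\chi\otimes a_1,\\ \Delta(a_1)&=a_1\otimes1+\cosh\chi\otimes a_1+\sinh\chi\otimes a_0,\\ \Delta(\chi)&=\chi\otimes1+1\otimes\chi, \end{aligned}$$ and commutation relations $[a_0,a_1]=\alpha\theta$, $[\theta,a_0]=0$, $[\theta,a_1]=\alpha\theta$, $[\chi,\theta]=[\chi,a_0]=\alpha(\cosh\chi-1)$, $[\chi,a_1]=\alpha\sinh\chi$. In the new coordinates $$\tilde\theta=\theta-a_0,\quad\tilde a_0=a_0,\quad\tilde a_1=a_1,\quad\tilde\chi=\chi,$$ the coproducts and commutation relations become $$\begin{aligned} \Delta(\tilde\theta)&=\tilde\theta\otimes1+1\otimes\tilde\theta,\\ \Delta(\tilde a_0)&=\tilde a_0\otimes1+\cosh\tilde\chi\otimes\tilde a_0+\sinh\tilde\chi\otimes\tilde a_1,\\ \Delta(\tilde a_1)&=\tilde a_1\otimes1+\cosh\tilde\chi\otimes\tilde a_1+\sinh\tilde\chi\otimes\tilde a_0,\\ \Delta(\tilde\chi)&=\tilde\chi\otimes1+1\otimes\tilde\chi, \end{aligned}$$ $$\begin{gathered} [\tilde a_0,\tilde a_1]=\alpha(\tilde\theta+\tilde a_0),\quad[\tilde\theta,\tilde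 a_0]=0,\quad[\tilde\theta,\tilde a_1]=0,\\ [\tilde\chi,\tilde\theta]=0,\quad[\tilde\chi,\tilde a_0]=\alpha(\cosh\tilde\chi-1),\quad[\tilde\chi,\tilde a_1]=\alpha\sinh\tilde\chi. \end{gathered}$$ Consequently this Hopf algebra is a non-trivial central extension, with central element $\tilde\theta$, of the (1+1) spacelike $\kappa$-Poincaré quantum group: $\tilde\theta$ is central, setting $\tilde\theta=0$ gives the (1+1) spacelike $\kappa$-Poincaré quantum group, and the Hopf algebra cannot be expressed as the tensor product of the (1+1) spacelike $\kappa$-Poincaré quantum group with the commutative and cocommutative Hopf subalgebra generated by the central element $\tilde\theta$.
   Context: Everything is formal in $\alpha$: the Hopf algebras are topological Hopf algebras over $\mathbb{R}[[\alpha]]$ whose elements are (possibly infinite) series of ordered monomials in the generators, with $\cosh\chi,\sinh\chi$ the usual power series. The (1+1) spacelike $\kappa$-Poincaré quantum group is the Hopf algebra generated by $a_0,a_1,\chi$ with commutation relations $$[a_0,a_1]=\alpha a_0,\quad[\chi,a_0]=\alpha(\cosh\chi-1),\quad[\chi,a_1]=\alpha\sinh\chi,$$ and coproducts $\Delta(a_0)=a_0\otimes1+\cosh\chi\otimes a_0+\sinh\chi\otimes a_1$, $\Delta(a_1)=a_1\otimes1+\cosh\chi\otimes a_1+\sinh\chi\otimes a_0$, $\Delta(\chi)=\chi\otimes1+1\otimes\chi$. A central extension of a Hopf algebra is called non-trivial if it is not isomorphic, as a Hopf algebra, to the (completed) tensor product of the non-extended Hopf algebra with the commutative and cocommutative Hopf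 algebra generated by the central (primitive) element. *)

(* Defs.v *)
From HB Require Import structures.
From mathcomp Require Import all_boot all_order all_algebra.
From mathcomp Require Import all_classical all_reals.

Set Implicit Arguments.
Unset Strict Implicit.
Unset Printing Implicit Defensive.

Import GRing.Theory.
Local Open Scope classical_set_scope.
Local Open Scope ring_scope.

Lemma sum_triangle (V : nmodType) (F : nat -> nat -> V) (n : nat) :
  \sum_(j < n.+1) \sum_(i < j.+1) F i (j - i)%N =
  \sum_(i < n.+1) \sum_(k < (n - i).+1) F i k.
Proof.
elim: n => [|n IHn].
  by rewrite !big_ord1.
rewrite big_ord_recr [RHS]big_ord_recr /= IHn subnn.
rewrite big_ord1 /=.
under [X in _ = X + _]eq_bigr => i _ do
  rewrite subSn ?leq_ord// big_ord_recr /=.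
rewrite big_split /= -addrA; congr (_ + _).
rewrite big_ord_recr /= subnn; congr (_ + _).
by apply: eq_bigr => i _; rewrite subSn ?leq_ord.
Qed.

(* [a n] is the coefficient of alpha^n. *)
Definition fps (R : realType) : Type := nat -> R.

Section Fps.
Variable R : realType.
Implicit Types a b c : fps R.

HB.instance Definition _ := GRing.Zmodule.copy (fps R) (nat -> R).

Definition fps_one : fps R := fun n => (n == 0)%:R.
Definition fps_mul a b : fps R := fun n => \sum_(i < n.+1) a i * b (n - i)%N.

Lemma fps_mulA : associative fps_mul.
Proof.
move=> a b c; apply/funext => n; rewrite /fps_mul.
transitivity (\sum_(i < n.+1) \sum_(k < (n - i).+1)
    a i * (b k * c (n - i - k)%N)).
  by apply: eq_bigr => i _; rewrite big_distrr.
rewrite -(sum_triangle (fun i k => a i * (b k * c (n - i - k)%N))).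
apply: eq_bigr => j _; rewrite big_distrl /=; apply: eq_bigr => i _.
by rewrite mulrA -subnDA subnKC// -ltnS.
Qed.

Lemma fps_mulC : commutative fps_mul.
Proof.
move=> a b; apply/funext => n; rewrite /fps_mul.
rewrite (reindex_inj rev_ord_inj) /=; apply: eq_bigr => i _.
by rewrite mulrC subSS subKn// -ltnS.
Qed.

Lemma fps_mul1 : left_id fps_one fps_mul.
Proof.
move=> a; apply/funext => n; rewrite /fps_mul big_ord_recl /= mul1r subn0.
by rewrite big1 ?addr0// => i _; rewrite /fps_one mul0r.
Qed.

Lemma fps_mulDl : left_distributive fps_mul +%R.
Proof.
move=> a b c; apply/funext => n; rewrite /fps_mul.
transitivity (\sum_(i < n.+1) (a i * c (n - i)%N + b i * c (n - i)%N)).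
  by apply: eq_bigr => i _; rewrite mulrDl.
by rewrite big_split.
Qed.

Lemma fps_one_neq0 : fps_one != 0.
Proof.
apply/eqP => /(congr1 (fun a : fps R => a 0)) /eqP.
by rewrite /fps_one /= oner_eq0.
Qed.

HB.instance Definition _ := GRing.Zmodule_isComNzRing.Build (fps R)
  fps_mulA fps_mulC fps_mul1 fps_mulDl fps_one_neq0.

Definition fpsC (x : R) : fps R := fun n => if n is 0 then x else 0.

Definition alpha : fps R := fun n => (n == 1)%:R.

Definition fps_fil (n : nat) : set (fps R) :=
  [set a | forall k, (k < n)%N -> a k = 0].

End Fps.

Arguments alpha {R}.

(* [fil n] is a basis of neighbourhoods of 0; the topology is linear, Hausdorff
   and complete, and alpha is topologically nilpotent. *)
HB.mixin Record hasFiltration (R : realType) (A : Type)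
    of GRing.Algebra (fps R) A := {
  fil : nat -> set A;
  fil_setT : fil 0 = setT;
  fil_le : forall m n, (m <= n)%N -> fil n `<=` fil m;
  fil_0 : forall n, fil n 0;
  fil_B : forall n x y, fil n x -> fil n y -> fil n (x - y);
  fil_M : forall m n x y, fil m x -> fil n y -> fil (m + n)%N (x * y);
  fil_alpha : fil 1 (alpha *: 1);
  fil_separated : forall x, (forall n, fil n x) -> x = 0;
  fil_complete : forall u : nat -> A, (forall n, fil n (u n.+1 - u n)) ->
    exists l, forall n, fil n (l - u n) }.

#[short(type="filAlgType")]
HB.structure Definition FilAlg (R : realType) :=
  {A of GRing.Algebra (fps R) A & hasFiltration R A}.

Definition fil_continuous (A B : Type) (FA : nat -> set A) (FB : nat -> set B)
  (f : A -> B) : Prop := forall n, exists m, FA m `<=` f @^-1` FB n.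

Section FilAlgTheory.
Variables (R : realType) (A : filAlgType R).
Implicit Types (x y : A) (J : set A).

Definition bracket x y : A := x * y - y * x.

Definition fil_cvg (u : nat -> A) (l : A) : Prop :=
  forall n, exists N, forall m, (N <= m)%N -> fil n (l - u m).

(* [powser c x] is the sum of the [c k *: x ^+ k]; it is a junk value when the
   series diverges, but it converges for all x in [fil 1]. *)
Definition powser (c : nat -> R) x : A :=
  xget 0 [set l | fil_cvg (fun m => \sum_(k < m) fpsC (c k) *: x ^+ k) l].

Definition cosh x : A := powser (fun k => if odd k then 0 else k`!%:R^-1) x.
Definition sinh x : A := powser (fun k => if odd k then k`!%:R^-1 else 0) x.

Definition closed_ideal J : Prop :=
  [/\ J 0, forall x y, J x -> J y -> J (x - y),
      forall x y, J y -> J (x * y) /\ J (y * x) &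
      forall x, (forall n, exists2 y, J y & fil n (x - y)) -> J x].

Definition closed_ideal_of (S : set A) : set A := smallest closed_ideal S.

Lemma closed_ideal_ofP S : closed_ideal (closed_ideal_of S).
Proof.
split=> [|x y Jx Jy|x y Jy|x clx].
- by move=> J [[]].
- by move=> J JS; have [[_ JB _ _] _] := JS; apply: JB; [exact: Jx|exact: Jy].
- by split=> J JS; have [[_ _ JM _] _] := JS; have [] := JM x y (Jy _ JS).
- move=> J JS; have [[_ _ _ Jcl] _] := JS; apply: Jcl => n.
  by have [y Jy ?] := clx n; exists y => //; exact: Jy.
Qed.

Lemma fil_N n x : fil n x -> fil n (- x).
Proof. by move=> nx; rewrite -sub0r; apply: fil_B => //; exact: fil_0. Qed.

Lemma fil_D n x y : fil n x -> fil n y -> fil n (x + y).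
Proof. by move=> nx ny; rewrite -[y]opprK; apply: fil_B => //; exact: fil_N. Qed.

Lemma fil_Ml n x y : fil n y -> fil n (x * y).
Proof. by move=> ny; rewrite -[n]add0n; apply: fil_M => //; rewrite fil_setT. Qed.

Lemma fil_Mr n x y : fil n x -> fil n (x * y).
Proof. by move=> ny; rewrite -[n]addn0; apply: fil_M => //; rewrite fil_setT. Qed.

Lemma fil_alphaZ x : fil 1 (alpha *: x).
Proof. by rewrite -[x]mul1r scalerAl; apply/fil_Mr/fil_alpha. Qed.

Lemma fil_bracket n x y : fil n x -> fil n (bracket x y).
Proof. by move=> nx; apply: fil_B; [exact: fil_Mr|exact: fil_Ml]. Qed.

End FilAlgTheory.

(* [f w] is the coefficient of the word w. *)
Definition ncs (R : realType) (X : finType) : Type := seq X -> fps R.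

Section Ncs.
Variables (R : realType) (X : finType).
Implicit Types (f g h : ncs R X) (a b : fps R).

HB.instance Definition _ := GRing.Zmodule.copy (ncs R X) (seq X -> fps R).

Definition ncs_one : ncs R X := fun w => (w == [::])%:R.
Definition ncs_mul f g : ncs R X :=
  fun w => \sum_(i < (size w).+1) f (take i w) * g (drop i w).
Definition ncs_scale a f : ncs R X := fun w => a * f w.

Lemma ncs_mulA : associative ncs_mul.
Proof.
move=> f g h; apply/funext => w; rewrite /ncs_mul.
transitivity (\sum_(i < (size w).+1) \sum_(k < (size w - i).+1)
    f (take i w) * (g (take k (drop i w)) * h (drop (i + k) w))).
  apply: eq_bigr => i _; rewrite big_distrr size_drop /=.
  by apply: eq_bigr => k _; rewrite drop_drop addnC.
rewrite -(sum_triangle (fun i k =>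
  f (take i w) * (g (take k (drop i w)) * h (drop (i + k) w)))).
apply: eq_bigr => j _; have jw : (j <= size w)%N by rewrite -ltnS.
rewrite big_distrl size_takel//=; apply: eq_bigr => i _.
have ij : (i <= j)%N by rewrite -ltnS.
by rewrite mulrA take_takel// subnKC// take_drop subnK.
Qed.

Lemma ncs_mul1l : left_id ncs_one ncs_mul.
Proof.
move=> f; apply/funext => w; rewrite /ncs_mul big_ord_recl /= take0 drop0 mul1r.
rewrite big1 ?addr0// => i _; rewrite /ncs_one -size_eq0 size_takel//.
by rewrite mul0r.
Qed.

Lemma ncs_mul1r : right_id ncs_one ncs_mul.
Proof.
move=> f; apply/funext => w; rewrite /ncs_mul big_ord_recr /= take_size.
rewrite drop_size mulr1 big1 ?add0r// => i _.
by rewrite /ncs_one -size_eq0 size_drop subn_eq0 leqNgt ltn_ord mulr0.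
Qed.

Lemma ncs_mulDl : left_distributive ncs_mul +%R.
Proof.
move=> f g h; apply/funext => w; rewrite /ncs_mul.
under eq_bigr => i _ do rewrite mulrDl.
by rewrite big_split.
Qed.

Lemma ncs_mulDr : right_distributive ncs_mul +%R.
Proof.
move=> f g h; apply/funext => w; rewrite /ncs_mul.
under eq_bigr => i _ do rewrite mulrDr.
by rewrite big_split.
Qed.

Lemma ncs_one_neq0 : ncs_one != 0.
Proof.
apply/eqP => /(congr1 (fun f : ncs R X => f [::])) /eqP.
by rewrite /ncs_one /= oner_eq0.
Qed.

HB.instance Definition _ := GRing.Zmodule_isNzRing.Build (ncs R X)
  ncs_mulA ncs_mul1l ncs_mul1r ncs_mulDl ncs_mulDr ncs_one_neq0.

Lemma ncs_scaleA a b f : ncs_scale a (ncs_scale b f) = ncs_scale (a * b) f.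
Proof. by apply/funext => w; rewrite /ncs_scale mulrA. Qed.

Lemma ncs_scale1 : left_id 1 ncs_scale.
Proof. by move=> f; apply/funext => w; rewrite /ncs_scale mul1r. Qed.

Lemma ncs_scaleDr : right_distributive ncs_scale +%R.
Proof. by move=> a f g; apply/funext => w; rewrite /ncs_scale mulrDr. Qed.

Lemma ncs_scaleDl f : {morph ncs_scale^~ f : a b / a + b}.
Proof. by move=> a b; apply/funext => w; rewrite /ncs_scale mulrDl. Qed.

HB.instance Definition _ := GRing.Zmodule_isLmodule.Build (fps R) (ncs R X)
  ncs_scaleA ncs_scale1 ncs_scaleDr ncs_scaleDl.

Lemma ncs_scaleAl a f g : a *: (f * g) = (a *: f) * g.
Proof.
apply/funext => w; transitivity (a * ncs_mul f g w) => //.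
rewrite /ncs_mul big_distrr /=.
by apply: eq_bigr => i _; rewrite mulrA.
Qed.

HB.instance Definition _ := GRing.Lmodule_isLalgebra.Build (fps R) (ncs R X)
  ncs_scaleAl.

Lemma ncs_scaleAr a f g : a *: (f * g) = f * (a *: g).
Proof.
apply/funext => w; transitivity (a * ncs_mul f g w) => //.
rewrite /ncs_mul big_distrr /=.
by apply: eq_bigr => i _; rewrite mulrCA.
Qed.

HB.instance Definition _ := GRing.Lalgebra_isAlgebra.Build (fps R) (ncs R X)
  ncs_scaleAr.

(* Series of total order at least n, where alpha and the generators all have
   degree 1. *)
Definition ncs_fil (n : nat) : set (ncs R X) :=
  [set f | forall w k, (size w + k < n)%N -> f w k = 0].

Lemma ncs_fil_setT : ncs_fil 0 = setT.
Proof. by apply/seteqP; split. Qed.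

Lemma ncs_fil_le m n : (m <= n)%N -> ncs_fil n `<=` ncs_fil m.
Proof. by move=> mn f fn w k /leq_trans/(_ mn)/fn. Qed.

Lemma ncs_fil_0 n : ncs_fil n 0. Proof. by []. Qed.

Lemma ncs_fil_B n f g : ncs_fil n f -> ncs_fil n g -> ncs_fil n (f - g).
Proof.
move=> fn gn w k wk; transitivity (f w k - g w k) => //.
by rewrite fn// gn// subrr.
Qed.

Lemma fps_sumE (I : Type) (r : seq I) (p : pred I) (F : I -> fps R) k :
  (\sum_(i <- r | p i) F i) k = \sum_(i <- r | p i) F i k.
Proof. by elim/big_ind2: _ => // a x b y <- <-. Qed.

Lemma ncs_fil_M m n f g : ncs_fil m f -> ncs_fil n g -> ncs_fil (m + n)%N (f * g).
Proof.
move=> fm gn w k wk; transitivity (ncs_mul f g w k) => //.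
rewrite /ncs_mul fps_sumE; apply: big1 => i _.
transitivity (fps_mul (f (take i w)) (g (drop i w)) k) => //.
rewrite /fps_mul; apply: big1 => j _.
have iw : (i <= size w)%N by rewrite -ltnS.
have jk : (j <= k)%N by rewrite -ltnS.
have [ijm|mij] := ltnP (i + j) m.
  by rewrite fm ?mul0r// size_takel.
rewrite [X in _ * X]gn ?mulr0// size_drop.
rewrite -(ltn_add2l (i + j)) addnACA !subnKC//.
by apply: leq_trans wk _; rewrite leq_add2r.
Qed.

Lemma ncs_fil_alpha : ncs_fil 1 (alpha *: 1).
Proof.
move=> w k; rewrite ltnS leqn0 addn_eq0 size_eq0 => /andP[/eqP -> /eqP ->].
transitivity (fps_mul (alpha : fps R) 1 0) => //.
by rewrite /fps_mul big_ord1 mul0r.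
Qed.

Lemma ncs_fil_separated f : (forall n, ncs_fil n f) -> f = 0.
Proof.
by move=> f0; apply/funext => w; apply/funext => k; exact: (f0 (size w + k).+1).
Qed.

Lemma ncs_fil_complete (u : nat -> ncs R X) :
  (forall n, ncs_fil n (u n.+1 - u n)) ->
  exists l, forall n, ncs_fil n (l - u n).
Proof.
move=> du; exists (fun w k => u (size w + k).+1 w k) => n w k wk.
suff H d : u ((size w + k).+1 + d)%N w k = u (size w + k).+1 w k.
  transitivity (u (size w + k).+1 w k - u n w k) => //.
  by rewrite -[in X in _ - X](subnKC wk) H subrr.
elim: d => [|d <-]; first by rewrite addn0.
rewrite addnS; apply: subr0_eq.
by apply: (du _ w k); rewrite addSn ltnS leq_addr.
Qed.

HB.instance Definition _ := hasFiltration.Build R (ncs R X)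
  ncs_fil_setT ncs_fil_le ncs_fil_0 ncs_fil_B ncs_fil_M ncs_fil_alpha
  ncs_fil_separated ncs_fil_complete.

Definition gen (x : X) : ncs R X := fun w => (w == [:: x])%:R.

Lemma fil_gen x : fil 1 (gen x).
Proof.
move=> w k; rewrite ltnS leqn0 addn_eq0 size_eq0 => /andP[/eqP -> /eqP ->].
by [].
Qed.

End Ncs.

Arguments gen {R X} x.

(* The substitution of the letters of X by letters of Y. *)
Definition rename (R : realType) (X Y : finType) (r : X -> Y) (f : ncs R X) :
    ncs R Y :=
  fun w => \sum_(v : (size w).-tuple X | map r v == w) f v.

Record pres (R : realType) := Pres {
  pgen : finType;
  prel : set (ncs R pgen);
  prel_fil : prel `<=` fil 1 }.

(* The presented algebra is the quotient of the free complete algebra by the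
   closed two-sided ideal generated by the relations. *)
Section Alg.
Variables (R : realType) (P : pres R).
Local Notation F := (ncs R (pgen P)).

Definition alg_ideal_set : set F := closed_ideal_of (@prel R P).

Definition alg_ideal : {pred F} := [pred f | `[< alg_ideal_set f >]].

Lemma alg_idealE f : (f \in alg_ideal) = `[< alg_ideal_set f >].
Proof. by []. Qed.

Lemma alg_ideal_zmod : zmod_closed alg_ideal.
Proof.
have [J0 JB _ _] := closed_ideal_ofP (@prel R P).
split=> [|f g]; first exact/asboolP.
by rewrite !alg_idealE => /asboolP Jf /asboolP Jg; apply/asboolP; exact: (JB _ _ Jf Jg).
Qed.

HB.instance Definition _ := GRing.isZmodClosed.Build F alg_ideal alg_ideal_zmod.

Definition alg : Type := Quotient.quot alg_ideal.

HB.instance Definition _ := GRing.Zmodule.on alg.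
HB.instance Definition _ := EqQuotient.on alg.

Definition alg_pi (f : F) : alg := \pi_alg%qT f.

Lemma alg_pi_eq f g : alg_pi f = alg_pi g <-> alg_ideal_set (f - g).
Proof.
split=> [/eqP|Jfg]; first by rewrite -Quotient.idealrBE => /asboolP.
by apply/eqP; rewrite -Quotient.idealrBE; exact/asboolP.
Qed.

Lemma alg_pi_surj x : exists f, alg_pi f = x.
Proof. by exists (repr x); rewrite /alg_pi reprK. Qed.

Lemma alg_pi_repr x : alg_pi (repr x) = x.
Proof. by rewrite /alg_pi reprK. Qed.

Lemma alg_piB f g : alg_pi (f - g) = alg_pi f - alg_pi g.
Proof. by rewrite /alg_pi !piE. Qed.

Lemma alg_piD f g : alg_pi (f + g) = alg_pi f + alg_pi g.
Proof. by rewrite /alg_pi !piE. Qed.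

Definition alg_one : alg := alg_pi 1.
Definition alg_mul (x y : alg) : alg := alg_pi (repr x * repr y).
Definition alg_scale (a : fps R) (x : alg) : alg := alg_pi (a *: repr x).

Lemma alg_repr_pi f : alg_ideal_set (repr (alg_pi f) - f).
Proof. by apply/alg_pi_eq; rewrite alg_pi_repr. Qed.

Lemma alg_piM f g : alg_pi (f * g) = alg_mul (alg_pi f) (alg_pi g).
Proof.
have [J0 JB JM _] := closed_ideal_ofP (@prel R P).
apply/esym/alg_pi_eq.
have Jf := alg_repr_pi f; have Jg := alg_repr_pi g.
set f' := repr _ in Jf *; set g' := repr _ in Jg *.
have -> : f' * g' - f * g = f' * (g' - g) - (f - f') * g.
  by rewrite mulrBr mulrBl opprB addrA subrK.
apply: (JB _ _ (JM f' _ Jg).1 (JM g _ _).2).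
by rewrite -opprB -[- _]sub0r; exact: (JB _ _ J0 Jf).
Qed.

Lemma alg_piZ a f : alg_pi (a *: f) = alg_scale a (alg_pi f).
Proof.
have [_ JB JM _] := closed_ideal_ofP (@prel R P).
apply/esym/alg_pi_eq; rewrite -scalerBr -[_ - _]mul1r scalerAl.
exact: (JM _ _ (alg_repr_pi f)).1.
Qed.

Lemma alg_mulA : associative alg_mul.
Proof.
move=> x y z; rewrite -(alg_pi_repr x) -(alg_pi_repr y) -(alg_pi_repr z).
by rewrite -!alg_piM mulrA.
Qed.

Lemma alg_mul1l : left_id alg_one alg_mul.
Proof. by move=> x; rewrite -(alg_pi_repr x) -alg_piM mul1r. Qed.

Lemma alg_mul1r : right_id alg_one alg_mul.
Proof. by move=> x; rewrite -(alg_pi_repr x) -alg_piM mulr1. Qed.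

Lemma alg_mulDl : left_distributive alg_mul +%R.
Proof.
move=> x y z; rewrite -(alg_pi_repr x) -(alg_pi_repr y) -(alg_pi_repr z).
by rewrite -alg_piD -!alg_piM mulrDl alg_piD.
Qed.

Lemma alg_mulDr : right_distributive alg_mul +%R.
Proof.
move=> x y z; rewrite -(alg_pi_repr x) -(alg_pi_repr y) -(alg_pi_repr z).
by rewrite -alg_piD -!alg_piM mulrDr alg_piD.
Qed.

Lemma closed_ideal_fil1 : closed_ideal (fil 1 : set F).
Proof.
split=> [|f g|f g g1|f clf]; first exact: fil_0.
- exact: fil_B.
- by split; [exact: fil_Ml|exact: fil_Mr].
- by have [g g1 fg] := clf 1; rewrite -[f](subrK g); exact: fil_D.
Qed.

Lemma alg_one_neq0 : alg_one != 0.
Proof.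
have p0 : alg_pi 0 = 0 by rewrite -[0 in LHS](subrr 0) alg_piB subrr.
apply/eqP; rewrite -p0 => /alg_pi_eq; rewrite subr0 => one_in.
have : fil 1 (1 : F).
  apply: one_in; split; first exact: closed_ideal_fil1.
  exact: prel_fil.
move=> /(_ [::] 0 isT) /eqP.
by rewrite [X in X == _]/(1 : R) oner_eq0.
Qed.

HB.instance Definition _ := GRing.Zmodule_isNzRing.Build alg
  alg_mulA alg_mul1l alg_mul1r alg_mulDl alg_mulDr alg_one_neq0.

Lemma alg_scaleA a b x : alg_scale a (alg_scale b x) = alg_scale (a * b) x.
Proof. by rewrite -(alg_pi_repr x) -!alg_piZ scalerA. Qed.

Lemma alg_scale1 : left_id 1 alg_scale.
Proof. by move=> x; rewrite -(alg_pi_repr x) -alg_piZ scale1r. Qed.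

Lemma alg_scaleDr : right_distributive alg_scale +%R.
Proof.
move=> a x y; rewrite -(alg_pi_repr x) -(alg_pi_repr y).
by rewrite -alg_piD -!alg_piZ scalerDr alg_piD.
Qed.

Lemma alg_scaleDl x : {morph alg_scale^~ x : a b / a + b}.
Proof.
by move=> a b; rewrite -(alg_pi_repr x) -!alg_piZ scalerDl alg_piD.
Qed.

HB.instance Definition _ := GRing.Zmodule_isLmodule.Build (fps R) alg
  alg_scaleA alg_scale1 alg_scaleDr alg_scaleDl.

Lemma alg_scaleAl (a : fps R) (x y : alg) : a *: (x * y) = (a *: x) * y.
Proof.
rewrite -(alg_pi_repr x) -(alg_pi_repr y) -[_ * _ in LHS]alg_piM.
by rewrite -[LHS]alg_piZ scalerAl alg_piM alg_piZ.
Qed.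

HB.instance Definition _ := GRing.Lmodule_isLalgebra.Build (fps R) alg
  alg_scaleAl.

Lemma alg_scaleAr (a : fps R) (x y : alg) : a *: (x * y) = x * (a *: y).
Proof.
rewrite -(alg_pi_repr x) -(alg_pi_repr y) -[_ * _ in LHS]alg_piM.
by rewrite -[LHS]alg_piZ scalerAr alg_piM alg_piZ.
Qed.

HB.instance Definition _ := GRing.Lalgebra_isAlgebra.Build (fps R) alg
  alg_scaleAr.

Lemma alg_pi_linear : linear alg_pi.
Proof. by move=> a f g; rewrite alg_piD alg_piZ. Qed.

Lemma alg_pi_monoid : monoid_morphism alg_pi.
Proof. by split=> // f g; exact: alg_piM. Qed.

HB.instance Definition _ := GRing.isLinear.Build (fps R) F alg _ alg_pi
  alg_pi_linear.
HB.instance Definition _ := GRing.isMonoidMorphism.Build F alg alg_pi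
  alg_pi_monoid.

Definition alg_fil (n : nat) : set alg := alg_pi @` fil n.

Lemma alg_fil_setT : alg_fil 0 = setT.
Proof.
apply/seteqP; split=> // x _; exists (repr x); last exact: alg_pi_repr.
by rewrite fil_setT.
Qed.

Lemma alg_fil_le m n : (m <= n)%N -> alg_fil n `<=` alg_fil m.
Proof. by move=> mn; apply: image_subset; exact: fil_le. Qed.

Lemma alg_fil_0 n : alg_fil n 0.
Proof. by exists 0; [exact: fil_0|rewrite raddf0]. Qed.

Lemma alg_fil_B n x y : alg_fil n x -> alg_fil n y -> alg_fil n (x - y).
Proof.
by move=> [f fn <-] [g gn <-]; exists (f - g); rewrite ?raddfB//; exact: fil_B.
Qed.

Lemma alg_fil_M m n x y :
  alg_fil m x -> alg_fil n y -> alg_fil (m + n)%N (x * y).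
Proof.
by move=> [f fm <-] [g gn <-]; exists (f * g); rewrite ?rmorphM//; exact: fil_M.
Qed.

Lemma alg_fil_alpha : alg_fil 1 (alpha *: 1).
Proof.
exists (alpha *: 1); first exact: fil_alpha.
by rewrite linearZ rmorph1.
Qed.

Lemma alg_fil_separated x : (forall n, alg_fil n x) -> x = 0.
Proof.
move=> x0; have [_ _ _ Jcl] := closed_ideal_ofP (@prel R P).
rewrite -(alg_pi_repr x) -(raddf0 alg_pi); apply/alg_pi_eq; rewrite subr0.
apply: Jcl => n; have [g gn gx] := x0 n; exists (repr x - g).
  by apply/alg_pi_eq; rewrite alg_pi_repr gx.
by rewrite opprB addrC subrK.
Qed.

Lemma alg_fil_complete (u : nat -> alg) :
  (forall n, alg_fil n (u n.+1 - u n)) ->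
  exists l, forall n, alg_fil n (l - u n).
Proof.
move=> du; have {}du n : exists f, fil n f /\ alg_pi f = u n.+1 - u n.
  by have [f] := du n; exists f.
have [d dP] := choice du.
pose v n := repr (u 0) + \sum_(k < n) d k.
have vE n : alg_pi (v n) = u n.
  rewrite /v raddfD /= alg_pi_repr raddf_sum /=.
  elim: n => [|n IHn]; first by rewrite big_ord0 addr0.
  by rewrite big_ord_recr /= addrA IHn (dP n).2 addrC subrK.
have [l lP] : exists l, forall n, fil n (l - v n).
  apply: fil_complete => n.
  rewrite /v big_ord_recr /= addrA [X in X - _]addrC addrK.
  exact: (dP n).1.
by exists (alg_pi l) => n; exists (l - v n); [exact: lP|rewrite raddfB /= vE].
Qed.

HB.instance Definition _ := hasFiltration.Build R alg
  alg_fil_setT alg_fil_le alg_fil_0 alg_fil_B alg_fil_M alg_fil_alpha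
  alg_fil_separated alg_fil_complete.

Definition agen (x : pgen P) : alg := alg_pi (gen x).

End Alg.

Arguments agen {R} P x.

Section Tensor.
Variables (R : realType) (P Q : pres R).

Definition ctens_rel : set (ncs R (pgen P + pgen Q)%type) :=
  [set rename inl f | f in @prel R P] `|` [set rename inr g | g in @prel R Q] `|`
  [set h | exists x y, h = bracket (gen (inl x)) (gen (inr y))].

Lemma fil_rename (X Y : finType) (r : X -> Y) (f : ncs R X) n :
  fil n f -> fil n (rename r f).
Proof.
move=> fn w k wk; rewrite /rename fps_sumE; apply: big1 => v _.
by apply: fn; rewrite size_tuple.
Qed.

Lemma ctens_rel_fil : ctens_rel `<=` fil 1.
Proof.
move=> h [[[f Pf <-]|[g Qg <-]]|[x [y ->]]].
- exact/fil_rename/prel_fil.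
- exact/fil_rename/prel_fil.
- exact/fil_bracket/fil_gen.
Qed.

(* The completed tensor product of two complete algebras is the universal
   complete algebra receiving commuting copies of both, so it is presented by
   the disjoint union of the generators, the relations of both factors, and the
   commutation of the generators of P with those of Q. *)
Definition ctens : pres R := Pres ctens_rel_fil.

(* [rename inl] and [rename inr] are continuous algebra morphisms sending
   relations to relations, so the classes below do not depend on the
   representatives chosen by [repr]. *)
Definition tens (x : alg P) (y : alg Q) : alg ctens :=
  @alg_pi R ctens (rename inl (repr x)) * @alg_pi R ctens (rename inr (repr y)).

End Tensor.

Notation "x \ox y" := (tens x y) (at level 40, left associativity).

(* [h] is the completed tensor product of [f] and [g]: it is unique, the span
   of the pure tensors being dense. *)
Definition is_tensor_map (R : realType) (P Q P' Q' : pres R)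
    (f : alg P -> alg P') (g : alg Q -> alg Q')
    (h : {linear alg (ctens P Q) -> alg (ctens P' Q')}) : Prop :=
  fil_continuous fil fil h /\ forall x y, h (x \ox y) = f x \ox g y.

(* [dl], [dr], [el], [er], [ml], [mr] stand for Delta (x) id, id (x) Delta,
   eps (x) id, id (x) eps, mult o (S (x) id), mult o (id (x) S): each is the only
   continuous linear map with the prescribed values on pure tensors. *)
Record hopf (R : realType) (P : pres R) := Hopf {
  comul : {lrmorphism alg P -> alg (ctens P P)};
  counit : {lrmorphism alg P -> fps R | *%R};
  antipode : {linear alg P -> alg P};
  comul_continuous : fil_continuous fil fil comul;
  counit_continuous : fil_continuous fil (@fps_fil R) counit;
  antipode_continuous : fil_continuous fil fil antipode;
  comul_coassoc :
    exists (dl : {linear alg (ctens P P) -> alg (ctens (ctens P P) P)})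
           (dr : {linear alg (ctens P P) -> alg (ctens P (ctens P P))})
           (assoc : {linear alg (ctens (ctens P P) P) ->
                            alg (ctens P (ctens P P))}),
      [/\ is_tensor_map comul idfun dl, is_tensor_map idfun comul dr,
          fil_continuous fil fil assoc,
          forall x y z, assoc ((x \ox y) \ox z) = x \ox (y \ox z) &
          forall x, assoc (dl (comul x)) = dr (comul x)];
  comul_counitl :
    exists el : {linear alg (ctens P P) -> alg P},
      [/\ fil_continuous fil fil el,
          forall x y, el (x \ox y) = counit x *: y &
          forall x, el (comul x) = x];
  comul_counitr :
    exists er : {linear alg (ctens P P) -> alg P},
      [/\ fil_continuous fil fil er,
          forall x y, er (x \ox y) = counit y *: x &
          forall x, er (comul x) = x];
  comul_antipodel :
    exists ml : {linear alg (ctens P P) -> alg P},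
      [/\ fil_continuous fil fil ml,
          forall x y, ml (x \ox y) = antipode x * y &
          forall x, ml (comul x) = counit x *: 1];
  comul_antipoder :
    exists mr : {linear alg (ctens P P) -> alg P},
      [/\ fil_continuous fil fil mr,
          forall x y, mr (x \ox y) = x * antipode y &
          forall x, mr (comul x) = counit x *: 1] }.

Definition hopf_morphism (R : realType) (P Q : pres R) (HP : hopf P)
    (HQ : hopf Q) (f : {lrmorphism alg P -> alg Q}) : Prop :=
  [/\ fil_continuous fil fil f,
      exists2 ff : {linear alg (ctens P P) -> alg (ctens Q Q)},
        is_tensor_map f f ff & forall x, comul HQ (f x) = ff (comul HP x),
      forall x, counit HQ (f x) = counit HP x &
      forall x, antipode HQ (f x) = f (antipode HP x)].

Definition hopf_isomorphic (R : realType) (P Q : pres R) (HP : hopf P)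
    (HQ : hopf Q) : Prop :=
  exists (f : {lrmorphism alg P -> alg Q}) (g : {lrmorphism alg Q -> alg P}),
    [/\ hopf_morphism HP HQ f, hopf_morphism HQ HP g, cancel f g & cancel g f].

Definition is_tensor_hopf (R : realType) (P Q : pres R) (HP : hopf P)
    (HQ : hopf Q) (H : hopf (ctens P Q)) : Prop :=
  [/\ exists flip : {linear alg (ctens (ctens P P) (ctens Q Q)) ->
                            alg (ctens (ctens P Q) (ctens P Q))},
        [/\ fil_continuous fil fil flip,
            forall x x' y y',
              flip ((x \ox x') \ox (y \ox y')) = (x \ox y) \ox (x' \ox y') &
            forall x y,
              comul H (x \ox y) = flip (comul HP x \ox comul HQ y)],
      forall x y, counit H (x \ox y) = counit HP x * counit HQ y &
      forall x y, antipode H (x \ox y) = antipode HP x \ox antipode HQ y].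

Inductive kappa_gen := Ka0 | Ka1 | Kchi.

Definition kappa_code (x : kappa_gen) : 'I_3 :=
  match x with Ka0 => inord 0 | Ka1 => inord 1 | Kchi => inord 2 end.
Definition kappa_decode (i : 'I_3) : kappa_gen :=
  match val i with 0 => Ka0 | 1 => Ka1 | _ => Kchi end.
Lemma kappa_codeK : cancel kappa_code kappa_decode.
Proof. by case; rewrite /kappa_decode /= inordK. Qed.
HB.instance Definition _ := Finite.copy kappa_gen (can_type kappa_codeK).

Inductive ext_gen := Etheta | Ea0 | Ea1 | Echi.

Definition ext_code (x : ext_gen) : 'I_4 :=
  match x with
  | Etheta => inord 0 | Ea0 => inord 1 | Ea1 => inord 2 | Echi => inord 3
  end.
Definition ext_decode (i : 'I_4) : ext_gen :=
  match val i with 0 => Etheta | 1 => Ea0 | 2 => Ea1 | _ => Echi end.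
Lemma ext_codeK : cancel ext_code ext_decode.
Proof. by case; rewrite /ext_decode /= inordK. Qed.
HB.instance Definition _ := Finite.copy ext_gen (can_type ext_codeK).

Section Presentations.
Variable R : realType.

(* Each relation u = v is represented by the element u - v. *)
Definition kappa_rel : set (ncs R kappa_gen) :=
  let a0 := gen Ka0 in let a1 := gen Ka1 in let chi := gen Kchi in
  [set bracket a0 a1 - alpha *: a0;
       bracket chi a0 - alpha *: (cosh chi - 1);
       bracket chi a1 - alpha *: sinh chi].

Definition ext_rel : set (ncs R ext_gen) :=
  let theta := gen Etheta in
  let a0 := gen Ea0 in let a1 := gen Ea1 in let chi := gen Echi in
  [set bracket a0 a1 - alpha *: theta;
       bracket theta a0;
       bracket theta a1 - alpha *: theta;
       bracket chi theta - alpha *: (cosh chi - 1);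
       bracket chi a0 - alpha *: (cosh chi - 1);
       bracket chi a1 - alpha *: sinh chi].

Definition tilde_rel : set (ncs R ext_gen) :=
  let theta := gen Etheta in
  let a0 := gen Ea0 in let a1 := gen Ea1 in let chi := gen Echi in
  [set bracket a0 a1 - alpha *: (theta + a0);
       bracket theta a0;
       bracket theta a1;
       bracket chi theta;
       bracket chi a0 - alpha *: (cosh chi - 1);
       bracket chi a1 - alpha *: sinh chi].

Lemma fil_rel (X : finType) (x : X) (y z : ncs R X) :
  fil 1 (bracket (gen x) y - alpha *: z).
Proof. by apply: fil_B; [exact/fil_bracket/fil_gen|exact: fil_alphaZ]. Qed.

Lemma kappa_rel_fil : kappa_rel `<=` fil 1.
Proof. by move=> f [[->|->]|->]; exact: fil_rel. Qed.

Lemma ext_rel_fil : ext_rel `<=` fil 1.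
Proof.
by move=> f [[[[[->|->]|->]|->]|->]|->]; first [exact: fil_rel
  |exact/fil_bracket/fil_gen].
Qed.

Lemma tilde_rel_fil : tilde_rel `<=` fil 1.
Proof.
by move=> f [[[[[->|->]|->]|->]|->]|->]; first [exact: fil_rel
  |exact/fil_bracket/fil_gen].
Qed.

Lemma set0_fil (X : finType) : (set0 : set (ncs R X)) `<=` fil 1.
Proof. by []. Qed.

Definition kappa_pres : pres R := Pres kappa_rel_fil.
Definition ext_pres : pres R := Pres ext_rel_fil.
Definition tilde_pres : pres R := Pres tilde_rel_fil.

(* R[[alpha]][[z]], with z the only generator. *)
Definition line_pres : pres R := Pres (@set0_fil unit).

End Presentations.

(* Main.v *)
(** A continuous linear map out of an algebra of series is determined by its
values on words, so the presented algebras and their completed tensor products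
have the expected universal properties: the Hopf structure maps can be given
on generators, and all the Hopf axioms can be checked there.

With [E = exp chi], the light-cone coordinates [a0 + a1] and [a0 - a1] are
skew-primitive, [Delta (a0 + a1) = (a0 + a1) (x) 1 + E (x) (a0 + a1)] and
[Delta (a0 - a1) = (a0 - a1) (x) 1 + E^-1 (x) (a0 - a1)], while [theta - a0] is
primitive and central. In these coordinates the compatibility of the relations
with the coproduct and the antipode reduces to [E E^-1 = 1] and to
[[E, x] = E [chi, x]] when [[chi, x]] commutes with [chi].

Non-triviality is an obstruction in total degree two, where it says that the
two Lie bialgebras of linear parts differ. Let [u0], [u1] and [x] be the images
of [a0], [a1] and [chi] under an isomorphism from the tensor product. The
relations [[u0, u1] = alpha u0] and [[x, u1] = alpha sinh x] force the
coefficients of [u0] on [a0] and [a1] and that of [x] on [a0] to vanish. Then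
the antisymmetric part of [Delta u1] on [chi /\ a0] vanishes as well; as it is
also the coefficient of [u1] on [a1], the first relation now makes the whole
linear part of [u0] zero, which is impossible for the image of a generator. *)

From HB Require Import structures.
Require Import Defs.
From mathcomp Require Import all_boot all_order all_algebra.
From mathcomp Require Import all_classical all_reals.

Set Implicit Arguments.
Unset Strict Implicit.
Unset Printing Implicit Defensive.

Import GRing.Theory Num.Theory.
Local Open Scope classical_set_scope.
Local Open Scope ring_scope.

(** Three obstacles shape the construction. The maps of the antipode axioms, multiplication after
    [S (x) id] or [id (x) S], are linear but not multiplicative, so agreement on generators does not
    spread by itself; what spreads is vanishing, since such a map kills the whole one-sided ideal of
    each element of the tensor square that meets a zero, and every nonempty word has a first and a
    last letter. For the same reason maps out of a completed tensor product are needed for factors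
    that are only linear; they are defined by sorting the letters of each word into its two halves.
    Finally, a Hopf isomorphism is only assumed continuous, which says nothing about degrees. The
    counit supplies them: an element of counit zero has order at least one, so both directions of
    the isomorphism preserve the filtration and can be compared in total degree two. In that degree
    [cosh chi - 1] contributes nothing on the right of a relation, where it carries a factor
    [alpha], and [sinh chi] counts as [chi]. *)

Section FpsTheory.
Variable R : realType.
Implicit Types a b : fps R.

Lemma fpsE_mul a b n : (a * b) n = \sum_(i < n.+1) a i * b (n - i)%N.
Proof. by []. Qed.

Lemma fpsE_mul0 a b : (a * b) 0 = a 0 * b 0.
Proof. by rewrite fpsE_mul big_ord1. Qed.

Lemma fps_alphaM0 b : (alpha * b) 0 = 0.
Proof. by rewrite fpsE_mul0 mul0r. Qed.

Lemma fps_alphaMS b n : (alpha * b) n.+1 = b n.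
Proof.
rewrite fpsE_mul !big_ord_recl /= mul0r add0r mul1r /= subSS subn0.
by rewrite big1 ?addr0// => i _; rewrite mul0r.
Qed.

(** Dividing by [alpha] shifts the coefficients. This turns the order of a scalar into a power of
    [alpha], the only scalar whose degree the filtration axioms mention. *)
Lemma fps_fil_factor k a : fps_fil k a -> exists b, a = alpha ^+ k * b.
Proof.
elim: k a => [|k IHk] a ak; first by exists a; rewrite mul1r.
have [|b bE] := IHk (fun n => a n.+1).
  by move=> n nk; apply: ak.
exists b; rewrite exprS -mulrA -bE; apply/funext => -[|n].
  by rewrite fps_alphaM0 ak.
by rewrite fps_alphaMS.
Qed.

Lemma fpsC1 : fpsC 1 = 1 :> fps R.
Proof. by apply/funext => -[|n]. Qed.

Lemma fpsC0 : fpsC 0 = 0 :> fps R.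
Proof. by apply/funext => -[|n]. Qed.

Lemma fpsCD (x y : R) : fpsC (x + y) = fpsC x + fpsC y.
Proof.
apply/funext => -[|n] //.
exact: (esym (addr0 (0 : R))).
Qed.

Lemma fpsCN (x : R) : fpsC (- x) = - fpsC x.
Proof.
apply/funext => -[|n] //.
exact: (esym (oppr0 R)).
Qed.

Lemma fpsCM (x y : R) : fpsC (x * y) = fpsC x * fpsC y.
Proof.
apply/funext => -[|n]; first by rewrite fpsE_mul0.
rewrite fpsE_mul big_ord_recl /= mulr0 add0r big1// => i _.
by rewrite mul0r.
Qed.

Lemma fpsCn n : fpsC n%:R = n%:R :> fps R.
Proof. by elim: n => [|n IHn]; rewrite ?fpsC0// !mulrS fpsCD fpsC1 IHn. Qed.

End FpsTheory.

(** * Calculus in filtered algebras *)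

Section FilAlgCalculus.
Variables (R : realType) (A : filAlgType R).
Implicit Types (x y z : A) (a : fps R) (c d : nat -> R).

Lemma filW m n x : (m <= n)%N -> fil n x -> fil m x.
Proof. by move=> mn; exact: fil_le. Qed.

Lemma fil_eq x y : (forall n, fil n (x - y)) -> x = y.
Proof. by move=> xy; apply: subr0_eq; exact: fil_separated. Qed.

Lemma fil_sum n (I : Type) (r : seq I) (p : pred I) (F : I -> A) :
  (forall i, p i -> fil n (F i)) -> fil n (\sum_(i <- r | p i) F i).
Proof. by move=> Fn; elim/big_ind: _ => //; [exact: fil_0|exact: fil_D]. Qed.

Lemma fil_scale_fps k n a x : fps_fil k a -> fil n x -> fil (k + n)%N (a *: x).
Proof.
move=> /fps_fil_factor[b ->] xn.
have -> : (alpha ^+ k * b) *: x = (alpha ^+ k *: 1) * (b *: x).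
  by rewrite -scalerAl mul1r scalerA.
apply: fil_M; last by rewrite -[x]mul1r scalerAl; exact: fil_Ml.
elim: k => [|k IHk]; first by rewrite fil_setT.
rewrite exprS -scalerA -[_ *: 1 in X in fil _ X]mul1r scalerAl.
by rewrite -add1n; apply: fil_M => //; exact: fil_alpha.
Qed.

Lemma fil_scale n a x : fil n x -> fil n (a *: x).
Proof. by move=> xn; rewrite -[n]add0n; exact: fil_scale_fps. Qed.

Lemma fil_exp k x : fil 1 x -> fil k (x ^+ k).
Proof.
move=> x1; elim: k => [|k IHk]; first by rewrite fil_setT.
by rewrite exprS -add1n; exact: fil_M.
Qed.

Lemma fil_trans n x y z : fil n (x - y) -> fil n (y - z) -> fil n (x - z).
Proof. by move=> xy yz; rewrite -(subrKA y); exact: fil_D. Qed.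

(** Two is invertible in [R]. This recovers [a0] and [a1] from the light-cone coordinates, which
    determine only their doubles. *)
Lemma addxx_inj x y : x + x = y + y -> x = y.
Proof.
move=> xy; have E z : z = fpsC 2^-1 *: (z + z).
  rewrite -mulr2n -scaler_nat scalerA -fpsCn -fpsCM mulVf ?fpsC1 ?scale1r//.
  by rewrite pnatr_eq0.
by rewrite (E x) xy -E.
Qed.

Lemma bracket_eq0 x y : (bracket x y = 0) <-> x * y = y * x.
Proof. by rewrite /bracket; split=> [/subr0_eq|->]; rewrite ?subrr. Qed.

Lemma bracketC x y : bracket x y = - bracket y x.
Proof. by rewrite /bracket opprB. Qed.

Lemma bracketDl x y z : bracket (x + y) z = bracket x z + bracket y z.
Proof. by rewrite /bracket mulrDl mulrDr opprD addrACA. Qed.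

Lemma bracketDr x y z : bracket x (y + z) = bracket x y + bracket x z.
Proof. by rewrite /bracket mulrDl mulrDr opprD addrACA. Qed.

Lemma bracketNl x z : bracket (- x) z = - bracket x z.
Proof. by rewrite /bracket mulNr mulrN -opprB opprK addrC. Qed.

Lemma bracketNr x z : bracket x (- z) = - bracket x z.
Proof. by rewrite bracketC bracketNl -bracketC. Qed.

Lemma bracketZr a x z : bracket x (a *: z) = a *: bracket x z.
Proof. by rewrite /bracket -scalerAl -scalerAr scalerBr. Qed.

Lemma bracketMl x y z : bracket (x * y) z = x * bracket y z + bracket x z * y.
Proof. by rewrite /bracket mulrBr mulrBl !mulrA addrA subrK. Qed.

Lemma bracketMr x y z : bracket x (y * z) = y * bracket x z + bracket x y * z.
Proof. by rewrite bracketC bracketMl opprD -mulrN -mulNr -!bracketC. Qed.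

Lemma bracketxx x : bracket x x = 0.
Proof. by rewrite /bracket subrr. Qed.

Definition psum c x n := \sum_(k < n) fpsC (c k) *: x ^+ k.

Lemma psum_le c x m n : fil 1 x -> (n <= m)%N -> fil n (psum c x m - psum c x n).
Proof.
move=> x1 /subnKC <-; elim: (m - n)%N => [|k IHk].
  by rewrite addn0 subrr; exact: fil_0.
rewrite addnS; apply: fil_trans IHk.
rewrite /psum big_ord_recr /= [X in X - _]addrC addrK; apply: fil_scale.
by apply: (filW (leq_addr k n)); exact: fil_exp.
Qed.

(** Completeness provides a limit, so the default value of [powser] is not taken; the error after
    [n] terms has order [n] because [x ^+ k] has order [k]. *)
Lemma powserP c x n : fil 1 x -> fil n (powser c x - psum c x n).
Proof.
move=> x1; have [l lP] : exists l, forall n, fil n (l - psum c x n).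
  apply: fil_complete => m; rewrite /psum big_ord_recr /= [X in X - _]addrC addrK.
  exact/fil_scale/fil_exp.
have : fil_cvg (psum c x) (powser c x).
  rewrite /powser; case: xgetP => [y -> //|/(_ l) []] m.
  exists m => k mk; exact: (filW mk (lP _)).
move=> /(_ n)[N NP].
apply: (@fil_trans _ _ (psum c x (maxn N n))); first by apply: NP; exact: leq_maxl.
by apply: psum_le => //; exact: leq_maxr.
Qed.

(** Limits are unique by separatedness; an identity of power series is thereby reduced to estimates
    on partial sums. *)
Lemma powser_uniq c x y : fil 1 x -> (forall n, fil n (y - psum c x n)) ->
  powser c x = y.
Proof.
move=> x1 yP; apply: fil_eq => n; apply: fil_trans (powserP _ _ x1) _.
by rewrite -opprB; apply: fil_N; exact: yP.
Qed.

Lemma powserD c d x : fil 1 x ->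
  powser (fun k => c k + d k) x = powser c x + powser d x.
Proof.
move=> x1; apply: powser_uniq => // n.
have -> : psum (fun k => c k + d k) x n = psum c x n + psum d x n.
  by rewrite -big_split; apply: eq_bigr => k _; rewrite fpsCD scalerDl.
by rewrite opprD addrACA; apply: fil_D; exact: powserP.
Qed.

Lemma powserN c x : fil 1 x -> powser (fun k => - c k) x = - powser c x.
Proof.
move=> x1; apply: powser_uniq => // n.
have -> : psum (fun k => - c k) x n = - psum c x n.
  by rewrite -sumrN; apply: eq_bigr => k _; rewrite fpsCN scaleNr.
by rewrite -opprD; apply: fil_N; exact: powserP.
Qed.

Lemma powser_opp c x : fil 1 x ->
  powser c (- x) = powser (fun k => (-1) ^+ k * c k) x.
Proof.
move=> x1; apply: powser_uniq; first exact: fil_N.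
move=> n; have -> : psum c (- x) n = psum (fun k => (-1) ^+ k * c k) x n.
  apply: eq_bigr => k _; rewrite [(- x) ^+ k]exprNn -signr_odd.
  rewrite -[X in _ = fpsC (X * _) *: _]signr_odd.
  by case: (odd k); rewrite ?mul1r// !mulN1r fpsCN scalerN scaleNr.
exact: powserP.
Qed.

Lemma powser_comm c x y : fil 1 x -> GRing.comm y x -> GRing.comm y (powser c x).
Proof.
move=> x1 yx; apply: fil_eq => n.
have yp : y * psum c x n = psum c x n * y.
  rewrite mulr_sumr mulr_suml; apply: eq_bigr => k _.
  by rewrite -scalerAr -scalerAl (commrX k yx).
apply: (@fil_trans _ _ (y * psum c x n)).
  by rewrite -mulrBr; apply: fil_Ml; exact: powserP.
rewrite yp -mulrBl; apply: fil_Mr.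
by rewrite -opprB; apply: fil_N; exact: powserP.
Qed.

Definition fexp x : A := powser (fun k => k`!%:R^-1) x.

Lemma cosh_sinhD x : fil 1 x -> cosh x + sinh x = fexp x.
Proof.
move=> x1; rewrite -powserD//; congr (powser _ x); apply/funext => k.
by case: odd; rewrite ?addr0 ?add0r.
Qed.

Lemma cosh_sinhB x : fil 1 x -> cosh x - sinh x = fexp (- x).
Proof.
move=> x1; rewrite -powserN// -powserD// [RHS]powser_opp//.
congr (powser _ x); apply/funext => k; rewrite -signr_odd.
by case: odd; rewrite ?expr0 ?expr1 ?mul1r ?mulN1r ?add0r ?oppr0 ?addr0.
Qed.

Lemma cosh_fil x : fil 1 x -> fil 2 (cosh x - 1).
Proof.
move=> x1; have := powserP (fun k => if odd k then 0 else k`!%:R^-1) 2 x1.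
rewrite /psum !big_ord_recr big_ord0 /= fpsC0 scale0r addr0 add0r expr0.
by rewrite invr1 fpsC1 scale1r.
Qed.

Lemma sinh_fil2 x : fil 1 x -> fil 2 (sinh x - x).
Proof.
move=> x1; have := powserP (fun k => if odd k then k`!%:R^-1 else 0) 2 x1.
rewrite /psum !big_ord_recr big_ord0 /= fpsC0 scale0r !add0r expr1.
by rewrite invr1 fpsC1 scale1r.
Qed.

Lemma sinh_fil x : fil 1 x -> fil 1 (sinh x).
Proof.
by move=> x1; rewrite -[sinh x](subrK x); apply: fil_D => //;
  apply: (@filW 1 2) => //; exact: sinh_fil2.
Qed.

Lemma fexp0 : fexp 0 = 1.
Proof.
apply: powser_uniq; first exact: fil_0.
case=> [|n]; first by rewrite fil_setT.
rewrite /psum big_ord_recl /= big1 ?addr0 => [|k _].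
  by rewrite expr0 invr1 fpsC1 scale1r subrr; exact: fil_0.
by rewrite expr0n /= scaler0.
Qed.

Lemma fexp_comm x y : fil 1 x -> GRing.comm y x -> GRing.comm y (fexp x).
Proof. exact: powser_comm. Qed.

Lemma fexpD x y : fil 1 x -> fil 1 y -> GRing.comm x y ->
  fexp (x + y) = fexp x * fexp y.
Proof.
move=> x1 y1 xy; apply: powser_uniq; first exact: fil_D.
case=> [|n]; first by rewrite fil_setT.
pose e k : fps R := fpsC k`!%:R^-1.
pose F i j := (e i *: x ^+ i) * (e j *: y ^+ j).
set N := n.+1.
apply: (@fil_trans _ _ (psum (fun k => k`!%:R^-1) x N * fexp y)).
  by rewrite -mulrBl; apply/fil_Mr/powserP.
apply: (@fil_trans _ _ (psum (fun k => k`!%:R^-1) x N *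
                        psum (fun k => k`!%:R^-1) y N)).
  by rewrite -mulrBr; apply/fil_Ml/powserP.
(* By the binomial formula, the truncated series of the sum is the triangle [i + j <= n] of the
   double sum of the [F i j]. *)
have -> : psum (fun k => k`!%:R^-1) (x + y) N =
          \sum_(i < N) \sum_(j < (n - i).+1) F i j.
  rewrite -(sum_triangle F); apply: eq_bigr => k _.
  rewrite addrC (exprDn_comm _ (esym xy)) scaler_sumr; apply: eq_bigr => i _.
  rewrite /F -scalerAl -scalerAr scalerA -(commrX _ (esym (commrX _ (esym xy)))).
  rewrite -scaler_nat scalerA -/(fpsC _) -fpsCn -!fpsCM; congr (fpsC _ *: _).
  have ik : (i <= k)%N by rewrite -ltnS.
  rewrite -(bin_fact ik) !natrM.
  have f0 m : m`!%:R != 0 :> R by rewrite pnatr_eq0 -lt0n fact_gt0.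
  have b0 : 'C(k, i)%:R != 0 :> R by rewrite pnatr_eq0 -lt0n bin_gt0.
  by rewrite !invfM mulrC mulVKf.
(* The product of the truncations is the full square; what lies outside the triangle has
   [i + j > n], hence order at least [N]. *)
rewrite mulr_suml -sumrB; apply: fil_sum => i _.
rewrite mulr_sumr -[X in X - _](big_mkord xpredT (fun j => F i j)).
rewrite -[X in _ - X](big_mkord xpredT (fun j => F i j)).
rewrite (@big_cat_nat _ _ _ (n - i).+1)//=; last by rewrite ltnS leq_subr.
rewrite [X in X - _]addrC addrK big_nat; apply: fil_sum => j /andP[nij _].
apply: (@filW _ (i + j)%N); first by rewrite -leq_subLR subSn// -ltnS.
by apply: fil_M; exact/fil_scale/fil_exp.
Qed.

Lemma fexpNr x : fil 1 x -> fexp x * fexp (- x) = 1.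
Proof.
move=> x1; rewrite -fexpD ?subrr ?fexp0//; first exact: fil_N.
by rewrite /GRing.comm mulrN mulNr.
Qed.

Lemma fexpNl x : fil 1 x -> fexp (- x) * fexp x = 1.
Proof. by move=> x1; rewrite -{2}[x]opprK fexpNr//; exact: fil_N. Qed.

Lemma bracket_exp x y k : GRing.comm x (bracket x y) ->
  bracket (x ^+ k.+1) y = x ^+ k * bracket x y *+ k.+1.
Proof.
move=> xc; elim: k => [|k IHk]; first by rewrite expr1 mul1r.
rewrite exprS bracketMl IHk mulrnAr mulrA -exprS.
by rewrite [bracket x y * _](commrX _ (esym xc)) -mulrSr.
Qed.

Lemma bracket_fexp x y : fil 1 x -> GRing.comm x (bracket x y) ->
  bracket (fexp x) y = fexp x * bracket x y.
Proof.
move=> x1 xc; apply: fil_eq => n.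
(* The constant term drops out and the factor [k.+1] turns [k.+1] factorial into [k] factorial. The
   index thus falls by one, whence the truncation at [n.+1] against the truncation at [n]. *)
have H : bracket (psum (fun k => k`!%:R^-1) x n.+1) y =
         psum (fun k => k`!%:R^-1) x n * bracket x y.
  rewrite /bracket mulr_suml mulr_sumr -sumrB big_ord_recl mulr_suml.
  rewrite expr0 -scalerAl -scalerAr mul1r mulr1 subrr add0r.
  apply: eq_bigr => k _; rewrite -scalerAl -scalerAr -scalerBr.
  rewrite -[X in _ *: X = _]/(bracket (x ^+ lift ord0 k) y) lift0 bracket_exp//.
  rewrite -scaler_nat scalerA -scalerAl.
  rewrite -fpsCn -fpsCM factS natrM invfM mulrAC mulVf ?mul1r//.
  by rewrite pnatr_eq0.
apply: (@fil_trans _ _ (bracket (psum (fun k => k`!%:R^-1) x n.+1) y)).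
  rewrite -bracketNl -bracketDl; apply: fil_bracket.
  by apply: (filW (leqnSn n)); exact: powserP.
rewrite H -mulrBl; apply: fil_Mr.
by rewrite -opprB; apply: fil_N; exact: powserP.
Qed.

End FilAlgCalculus.

(** * Filtered linear maps and series in words *)

(** Preserving each step of the filtration is stronger than continuity, but every map constructed
    here does so, and density arguments can then be run at a fixed degree without moduli of
    continuity. *)
Record fhom (R : realType) (A B : filAlgType R) := FHom {
  fh :> {linear A -> B};
  fhP : forall n x, fil n x -> fil n (fh x) }.

Definition linear_of (R : realType) (A B : lmodType (fps R)) (f : A -> B)
  (lf : linear f) : {linear A -> B} :=
  HB.pack f (GRing.isLinear.Build (fps R) A B *:%R f lf).

Definition mkfhom (R : realType) (A B : filAlgType R) (f : A -> B)
  (lf : linear f) (ff : forall n x, fil n x -> fil n (f x)) : fhom A B :=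
  @FHom R A B (linear_of lf) ff.

(** Multiplicativity is a predicate on linear maps rather than a bundled structure: the universal
    maps are built as linear maps, some of them stay merely linear, and the others are shown
    multiplicative afterwards. *)
Definition fmult (R : realType) (A B : filAlgType R) (h : A -> B) : Prop :=
  h 1 = 1 /\ forall x y, h (x * y) = h x * h y.

Definition lrmorphism_of (R : realType) (A B : filAlgType R) (h : fhom A B)
    (hM : fmult h) : {lrmorphism A -> B} :=
  HB.pack (h : A -> B) (GRing.isLinear.Build (fps R) A B *:%R h (linearP h))
    (GRing.isMonoidMorphism.Build A B h hM).

Section FHom.
Variable R : realType.
Implicit Types A B C : filAlgType R.

Lemma fhZ A B (h : fhom A B) a x : h (a *: x) = a *: h x.
Proof. exact: (linearZZ h a x). Qed.

Lemma fhD A B (h : fhom A B) x y : h (x + y) = h x + h y.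
Proof. exact: raddfD. Qed.

Lemma fhN A B (h : fhom A B) x : h (- x) = - h x.
Proof. exact: raddfN. Qed.

Lemma fhB A B (h : fhom A B) x y : h (x - y) = h x - h y.
Proof. exact: raddfB. Qed.

Lemma fh0 A B (h : fhom A B) : h 0 = 0.
Proof. exact: raddf0. Qed.

Lemma fh_sum A B (h : fhom A B) I (r : seq I) (p : pred I) G :
  h (\sum_(i <- r | p i) G i) = \sum_(i <- r | p i) h (G i).
Proof. exact: raddf_sum. Qed.

Lemma fid_subproof A n (x : A) : fil n x -> fil n x. Proof. by []. Qed.
Definition fid A : fhom A A := @FHom R A A idfun (@fid_subproof A).

Lemma fidE A (x : A) : fid A x = x.
Proof. by []. Qed.

Lemma fcomp_linear A B C (g : fhom B C) (f : fhom A B) : linear (g \o f).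
Proof. by move=> a x y; rewrite /= !linearP. Qed.
Lemma fcomp_fil A B C (g : fhom B C) (f : fhom A B) n x :
  fil n x -> fil n ((g \o f) x).
Proof. by move=> xn; exact/fhP/fhP. Qed.
Definition fcomp A B C (g : fhom B C) (f : fhom A B) : fhom A C :=
  mkfhom (fcomp_linear g f) (@fcomp_fil A B C g f).

Lemma fcompE A B C (g : fhom B C) (f : fhom A B) x : fcomp g f x = g (f x).
Proof. by []. Qed.

(** With multiplications available as filtered maps, an identity about a product with one factor
    fixed is an equality of linear maps, to be tested on words. *)
Lemma fmull_linear A (a : A) : linear (fun x => a * x).
Proof. by move=> b x y; rewrite mulrDr scalerAr. Qed.
Definition fmull A (a : A) : fhom A A :=
  mkfhom (fmull_linear a) (fun n x => @fil_Ml R A n a x).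

Lemma fmullE A (a x : A) : fmull a x = a * x.
Proof. by []. Qed.

Lemma fmulr_linear A (a : A) : linear (fun x => x * a).
Proof. by move=> b x y; rewrite mulrDl scalerAl. Qed.
Definition fmulr A (a : A) : fhom A A :=
  mkfhom (fmulr_linear a) (fun n x => @fil_Mr R A n x a).

Lemma fmulrE A (a x : A) : fmulr a x = x * a.
Proof. by []. Qed.

Lemma fzero_linear A B : linear (fun _ : A => 0 : B).
Proof. by move=> b x y; rewrite scaler0 addr0. Qed.
Definition fzero A B : fhom A B :=
  mkfhom (@fzero_linear A B) (fun n x _ => @fil_0 R B n).

Lemma fcomp_mult A B C (g : fhom B C) (f : fhom A B) :
  fmult g -> fmult f -> fmult (fcomp g f).
Proof.
move=> [g1 gM] [f1 fM]; split=> [|x y]; first by rewrite /= f1 g1.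
by rewrite /= fM gM.
Qed.

Lemma fid_mult A : fmult (fid A). Proof. by []. Qed.

Lemma fhom_continuous A B (h : fhom A B) : fil_continuous fil fil h.
Proof. by move=> n; exists n => x /(fhP h). Qed.

Lemma fmult_exp A B (h : fhom A B) x k : fmult h -> h (x ^+ k) = h x ^+ k.
Proof.
move=> [h1 hM]; elim: k => [|k IHk]; first by rewrite !expr0 h1.
by rewrite !exprS hM IHk.
Qed.

Lemma fmult_powser A B (h : fhom A B) c x : fmult h -> fil 1 x ->
  h (powser c x) = powser c (h x).
Proof.
move=> hM x1; apply/esym/powser_uniq; first exact: fhP.
move=> n; have -> : psum c (h x) n = h (psum c x n).
  by rewrite /psum fh_sum; apply: eq_bigr => k _; rewrite fhZ fmult_exp.
by rewrite -fhB; apply/fhP/powserP.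
Qed.

Lemma fmult_bracket A B (h : fhom A B) x y : fmult h ->
  h (bracket x y) = bracket (h x) (h y).
Proof. by move=> [_ hM]; rewrite /bracket raddfB /= !hM. Qed.

(** Applied to the zero ideal, this makes the kernel a closed ideal, so that a map which kills
    relations kills the closed ideal they generate. *)
Lemma closed_ideal_preimage A B (h : fhom A B) (J : set B) : fmult h ->
  closed_ideal J -> closed_ideal (h @^-1` J).
Proof.
move=> [_ hM] [J0 JB JM Jcl]; split=> /=.
- by rewrite /preimage /= raddf0.
- by move=> x y hx hy; rewrite /preimage /= raddfB; exact: JB.
- by move=> x y hy; rewrite /preimage /= !hM; exact: JM.
- move=> x clx; apply: Jcl => n; have [y Jy xy] := clx n.
  by exists (h y) => //; rewrite -fhB; exact: fhP.
Qed.

Lemma closed_ideal_zero A : closed_ideal [set 0 : A].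
Proof.
split=> //= [x y -> ->|x y ->|x clx]; first by rewrite subr0.
  by rewrite mulr0 mul0r.
by apply: fil_separated => n; have [y /= -> ] := clx n; rewrite subr0.
Qed.

End FHom.

Notation fop := GRing.converse.

(* An antipode is an algebra morphism into the opposite algebra. *)
HB.instance Definition _ (R : realType) (V : lmodType (fps R)) :=
  GRing.Zmodule_isLmodule.Build (fps R) (fop V)
    (@scalerA _ V) (@scale1r _ V) (@scalerDr _ V) (fun v a b => @scalerDl _ V v a b).

Section Opposite.
Variables (R : realType) (A : filAlgType R).

Lemma fop_scaleAl (a : fps R) (x y : fop A) : a *: (x * y) = (a *: x) * y.
Proof. exact: (@scalerAr _ A). Qed.
HB.instance Definition _ := GRing.Lmodule_isLalgebra.Build (fps R) (fop A)
  fop_scaleAl.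
Lemma fop_scaleAr (a : fps R) (x y : fop A) : a *: (x * y) = x * (a *: y).
Proof. exact: (@scalerAl _ A). Qed.
HB.instance Definition _ := GRing.Lalgebra_isAlgebra.Build (fps R) (fop A)
  fop_scaleAr.

Lemma fop_fil_M m n (x y : fop A) :
  (fil m : set A) x -> (fil n : set A) y -> (fil (m + n)%N : set A) (x * y).
Proof. by move=> xm yn; rewrite addnC; exact: fil_M. Qed.

HB.instance Definition _ := hasFiltration.Build R (fop A)
  (@fil_setT R A) (@fil_le R A) (@fil_0 R A) (@fil_B R A) fop_fil_M
  (@fil_alpha R A) (@fil_separated R A) (@fil_complete R A).

Lemma fop_expE (x : A) k : (x : fop A) ^+ k = x ^+ k :> A.
Proof. by elim: k => // k IHk; rewrite exprS exprSr -IHk. Qed.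

(** Powers of a single element do not see the order of multiplication. *)
Lemma fop_powserE c (x : A) : fil 1 x -> powser c (x : fop A) = powser c x :> A.
Proof.
move=> x1; apply: (@powser_uniq R (fop A)) => // n.
have -> : psum c (x : fop A) n = psum c x n.
  by apply: eq_bigr => k _; rewrite -fop_expE.
exact: (@powserP R A).
Qed.

End Opposite.

Section Words.
Variables (R : realType) (X : finType).
Local Notation F := (ncs R X).

Definition mono (w : seq X) : F := fun v => (v == w)%:R.

Lemma mono0 : mono [::] = 1. Proof. by []. Qed.
Lemma mono1 x : mono [:: x] = gen x. Proof. by []. Qed.

Lemma ncs_mulE (f g : F) w :
  (f * g) w = \sum_(i < (size w).+1) f (take i w) * g (drop i w).
Proof. by []. Qed.

Lemma mono_cat u v : mono (u ++ v) = mono u * mono v.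
Proof.
apply/funext => w; rewrite ncs_mulE /mono.
have [->|wuv] := eqVneq w (u ++ v).
  have uw : (size u < (size (u ++ v)).+1)%N by rewrite size_cat ltnS leq_addr.
  rewrite (bigD1 (Ordinal uw)) //= take_size_cat// drop_size_cat// !eqxx mulr1.
  rewrite big1 ?addr0// => i /eqP iu.
  case: eqP => [/(congr1 size) iE|_]; last by rewrite mul0r.
  case: iu; apply: val_inj => /=; rewrite -iE size_takel//.
  by rewrite -ltnS.
rewrite big1// => i _; case: eqP => [tE|_]; last by rewrite mul0r.
case: eqP => [dE|_]; last by rewrite mulr0.
by move: wuv; rewrite -(cat_take_drop i w) tE dE eqxx.
Qed.

Lemma mono_cons x v : mono (x :: v) = gen x * mono v.
Proof. by rewrite -cat1s mono_cat. Qed.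

Lemma ncs_sumE (I : Type) (r : seq I) (p : pred I) (G : I -> F) w :
  (\sum_(i <- r | p i) G i) w = \sum_(i <- r | p i) G i w.
Proof. by elim/big_ind2: _ => // a x b y <- <-. Qed.

Section LinearExtension.
Variables (B : filAlgType R) (phi : seq X -> B).
Hypothesis phiP : forall w, fil (size w) (phi w).

(** Words are grouped by length: [phiP] bounds the order of the terms of length [n], which makes
    these partial sums converge. *)
Definition lsum (f : F) n := \sum_(k < n) \sum_(w : k.-tuple X) f w *: phi w.

Lemma lsumS f n : lsum f n.+1 = lsum f n + \sum_(w : n.-tuple X) f w *: phi w.
Proof. by rewrite /lsum big_ord_recr. Qed.

Definition lext_fun (f : F) : B :=
  xget 0 [set l | forall n, fil n (l - lsum f n)].

Lemma lext_funP f n : fil n (lext_fun f - lsum f n).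
Proof.
rewrite /lext_fun; case: xgetP => [y -> //|/= nol].
have [l lP] : exists l, forall n, fil n (l - lsum f n).
  apply: fil_complete => m; rewrite lsumS [X in X - _]addrC addrK.
  apply: fil_sum => w _; apply: fil_scale; rewrite -[m in fil m](size_tuple w).
  exact: phiP.
by case: (nol l).
Qed.

Lemma lext_uniq f l : (forall n, fil n (l - lsum f n)) -> lext_fun f = l.
Proof.
move=> lP; apply: fil_eq => n; apply: fil_trans (lext_funP _ _) _.
by rewrite -opprB; apply: fil_N; exact: lP.
Qed.

Lemma lext_linear : linear lext_fun.
Proof.
move=> a f g; apply: lext_uniq => n.
have -> : lsum (a *: f + g) n = a *: lsum f n + lsum g n.
  rewrite /lsum scaler_sumr -big_split; apply: eq_bigr => k _ /=.
  rewrite scaler_sumr -big_split; apply: eq_bigr => w _ /=.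
  by rewrite scalerA -scalerDl.
rewrite opprD addrACA -scalerBr.
by apply: fil_D; [apply: fil_scale|]; exact: lext_funP.
Qed.

Lemma lext_fil n f : fil n f -> fil n (lext_fun f).
Proof.
move=> fn; rewrite -[lext_fun f](subrK (lsum f n)); apply: fil_D.
  exact: lext_funP.
apply: fil_sum => k _; apply: fil_sum => w _.
(* A series of order [n] gives a word of length [k < n] a coefficient of order [n - k] in [alpha],
   and this makes up for the missing degree. *)
rewrite -[n in fil n](subnK (ltnW (ltn_ord k))); apply: fil_scale_fps.
  by move=> j jk; apply: fn; rewrite size_tuple -ltn_subRL.
by rewrite -[k in fil k](size_tuple w); exact: phiP.
Qed.

Definition lext : fhom F B := mkfhom lext_linear lext_fil.

Lemma sum_tuple_eq (V : nmodType) (G : seq X -> V) w n :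
  (forall v, v != w -> G v = 0) ->
  \sum_(v : n.-tuple X) G v = if n == size w then G w else 0.
Proof.
move=> G0; case: eqVneq => [->|nw].
  rewrite (bigD1 (in_tuple w)) //= big1 ?addr0// => v vw; apply: G0.
  by apply: contraNneq vw => vw; apply/eqP/val_inj.
rewrite big1// => v _; apply: G0.
by apply: contraNneq nw => <-; rewrite size_tuple.
Qed.

Lemma lsum_mono w n : lsum (mono w) n = if (size w < n)%N then phi w else 0.
Proof.
elim: n => [|n IHn]; first by rewrite /lsum big_ord0 ltn0.
rewrite lsumS IHn (@sum_tuple_eq _ (fun v => mono w v *: phi v) w) => [|v vw].
  rewrite /mono eqxx scale1r ltnS; case: ltngtP => //= _; rewrite ?addr0 ?add0r//.
by rewrite /mono (negPf vw) scale0r.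
Qed.

Lemma lext_mono w : lext (mono w) = phi w.
Proof.
apply: lext_uniq => n; rewrite lsum_mono; case: ltnP => [_|nw].
  by rewrite subrr; exact: fil_0.
by rewrite subr0; exact: filW (phiP w).
Qed.

End LinearExtension.

(** The truncation drops only words of length at least [n], whatever power of [alpha] they carry. *)
Lemma mono_dense (f : F) n : fil n (f - lsum mono f n).
Proof.
have lE v : lsum mono f n v = if (size v < n)%N then f v else 0.
  rewrite /lsum; elim: n => [|m IHm]; first by rewrite big_ord0.
  rewrite big_ord_recr /=.
  transitivity ((\sum_(k < m) \sum_(w : k.-tuple X) f w *: mono w) v +
     (\sum_(w : m.-tuple X) f w *: mono w) v); first by [].
  rewrite IHm ncs_sumE.
  rewrite (@sum_tuple_eq _ (fun w => (f w *: mono w) v) v) => [|w wv].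
    transitivity ((if (size v < m)%N then f v else 0) +
      (if m == size v then f v * 1 else 0)).
      by congr (_ + _); case: eqP => // _; congr (_ * _); rewrite /mono eqxx.
    by rewrite mulr1 ltnS; case: ltngtP => //= _; rewrite ?addr0 ?add0r.
  transitivity (f w * mono w v) => //.
  by rewrite /mono eq_sym (negPf wv) mulr0.
move=> v k vk; transitivity (f v k - lsum mono f n v k) => //.
by rewrite lE (leq_ltn_trans _ vk) ?leq_addr// subrr.
Qed.

Lemma ncs_fhom_eq (B : filAlgType R) (g h : fhom F B) :
  (forall w, g (mono w) = h (mono w)) -> g =1 h.
Proof.
move=> gh f; apply: fil_eq => n.
apply: (@fil_trans _ _ _ _ (g (lsum mono f n))).
  by rewrite -fhB; apply/fhP/mono_dense.
have -> : g (lsum mono f n) = h (lsum mono f n).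
  rewrite /lsum !fh_sum; apply: eq_bigr => k _.
  by rewrite !fh_sum; apply: eq_bigr => w _; rewrite !fhZ gh.
by rewrite -fhB; apply/fhP; rewrite -opprB; apply/fil_N/mono_dense.
Qed.

Arguments lext : simpl never.

Section FreeMorphism.
Variables (B : filAlgType R) (g : X -> B).
Hypothesis g1 : forall x, fil 1 (g x).

Lemma prod_fil w : fil (size w) (\prod_(x <- w) g x).
Proof.
elim: w => [|x w IHw]; first by rewrite fil_setT.
by rewrite big_cons -[size _]add1n; exact: fil_M.
Qed.

Definition fext : fhom F B := lext prod_fil.

Arguments fext : simpl never.

Lemma fext_mono w : fext (mono w) = \prod_(x <- w) g x.
Proof. exact: lext_mono. Qed.

Lemma fext_gen x : fext (gen x) = g x.
Proof. by rewrite -mono1 fext_mono big_seq1. Qed.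

Lemma fext_mult : fmult fext.
Proof.
split=> [|f h]; first by rewrite -mono0 fext_mono big_nil.
(* Multiplicativity is checked one factor at a time, each time as an equality of linear maps tested
   on words. *)
have H w : fext (mono w * h) = fext (mono w) * fext h.
  apply: (@ncs_fhom_eq B (fcomp fext (fmull (mono w)))
    (fcomp (fmull (fext (mono w))) fext)) => v.
  by rewrite !(fcompE, fmullE) -mono_cat !fext_mono big_cat.
exact: (@ncs_fhom_eq B (fcomp fext (fmulr h)) (fcomp (fmulr (fext h)) fext)).
Qed.

End FreeMorphism.

Lemma fmult_mono (B : filAlgType R) (h : fhom F B) w : fmult h ->
  h (mono w) = \prod_(x <- w) h (gen x).
Proof.
move=> [h1 hM]; elim: w => [|x w IHw]; first by rewrite big_nil.
by rewrite mono_cons hM IHw big_cons.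
Qed.

End Words.

Arguments mono {R X} w.
Arguments lext : simpl never.
Arguments fext : simpl never.

(** * Maps out of presented algebras *)

Section AlgLift.
Variables (R : realType) (P : pres R).
Local Notation F := (ncs R (pgen P)).

Lemma alg_pi_fil n (f : F) : fil n f -> fil n (alg_pi f : alg P).
Proof. by move=> fn; exists f. Qed.

Definition fpi : fhom F (alg P) := @FHom R F (alg P) (@alg_pi R P) alg_pi_fil.

Lemma fpi_mult : fmult fpi. Proof. by split=> // x y; exact: rmorphM. Qed.

Lemma agen_fil x : fil 1 (agen P x).
Proof. exact/alg_pi_fil/fil_gen. Qed.

Section Descent.
Variables (B : filAlgType R) (u : fhom F B).
Hypothesis u0 : forall f, alg_ideal_set f -> u f = 0.

Definition adesc_fun (x : alg P) : B := u (repr x).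

Lemma adesc_funE f : adesc_fun (alg_pi f) = u f.
Proof. by apply: subr0_eq; rewrite /adesc_fun -fhB; apply: u0; exact: alg_repr_pi. Qed.

Lemma adesc_linear : linear adesc_fun.
Proof.
move=> a x y; rewrite -(alg_pi_repr x) -(alg_pi_repr y).
by rewrite -linearP !adesc_funE linearP.
Qed.

Lemma adesc_fil n x : fil n x -> fil n (adesc_fun x).
Proof. by move=> [f fn <-]; rewrite adesc_funE; exact: fhP. Qed.

Definition adesc : fhom (alg P) B := mkfhom adesc_linear adesc_fil.

Arguments adesc : simpl never.

Lemma adescE f : adesc (alg_pi f) = u f. Proof. exact: adesc_funE. Qed.

Lemma adesc_mult : fmult u -> fmult adesc.
Proof.
move=> [u1 uM]; split=> [|x y].
  by rewrite -[1 in LHS](rmorph1 (@alg_pi R P)) adescE.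
by rewrite -(alg_pi_repr x) -(alg_pi_repr y) -rmorphM !adescE.
Qed.

End Descent.

Arguments adesc : simpl never.

(** The kernel is a closed ideal, and [alg_ideal_set] is the smallest one containing the
    relations. *)
Lemma alg_ideal_ker (B : filAlgType R) (u : fhom F B) : fmult u ->
  (forall r, @prel R P r -> u r = 0) -> forall f, alg_ideal_set f -> u f = 0.
Proof.
move=> uM ur f /(_ [set g | u g = 0]); apply; split=> //.
exact: (closed_ideal_preimage uM (@closed_ideal_zero R B)).
Qed.

Lemma alg_lift (B : filAlgType R) (g : pgen P -> B) (g1 : forall x, fil 1 (g x)) :
  (forall r, @prel R P r -> fext g1 r = 0) ->
  exists h : fhom (alg P) B, fmult h /\ forall x, h (agen P x) = g x.
Proof.
move=> gr; have g0 := alg_ideal_ker (fext_mult g1) gr.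
exists (adesc g0); split; first exact/adesc_mult/fext_mult.
by move=> x; rewrite adescE fext_gen.
Qed.

Lemma alg_fhom_eq (B : filAlgType R) (g h : fhom (alg P) B) :
  (forall w, g (alg_pi (mono w)) = h (alg_pi (mono w))) -> g =1 h.
Proof.
move=> gh x; rewrite -(alg_pi_repr x).
exact: (@ncs_fhom_eq R _ B (fcomp g fpi) (fcomp h fpi)).
Qed.

Lemma alg_fmult_eq (B : filAlgType R) (g h : fhom (alg P) B) :
  fmult g -> fmult h -> (forall x, g (agen P x) = h (agen P x)) -> g =1 h.
Proof.
move=> gM hM gh; apply: alg_fhom_eq => w.
have := fmult_mono w (fcomp_mult gM fpi_mult).
have := fmult_mono w (fcomp_mult hM fpi_mult).
by move=> /= -> ->; apply: eq_bigr => x _; exact: gh.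
Qed.

Definition alg_word (w : seq (pgen P)) : alg P := \prod_(x <- w) agen P x.

Lemma alg_pi_mono w : alg_pi (mono w) = alg_word w.
Proof. exact: (fmult_mono w fpi_mult). Qed.

End AlgLift.

(** * Completed tensor products *)

Section Rename.
Variables (R : realType) (X Y : finType) (r : X -> Y).

Lemma rename_linear : linear (rename r : ncs R X -> ncs R Y).
Proof.
move=> a f g; apply/funext => w.
transitivity (a * rename r f w + rename r g w) => //.
by rewrite /rename big_distrr -big_split.
Qed.

Definition frename : fhom (ncs R X) (ncs R Y) :=
  mkfhom rename_linear (fun n f => @fil_rename R X Y r f n).
Arguments frename : simpl never.

Lemma frenameE f : frename f = rename r f. Proof. by []. Qed.

Lemma frename_mono v : frename (mono v) = mono (map r v).
Proof.
rewrite frenameE; apply/funext => w; rewrite /rename big_mkcond /=.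
rewrite (@sum_tuple_eq X (fps R)
  (fun u => if map r u == w then mono v u else 0) v); last first.
  by move=> u uv; rewrite /mono (negPf uv) if_same.
rewrite /mono eqxx (eq_sym _ w); case: (eqVneq w (map r v)) => [->|_].
  by rewrite size_map eqxx.
by rewrite if_same.
Qed.

(** Renaming agrees on words with the free extension of the letter map, whose multiplicativity is
    known. *)
Lemma frename_mult : fmult frename.
Proof.
have g1 x : fil 1 (gen (r x) : ncs R Y) by exact: fil_gen.
have E : frename =1 fext g1.
  apply: ncs_fhom_eq => w; rewrite frename_mono fext_mono.
  by elim: w => [|x w IHw]; rewrite ?big_nil// big_cons mono_cons IHw.
have [e1 eM] := fext_mult g1.
by split=> [|f g]; rewrite !E.
Qed.

End Rename.
Arguments frename {R X Y} r : simpl never.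

Lemma alg_pi_rel (R : realType) (P : pres R) r : @prel R P r -> alg_pi r = 0 :> alg P.
Proof.
move=> Pr; rewrite -(raddf0 (@alg_pi R P)); apply/alg_pi_eq; rewrite subr0.
by move=> J [_]; exact.
Qed.

Lemma alg_word_fil (R : realType) (P : pres R) w : fil (size w) (alg_word w : alg P).
Proof. exact: (prod_fil (@agen_fil R P)). Qed.

Lemma alg_word_cat (R : realType) (P : pres R) (u v : seq (pgen P)) :
  alg_word (u ++ v) = alg_word u * alg_word v.
Proof. exact: big_cat. Qed.

Lemma fmult_comm (R : realType) (P : pres R) (B : filAlgType R)
    (h : fhom (alg P) B) (c : B) : fmult h ->
  (forall x, c * h (agen P x) = h (agen P x) * c) -> forall x, c * h x = h x * c.
Proof.
move=> [h1 hM] hc.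
apply: (@alg_fhom_eq R P B (fcomp (fmull c) h) (fcomp (fmulr c) h)) => w.
rewrite !(fcompE, fmullE, fmulrE) alg_pi_mono.
elim: w => [|x w IHw]; first by rewrite /alg_word big_nil h1 mulr1 mul1r.
by rewrite /alg_word big_cons hM mulrA hc -mulrA IHw mulrA.
Qed.

Section TensorLift.
Variables (R : realType) (P Q : pres R).
Local Notation X := (pgen P).
Local Notation Y := (pgen Q).
Local Notation F := (ncs R (X + Y)%type).

Definition lpart (s : X + Y) : option X := if s is inl x then Some x else None.
Definition rpart (s : X + Y) : option Y := if s is inr y then Some y else None.
(** Erasing the letters of the other factor: since the two kinds of letters commute, the pair of
    erased words determines the class of a word. *)
Definition lword (w : seq (X + Y)) : seq X := pmap lpart w.
Definition rword (w : seq (X + Y)) : seq Y := pmap rpart w.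

Lemma lrword_size w : size w = (size (lword w) + size (rword w))%N.
Proof. by elim: w => //= -[x|y] w /= ->; rewrite ?addSn ?addnS. Qed.

Lemma lword_cat u v : lword (u ++ v) = lword u ++ lword v.
Proof. exact: pmap_cat. Qed.
Lemma rword_cat u v : rword (u ++ v) = rword u ++ rword v.
Proof. exact: pmap_cat. Qed.

Lemma lword_inl u : lword (map inl u) = u.
Proof. by elim: u => //= x u ->. Qed.
Lemma lword_inr u : lword (map inr u) = [::].
Proof. by elim: u. Qed.
Lemma rword_inl u : rword (map inl u) = [::].
Proof. by elim: u. Qed.
Lemma rword_inr u : rword (map inr u) = u.
Proof. by elim: u => //= x u ->. Qed.

Section Lift.
Variables (B : filAlgType R) (u : fhom (alg P) B) (v : fhom (alg Q) B).

Lemma tphi_fil w : fil (size w) (u (alg_word (lword w)) * v (alg_word (rword w))).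
Proof. by rewrite lrword_size; apply: fil_M; apply/fhP/alg_word_fil. Qed.

(** The value is prescribed on sorted words instead of extended multiplicatively from the letters,
    so that [u] and [v] may be merely linear, as the antipode axioms require. *)
Definition free_tlift : fhom F B := lext tphi_fil.
Arguments free_tlift : simpl never.

Lemma free_tlift_mono w :
  free_tlift (mono w) = u (alg_word (lword w)) * v (alg_word (rword w)).
Proof. exact: lext_mono. Qed.

Lemma free_tlift_inl a b f :
  free_tlift (mono a * frename inl f * mono b) =
  u (alg_word (lword a) * alg_pi f * alg_word (lword b)) *
  v (alg_word (rword a ++ rword b)).
Proof.
apply: (@ncs_fhom_eq R X B
  (fcomp free_tlift (fcomp (fmulr (mono b)) (fcomp (fmull (mono a)) (frename inl))))
  (fcomp (fmulr (v (alg_word (rword a ++ rword b))))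
   (fcomp u (fcomp (fmulr (alg_word (lword b)))
     (fcomp (fmull (alg_word (lword a))) (@fpi R P)))))) => w.
rewrite !(fcompE, fmullE, fmulrE) frename_mono -!mono_cat free_tlift_mono.
rewrite !(lword_cat, rword_cat) lword_inl rword_inl cats0 !alg_word_cat.
by rewrite [fpi _ _]alg_pi_mono.
Qed.

Lemma free_tlift_inr a b f :
  free_tlift (mono a * frename inr f * mono b) =
  u (alg_word (lword a ++ lword b)) *
  v (alg_word (rword a) * alg_pi f * alg_word (rword b)).
Proof.
apply: (@ncs_fhom_eq R Y B
  (fcomp free_tlift (fcomp (fmulr (mono b)) (fcomp (fmull (mono a)) (frename inr))))
  (fcomp (fmull (u (alg_word (lword a ++ lword b))))
   (fcomp v (fcomp (fmulr (alg_word (rword b)))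
     (fcomp (fmull (alg_word (rword a))) (@fpi R Q)))))) => w.
rewrite !(fcompE, fmullE, fmulrE) frename_mono -!mono_cat free_tlift_mono.
rewrite !(lword_cat, rword_cat) lword_inr rword_inr cats0 !alg_word_cat.
by rewrite [fpi _ _]alg_pi_mono.
Qed.

(** The map need not be multiplicative, so killing a relation does not imply killing its multiples;
    the relation is therefore tested between arbitrary factors [p] and [q], which density reduces to
    words. *)
Lemma free_tlift_rel f : @prel R (ctens P Q) f ->
  forall p q, free_tlift (p * f * q) = 0.
Proof.
move=> Pf p q.
apply: (@ncs_fhom_eq R _ B (fcomp free_tlift (fcomp (fmulr q) (fmulr f)))
  (fzero _ _)) => a; rewrite !(fcompE, fmulrE).
apply: (@ncs_fhom_eq R _ B (fcomp free_tlift (fmull (mono a * f)))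
  (fzero _ _)) => b; rewrite !(fcompE, fmullE).
case: Pf => [[[r Pr <-]|[r Qr <-]]|[x [y ->]]].
- by rewrite free_tlift_inl alg_pi_rel// mulr0 mul0r fh0 mul0r.
- by rewrite free_tlift_inr alg_pi_rel// mulr0 mul0r fh0 mulr0.
(* Both orders of the two letters sort to the same pair of words. *)
- rewrite /bracket mulrBr mulrBl fhB -!mono1 -!mono_cat !free_tlift_mono.
  by rewrite !(lword_cat, rword_cat) /= subrr.
Qed.

(** The kernel need not be an ideal, but the elements killed in every context [p * g * q] form a
    closed one. *)
Lemma free_tlift_ideal f : alg_ideal_set (f : ncs R (pgen (ctens P Q))) ->
  free_tlift f = 0.
Proof.
move=> /(_ [set g | forall p q, free_tlift (p * g * q) = 0]) H.
have := H _ 1 1; rewrite mul1r mulr1; apply; split; last exact: free_tlift_rel.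
split=> [p q|x y x0 y0 p q|x y y0|x clx p q].
- by rewrite mulr0 mul0r fh0.
- by rewrite mulrBr mulrBl fhB x0 y0 subrr.
- by split=> p q; [rewrite mulrA y0|rewrite mulrA -mulrA y0].
- apply: fil_separated => n; have [y y0 xy] := clx n.
  by rewrite -[free_tlift _]subr0 -(y0 p q) -fhB -mulrBl -mulrBr;
    apply/fhP/fil_Mr/fil_Ml.
Qed.

Definition tlift : fhom (alg (ctens P Q)) B := adesc free_tlift_ideal.

End Lift.
Arguments free_tlift : simpl never.
Arguments tlift : simpl never.

Definition tinl_free : fhom (ncs R X) (alg (ctens P Q)) :=
  fcomp (@fpi R (ctens P Q)) (frename inl).
Definition tinr_free : fhom (ncs R Y) (alg (ctens P Q)) :=
  fcomp (@fpi R (ctens P Q)) (frename inr).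

Lemma tinl_free_mult : fmult tinl_free.
Proof. by apply: fcomp_mult; [exact: fpi_mult|exact: frename_mult]. Qed.
Lemma tinr_free_mult : fmult tinr_free.
Proof. by apply: fcomp_mult; [exact: fpi_mult|exact: frename_mult]. Qed.

Lemma tinl_ideal f : alg_ideal_set f -> tinl_free f = 0.
Proof.
apply: (alg_ideal_ker tinl_free_mult) => r Pr.
by apply: (@alg_pi_rel R (ctens P Q)); left; left; exists r.
Qed.
Lemma tinr_ideal f : alg_ideal_set f -> tinr_free f = 0.
Proof.
apply: (alg_ideal_ker tinr_free_mult) => r Pr.
by apply: (@alg_pi_rel R (ctens P Q)); left; right; exists r.
Qed.

Definition tinl : fhom (alg P) (alg (ctens P Q)) := adesc tinl_ideal.
Definition tinr : fhom (alg Q) (alg (ctens P Q)) := adesc tinr_ideal.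
Arguments tinl : simpl never.
Arguments tinr : simpl never.

Lemma tinl_mult : fmult tinl. Proof. exact/adesc_mult/tinl_free_mult. Qed.
Lemma tinr_mult : fmult tinr. Proof. exact/adesc_mult/tinr_free_mult. Qed.

Lemma tensE x y : x \ox y = tinl x * tinr y. Proof. by []. Qed.

Lemma tinl_agen x : tinl (agen P x) = agen (ctens P Q) (inl x).
Proof.
by rewrite /tinl adescE fcompE -[gen x]mono1 frename_mono.
Qed.
Lemma tinr_agen x : tinr (agen Q x) = agen (ctens P Q) (inr x).
Proof.
by rewrite /tinr adescE fcompE -[gen x]mono1 frename_mono.
Qed.

Lemma tinlr_comm x y : tinl x * tinr y = tinr y * tinl x.
Proof.
move: y; apply: fmult_comm => [|y]; first exact: tinr_mult.
apply/esym; move: x; apply: fmult_comm => [|x]; first exact: tinl_mult.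
rewrite tinl_agen tinr_agen; apply/esym/bracket_eq0.
rewrite -(fmult_bracket _ _ (@fpi_mult R (ctens P Q))).
by apply: alg_pi_rel; right; exists x, y.
Qed.

Lemma tensx1 x : x \ox 1 = tinl x.
Proof. by rewrite tensE (tinr_mult.1) mulr1. Qed.
Lemma tens1x y : 1 \ox y = tinr y.
Proof. by rewrite tensE (tinl_mult.1) mul1r. Qed.
Lemma tens11 : (1 : alg P) \ox (1 : alg Q) = 1.
Proof. by rewrite tensx1 tinl_mult.1. Qed.

Implicit Types (x : alg P) (y : alg Q).

Lemma tensM x x' y y' : (x \ox y) * (x' \ox y') = (x * x') \ox (y * y').
Proof.
rewrite !tensE tinl_mult.2 tinr_mult.2 -!mulrA; congr (_ * _).
by rewrite !mulrA tinlr_comm.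
Qed.

Lemma tensDl x x' y : (x + x') \ox y = x \ox y + x' \ox y.
Proof. by rewrite !tensE fhD mulrDl. Qed.
Lemma tensDr x y y' : x \ox (y + y') = x \ox y + x \ox y'.
Proof. by rewrite !tensE fhD mulrDr. Qed.
Lemma tensNl x y : (- x) \ox y = - (x \ox y).
Proof. by rewrite !tensE fhN mulNr. Qed.
Lemma tensNr x y : x \ox (- y) = - (x \ox y).
Proof. by rewrite !tensE fhN mulrN. Qed.
Lemma tensBl x x' y : (x - x') \ox y = x \ox y - x' \ox y.
Proof. by rewrite tensDl tensNl. Qed.
Lemma tensBr x y y' : x \ox (y - y') = x \ox y - x \ox y'.
Proof. by rewrite tensDr tensNr. Qed.
Lemma tens_fil m n x y : fil m x -> fil n y -> fil (m + n)%N (x \ox y).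
Proof. by move=> xm yn; rewrite tensE; apply: fil_M; exact: fhP. Qed.

Lemma tens_fill n x y : fil n x -> fil n (x \ox y).
Proof. by move=> xn; rewrite tensE; apply/fil_Mr/fhP. Qed.
Lemma tens_filr n x y : fil n y -> fil n (x \ox y).
Proof. by move=> xn; rewrite tensE; apply/fil_Ml/fhP. Qed.

(** Words are pure tensors, hence pure tensors suffice to compare filtered linear maps on the
    completed tensor product. *)
Lemma alg_word_tens (w : seq (pgen (ctens P Q))) :
  alg_word w = alg_word (lword w) \ox alg_word (rword w).
Proof.
elim: w => [|s w IHw]; first by rewrite /alg_word !big_nil tens11.
rewrite [LHS]big_cons -/(alg_word w) IHw; case: s => x /=.
  rewrite -tinl_agen -tensx1 tensM mul1r; congr (_ \ox _).
  by rewrite [RHS]big_cons.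
rewrite -tinr_agen -tens1x tensM mul1r; congr (_ \ox _).
by rewrite [RHS]big_cons.
Qed.

Lemma tens_fhom_eq (B : filAlgType R) (g h : fhom (alg (ctens P Q)) B) :
  (forall x y, g (x \ox y) = h (x \ox y)) -> g =1 h.
Proof. by move=> gh; apply: alg_fhom_eq => w; rewrite alg_pi_mono alg_word_tens. Qed.

Lemma tliftE (B : filAlgType R) (u : fhom (alg P) B) (v : fhom (alg Q) B) x y :
  tlift u v (x \ox y) = u x * v y.
Proof.
rewrite -{2}(alg_pi_repr x) -{2}(alg_pi_repr y) /tens.
move: (repr x) (repr y) => f g; rewrite -rmorphM adescE.
rewrite -[f]/(idfun f) -[g]/(idfun g) -!frenameE.
apply: (@ncs_fhom_eq R X B (fcomp (free_tlift u v) (fcomp (fmulr (frename inr g))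
  (frename inl))) (fcomp (fmulr (v (alg_pi g))) (fcomp u (@fpi R P)))) => a.
apply: (@ncs_fhom_eq R Y B (fcomp (free_tlift u v) (fcomp (fmull (frename inl (mono a)))
  (frename inr))) (fcomp (fmull (u (alg_pi (mono a)))) (fcomp v (@fpi R Q)))) => b.
rewrite !(fcompE, fmullE, fmulrE) !frename_mono -mono_cat free_tlift_mono.
rewrite lword_cat rword_cat lword_inl rword_inl lword_inr rword_inr cats0.
by rewrite -!alg_pi_mono.
Qed.

Lemma tlift_mult (B : filAlgType R) (u : fhom (alg P) B) (v : fhom (alg Q) B) :
  fmult u -> fmult v -> (forall x y, u x * v y = v y * u x) ->
  fmult (tlift u v).
Proof.
move=> [u1 uM] [v1 vM] uv; split=> [|s t].
  by rewrite -tens11 tliftE u1 v1 mulr1.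
apply: (@tens_fhom_eq B (fcomp (tlift u v) (fmulr t))
  (fcomp (fmulr (tlift u v t)) (tlift u v))) => x y.
apply: (@tens_fhom_eq B (fcomp (tlift u v) (fmull (x \ox y)))
  (fcomp (fmull (tlift u v (x \ox y))) (tlift u v))) => x' y'.
rewrite !(fcompE, fmullE) tensM !tliftE uM vM -!mulrA; congr (_ * _).
by rewrite !mulrA uv.
Qed.

End TensorLift.
Arguments tlift : simpl never.
Arguments tinl {R P Q} : simpl never.
Arguments tinr {R P Q} : simpl never.

Section TensorMap.
Variable R : realType.
Implicit Types P Q : pres R.

Definition tmap P Q P' Q' (f : fhom (alg P) (alg P')) (g : fhom (alg Q) (alg Q')) :
  fhom (alg (ctens P Q)) (alg (ctens P' Q')) := tlift (fcomp tinl f) (fcomp tinr g).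

Lemma tmapE P Q P' Q' (f : fhom (alg P) (alg P')) (g : fhom (alg Q) (alg Q')) x y :
  tmap f g (x \ox y) = f x \ox g y.
Proof. exact: tliftE. Qed.

Lemma tmap_mult P Q P' Q' (f : fhom (alg P) (alg P')) (g : fhom (alg Q) (alg Q')) :
  fmult f -> fmult g -> fmult (tmap f g).
Proof.
move=> fM gM; apply: tlift_mult => [||x y]; last exact: tinlr_comm.
  exact: fcomp_mult (@tinl_mult R P' Q') fM.
exact: fcomp_mult (@tinr_mult R P' Q') gM.
Qed.

Lemma tmap_tensor_map P Q P' Q' (f : fhom (alg P) (alg P'))
    (g : fhom (alg Q) (alg Q')) : is_tensor_map f g (tmap f g).
Proof. by split; [exact: fhom_continuous|exact: tmapE]. Qed.

Definition tassoc P Q S :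
    fhom (alg (ctens (ctens P Q) S)) (alg (ctens P (ctens Q S))) :=
  tlift (tlift tinl (fcomp tinr tinl)) (fcomp tinr tinr).

Lemma tassocE P Q S (x : alg P) (y : alg Q) (z : alg S) :
  tassoc P Q S ((x \ox y) \ox z) = x \ox (y \ox z).
Proof.
rewrite /tassoc !tliftE !fcompE !tensE -mulrA; congr (_ * _).
by rewrite (@tinr_mult R P (ctens Q S)).2.
Qed.

Lemma tassoc_mult P Q S : fmult (tassoc P Q S).
Proof.
have M1 := @tinl_mult R P (ctens Q S); have M2 := @tinr_mult R P (ctens Q S).
have M3 := @tinl_mult R Q S; have M4 := @tinr_mult R Q S.
apply: tlift_mult => [||t z].
- apply: tlift_mult => [||x y]; [by []|exact: fcomp_mult|exact: tinlr_comm].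
- exact: fcomp_mult.
- apply: (@tens_fhom_eq R P Q _
    (fcomp (fmulr (fcomp tinr tinr z)) (tlift tinl (fcomp tinr tinl)))
    (fcomp (fmull (fcomp tinr tinr z)) (tlift tinl (fcomp tinr tinl)))) => x y.
  rewrite !(fcompE, fmullE, fmulrE) tliftE fcompE [RHS]mulrA -tinlr_comm -!mulrA.
  by congr (_ * _); rewrite -!M2.2 tinlr_comm.
Qed.

End TensorMap.
Arguments tmap : simpl never.
Arguments tassoc : simpl never.

(** * Hopf structures *)

(** Order one only forces the [alpha]-free part of the constant term to vanish. A counit with values
    in power series needs the whole coefficient of the empty word to be zero. *)
Definition augmented (R : realType) (P : pres R) : Prop :=
  forall r, @prel R P r -> r [::] = 0.

Section Counit.
Variables (R : realType) (P : pres R).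
Hypothesis augP : augmented P.

Lemma ncs_mul_nil (X : finType) (f g : ncs R X) : (f * g) [::] = f [::] * g [::].
Proof. by rewrite ncs_mulE big_ord1. Qed.

Lemma alg_ideal_nil f : @alg_ideal_set R P f -> f [::] = 0.
Proof.
move=> /(_ [set g | g [::] = 0]); apply; split; last exact: augP.
split=> [|x y x0 y0|x y y0|x clx] //.
- by transitivity (x [::] - y [::]) => //; rewrite x0 y0 subrr.
- by split; rewrite /= ncs_mul_nil y0 ?mulr0 ?mul0r.
- apply/funext => k; have [y y0 xy] := clx k.+1.
  rewrite -[x](subrK y); transitivity ((x - y) [::] k + y [::] k) => //.
  by rewrite y0 xy ?addr0 ?add0r// ltnS.
Qed.

Definition eps (x : alg P) : fps R := (repr x : ncs R (pgen P)) [::].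

Lemma epsE f : eps (alg_pi f) = f [::].
Proof.
apply: subr0_eq; have := alg_ideal_nil (alg_repr_pi f); exact.
Qed.

Lemma eps_linear : linear_for *%R eps.
Proof.
move=> a x y; rewrite -(alg_pi_repr x) -(alg_pi_repr y) -linearP.
by rewrite !epsE.
Qed.

Lemma eps_monoid : monoid_morphism eps.
Proof.
split=> [|x y]; first by rewrite -[1](rmorph1 (@alg_pi R P)) epsE.
rewrite -(alg_pi_repr x) -(alg_pi_repr y) -rmorphM.
by rewrite !epsE ncs_mul_nil.
Qed.

Definition counit_eps : {lrmorphism alg P -> fps R | *%R} :=
  HB.pack eps (GRing.isLinear.Build (fps R) (alg P) (fps R) *%R eps eps_linear)
    (GRing.isMonoidMorphism.Build (alg P) (fps R) eps eps_monoid).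

Lemma eps0 : eps 0 = 0.
Proof. by rewrite -[0](raddf0 (@alg_pi R P)) epsE. Qed.

Lemma eps_scalar a : eps (a *: 1) = a.
Proof. by rewrite -[a *: 1]addr0 eps_linear eps_monoid.1 eps0 mulr1 addr0. Qed.

Lemma eps_agen x : eps (agen P x) = 0. Proof. by rewrite epsE. Qed.

Lemma eps_fil n x : fil n x -> fps_fil n (eps x).
Proof. by move=> [f fn <-] k kn; rewrite epsE; exact: fn. Qed.

(** Without the empty word every term has positive degree. This is how a morphism that is merely
    continuous and compatible with counits gets its degree bound on generators. *)
Lemma eps_fil1 x : eps x = 0 -> fil 1 x.
Proof.
rewrite -(alg_pi_repr x) epsE => x0; apply: alg_pi_fil => w k.
by rewrite ltnS leqn0 addn_eq0 size_eq0 => /andP[/eqP -> _]; rewrite x0.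
Qed.

Section FEps.
Variable B : filAlgType R.

Lemma feps_linear : linear (fun x : alg P => eps x *: (1 : B)).
Proof. by move=> a x y; rewrite eps_linear scalerDl scalerA. Qed.

Lemma feps_fil n x : fil n x -> fil n (eps x *: (1 : B)).
Proof.
move=> xn; rewrite -[n]addn0; apply: fil_scale_fps; first exact: eps_fil.
by rewrite fil_setT.
Qed.

(** The counit followed by the unit of [B]: with values in a filtered algebra it can serve as a
    factor of [tlift] and be compared with other filtered maps. *)
Definition feps : fhom (alg P) B := mkfhom feps_linear feps_fil.

Lemma fepsE x : feps x = eps x *: 1. Proof. by []. Qed.

Lemma feps_mult : fmult feps.
Proof.
split=> [|x y]; rewrite !fepsE; first by rewrite eps_monoid.1 scale1r.
by rewrite eps_monoid.2 -scalerAl mul1r scalerA.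
Qed.

Lemma feps_comm x (b : B) : feps x * b = b * feps x.
Proof. by rewrite fepsE -scalerAl -scalerAr mul1r mulr1. Qed.

End FEps.
End Counit.
Arguments feps {R P} augP B : simpl never.

Lemma eps_fmult (R : realType) (P Q : pres R) (augP : augmented P)
    (augQ : augmented Q) (f : fhom (alg P) (alg Q)) :
  fmult f -> (forall g, eps (f (agen P g)) = 0) -> forall x, eps (f x) = eps x.
Proof.
move=> fM f0 x; rewrite -[LHS](eps_scalar augQ) -[RHS](eps_scalar augQ).
congr eps; move: x.
apply: (@alg_fmult_eq R P _ (fcomp (feps augQ (alg Q)) f) (feps augP (alg Q))).
- exact: fcomp_mult (@feps_mult R Q augQ (alg Q)) fM.
- exact: feps_mult.
- by move=> g; rewrite fcompE !fepsE (eps_agen augP) f0.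
Qed.

Section OppositeMaps.
Variables (R : realType) (A B : filAlgType R).

(** The same function with its target read as [B]: the antipode is multiplicative into the opposite
    algebra, but enters its axioms as a linear map into the algebra itself. *)
Definition funop (h : fhom A (fop B)) : fhom A B :=
  @mkfhom R A B h (linearP h) (fhP h).

Lemma funopE (h : fhom A (fop B)) x : funop h x = h x :> B. Proof. by []. Qed.

Definition fopmap (h : fhom A B) : fhom (fop A) (fop B) :=
  @mkfhom R (fop A) (fop B) h (linearP h) (fhP h).

Lemma fopmap_mult (h : fhom A B) : fmult h -> fmult (fopmap h).
Proof. by move=> [h1 hM]; split=> [|x y]; [exact: h1|exact: hM]. Qed.

End OppositeMaps.
Arguments funop : simpl never.
Arguments fopmap : simpl never.

Section TensorNaturality.
Variable R : realType.

Lemma tmap_square (P Q P1 Q1 P2 Q2 P3 Q3 : pres R)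
   (f : fhom (alg P) (alg P1)) (f' : fhom (alg P1) (alg P3))
   (h : fhom (alg P) (alg P2)) (h' : fhom (alg P2) (alg P3))
   (g : fhom (alg Q) (alg Q1)) (g' : fhom (alg Q1) (alg Q3))
   (k : fhom (alg Q) (alg Q2)) (k' : fhom (alg Q2) (alg Q3)) :
  (forall x, f' (f x) = h' (h x)) -> (forall y, g' (g y) = k' (k y)) ->
  forall t, tmap f' g' (tmap f g t) = tmap h' k' (tmap h k t).
Proof.
move=> fh' gk'.
apply: (@tens_fhom_eq R P Q _ (fcomp (tmap f' g') (tmap f g))
  (fcomp (tmap h' k') (tmap h k))) => x y.
by rewrite !fcompE !tmapE fh' gk'.
Qed.

Lemma tassoc_nat (P Q S P' Q' S' : pres R) (f : fhom (alg P) (alg P'))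
   (g : fhom (alg Q) (alg Q')) (h : fhom (alg S) (alg S')) t :
  tassoc P' Q' S' (tmap (tmap f g) h t) = tmap f (tmap g h) (tassoc P Q S t).
Proof.
move: t; apply: (@tens_fhom_eq R _ _ _ (fcomp (tassoc P' Q' S') (tmap (tmap f g) h))
  (fcomp (tmap f (tmap g h)) (tassoc P Q S))) => t z.
rewrite !fcompE tmapE; move: t.
apply: (@tens_fhom_eq R _ _ _
  (fcomp (tassoc P' Q' S') (fcomp (fmulr (tinr (h z))) (fcomp tinl (tmap f g))))
  (fcomp (tmap f (tmap g h)) (fcomp (tassoc P Q S) (fcomp (fmulr (tinr z)) tinl))))
  => x y.
rewrite !(fcompE, fmulrE) -!tensE (tmapE f g x y) !tassocE.
by rewrite (tmapE f (tmap g h) x (y \ox z)) (tmapE g h y z).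
Qed.

Lemma tlift_tmap (P Q P' Q' : pres R) (B : filAlgType R)
   (u : fhom (alg P') B) (v : fhom (alg Q') B)
   (f : fhom (alg P) (alg P')) (g : fhom (alg Q) (alg Q'))
   (A : filAlgType R) (k : fhom A B)
   (u' : fhom (alg P) A) (v' : fhom (alg Q) A) :
  (forall x y, u (f x) * v (g y) = k (u' x * v' y)) ->
  forall t, tlift u v (tmap f g t) = k (tlift u' v' t).
Proof.
move=> H; apply: (@tens_fhom_eq R _ _ _ (fcomp (tlift u v) (tmap f g))
  (fcomp k (tlift u' v'))) => x y.
by rewrite !fcompE tmapE !tliftE H.
Qed.

End TensorNaturality.

(* Hopf data as filtered linear maps, with the counit forced to be the
   coefficient of the empty word. *)
Record fhopf (R : realType) (P : pres R) := FHopf {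
  faug : augmented P;
  fcomul : fhom (alg P) (alg (ctens P P));
  fanti : fhom (alg P) (fop (alg P));
  fcomul_mult : fmult fcomul;
  fanti_mult : fmult fanti;
  fcoassoc : forall x, tassoc P P P (tmap fcomul (fid _) (fcomul x)) =
                       tmap (fid _) fcomul (fcomul x);
  fcounitl : forall x, tlift (feps faug (alg P)) (fid _) (fcomul x) = x;
  fcounitr : forall x, tlift (fid _) (feps faug (alg P)) (fcomul x) = x;
  fantil : forall x, tlift (funop fanti) (fid _) (fcomul x) = eps x *: 1;
  fantir : forall x, tlift (fid _) (funop fanti) (fcomul x) = eps x *: 1 }.

(** The antipode axioms have right-hand side 0 because they are meant for elements of counit zero;
    in this form all five conditions are additive in [x]. *)
Definition hopf_axioms_at (R : realType) (P : pres R) (augP : augmented P)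
    (D : fhom (alg P) (alg (ctens P P))) (S : fhom (alg P) (fop (alg P)))
    (x : alg P) : Prop :=
  [/\ tassoc P P P (tmap D (fid _) (D x)) = tmap (fid _) D (D x),
    tlift (feps augP (alg P)) (fid _) (D x) = x,
    tlift (fid _) (feps augP (alg P)) (D x) = x,
    tlift (funop S) (fid _) (D x) = 0 &
    tlift (fid _) (funop S) (D x) = 0].

Section Builder.
Variables (R : realType) (P : pres R) (augP : augmented P).
Variables (D : fhom (alg P) (alg (ctens P P))) (S : fhom (alg P) (fop (alg P))).
Hypotheses (DM : fmult D) (SM : fmult S).

(** Multiplication after [S (x) id] sends [t * (x' \ox y')] to [S x' * ml t * y'], by
    antimultiplicativity of [S]; a zero at [t] thus spreads to the right ideal of [t]. *)
Lemma antil_annihilates t : tlift (funop S) (fid _) t = 0 ->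
  forall t', tlift (funop S) (fid _) (t * t') = 0.
Proof.
move=> t0 t'; move: t'; set ml := tlift _ _ in t0 *.
apply: (@tens_fhom_eq R P P _ (fcomp ml (fmull t)) (fzero _ _)) => x' y'.
rewrite fcompE fmullE.
suff -> : ml (t * (x' \ox y')) = funop S x' * ml t * y' by rewrite t0 mulr0 mul0r.
move: t {t0}; apply: (@tens_fhom_eq R P P _ (fcomp ml (fmulr (x' \ox y')))
  (fcomp (fmulr y') (fcomp (fmull (funop S x')) ml))) => x y.
rewrite !(fcompE, fmullE, fmulrE) tensM !tliftE !mulrA; congr (_ * _ * _).
exact: SM.2.
Qed.

Lemma antir_annihilates t' : tlift (fid _) (funop S) t' = 0 ->
  forall t, tlift (fid _) (funop S) (t * t') = 0.
Proof.
move=> t0 t; move: t; set mr := tlift _ _ in t0 *.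
apply: (@tens_fhom_eq R P P _ (fcomp mr (fmulr t')) (fzero _ _)) => x y.
rewrite fcompE fmulrE.
suff -> : mr ((x \ox y) * t') = x * mr t' * funop S y by rewrite t0 mulr0 mul0r.
move: t' {t0}; apply: (@tens_fhom_eq R P P _ (fcomp mr (fmull (x \ox y)))
  (fcomp (fmulr (funop S y)) (fcomp (fmull x) mr))) => x' y'.
rewrite !(fcompE, fmullE, fmulrE) tensM !tliftE -!mulrA; congr (_ * (_ * _)).
exact: SM.2.
Qed.

Let ml1 : tlift (funop S) (fid _) 1 = 1.
Proof. by rewrite -tens11 tliftE funopE SM.1 mulr1. Qed.
Let mr1 : tlift (fid _) (funop S) 1 = 1.
Proof. by rewrite -tens11 tliftE funopE SM.1 mulr1. Qed.

Lemma fhopf_of_generators :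
  (forall g, hopf_axioms_at augP D S (agen P g)) ->
  exists H : fhopf P, fcomul H = D /\ fanti H = S.
Proof.
move=> DS.
have ca x : tassoc P P P (tmap D (fid _) (D x)) = tmap (fid _) D (D x).
  move: x; apply: (@alg_fmult_eq R P _ (fcomp (tassoc P P P) (fcomp (tmap D (fid _)) D))
    (fcomp (tmap (fid _) D) D)); last by move=> g; case: (DS g).
    apply: fcomp_mult; first exact: tassoc_mult.
    exact: fcomp_mult (tmap_mult DM (@fid_mult R (alg P))) DM.
  exact: fcomp_mult (tmap_mult (@fid_mult R (alg P)) DM) DM.
have cl x : tlift (feps augP (alg P)) (fid _) (D x) = x.
  move: x; apply: (@alg_fmult_eq R P _ (fcomp (tlift (feps augP (alg P)) (fid _)) D)
    (fid _)); [|by []|by move=> g; case: (DS g)].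
  apply: fcomp_mult DM; apply: tlift_mult => //; first exact: feps_mult.
  by move=> x y; exact: feps_comm.
have cr x : tlift (fid _) (feps augP (alg P)) (D x) = x.
  move: x; apply: (@alg_fmult_eq R P _ (fcomp (tlift (fid _) (feps augP (alg P))) D)
    (fid _)); [|by []|by move=> g; case: (DS g)].
  apply: fcomp_mult DM; apply: tlift_mult => //; first exact: feps_mult.
  by move=> x y; exact/esym/feps_comm.
have al x : tlift (funop S) (fid _) (D x) = eps x *: 1.
  move: x; apply: (@alg_fhom_eq R P _ (fcomp (tlift (funop S) (fid _)) D)
    (feps augP (alg P))) => w; rewrite fcompE alg_pi_mono.
  case: w => [|x w].
    by rewrite /alg_word big_nil DM.1 ml1 (feps_mult augP _).1.
  rewrite /alg_word big_cons DM.2 antil_annihilates; last by case: (DS x).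
  by rewrite (feps_mult augP _).2 fepsE eps_agen// scale0r mul0r.
have ar x : tlift (fid _) (funop S) (D x) = eps x *: 1.
  move: x; apply: (@alg_fhom_eq R P _ (fcomp (tlift (fid _) (funop S)) D)
    (feps augP (alg P))) => w; rewrite fcompE alg_pi_mono.
  (* The last letter is peeled off here, since the right-hand map spreads its zeros to left
     multiples; the left-hand one used the first letter. *)
  case/lastP: w => [|w x].
    by rewrite /alg_word big_nil DM.1 mr1 (feps_mult augP _).1.
  rewrite /alg_word big_rcons DM.2 antir_annihilates; last by case: (DS x).
  by rewrite (feps_mult augP _).2 [feps _ _ (agen _ _)]fepsE eps_agen// scale0r mulr0.
by exists (FHopf DM SM ca cl cr al ar).
Qed.

End Builder.

Section HopfOf.
Variables (R : realType) (P : pres R) (H : fhopf P).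

Let D := lrmorphism_of (fcomul_mult H).
Let S : {linear alg P -> alg P} := funop (fanti H).
Let e := counit_eps (faug H).

Lemma counit_eps_continuous : fil_continuous fil (@fps_fil R) e.
Proof. by move=> n; exists n => x; exact: (eps_fil (faug H)). Qed.

Lemma hopf_coassoc :
  exists (dl : {linear alg (ctens P P) -> alg (ctens (ctens P P) P)})
         (dr : {linear alg (ctens P P) -> alg (ctens P (ctens P P))})
         (assoc : {linear alg (ctens (ctens P P) P) ->
                          alg (ctens P (ctens P P))}),
    [/\ is_tensor_map D idfun dl, is_tensor_map idfun D dr,
        fil_continuous fil fil assoc,
        forall x y z, assoc ((x \ox y) \ox z) = x \ox (y \ox z) &
        forall x, assoc (dl (D x)) = dr (D x)].
Proof.
exists (tmap (fcomul H) (fid _)), (tmap (fid _) (fcomul H)), (tassoc P P P).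
split.
- exact: tmap_tensor_map.
- exact: tmap_tensor_map.
- exact: fhom_continuous.
- exact: tassocE.
- exact: fcoassoc.
Qed.

Lemma hopf_counitl : exists el : {linear alg (ctens P P) -> alg P},
  [/\ fil_continuous fil fil el, forall x y, el (x \ox y) = e x *: y &
      forall x, el (D x) = x].
Proof.
exists (tlift (feps (faug H) (alg P)) (fid _)); split.
- exact: fhom_continuous.
- by move=> x y; rewrite tliftE fepsE -scalerAl mul1r.
- exact: fcounitl.
Qed.

Lemma hopf_counitr : exists er : {linear alg (ctens P P) -> alg P},
  [/\ fil_continuous fil fil er, forall x y, er (x \ox y) = e y *: x &
      forall x, er (D x) = x].
Proof.
exists (tlift (fid _) (feps (faug H) (alg P))); split.
- exact: fhom_continuous.
- by move=> x y; rewrite tliftE fepsE -scalerAr mulr1.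
- exact: fcounitr.
Qed.

Lemma hopf_antil : exists ml : {linear alg (ctens P P) -> alg P},
  [/\ fil_continuous fil fil ml, forall x y, ml (x \ox y) = S x * y &
      forall x, ml (D x) = e x *: 1].
Proof.
exists (tlift (funop (fanti H)) (fid _)); split.
- exact: fhom_continuous.
- exact: tliftE.
- exact: fantil.
Qed.

Lemma hopf_antir : exists mr : {linear alg (ctens P P) -> alg P},
  [/\ fil_continuous fil fil mr, forall x y, mr (x \ox y) = x * S y &
      forall x, mr (D x) = e x *: 1].
Proof.
exists (tlift (fid _) (funop (fanti H))); split.
- exact: fhom_continuous.
- exact: tliftE.
- exact: fantir.
Qed.

Definition hopf_of : hopf P := @Hopf R P D e S
  (fhom_continuous (fcomul H)) counit_eps_continuous
  (fhom_continuous (funop (fanti H))) hopf_coassoc hopf_counitl hopf_counitr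
  hopf_antil hopf_antir.

Lemma hopf_of_comul x : comul hopf_of x = fcomul H x. Proof. by []. Qed.
Lemma hopf_of_counit x : counit hopf_of x = eps x. Proof. by []. Qed.
Lemma hopf_of_antipode x : antipode hopf_of x = fanti H x. Proof. by []. Qed.

End HopfOf.

Lemma hopf_of_morphism (R : realType) (P Q : pres R) (HP : fhopf P) (HQ : fhopf Q)
    (f : fhom (alg P) (alg Q)) (fM : fmult f) :
  (forall g (x := agen P g), [/\ fcomul HQ (f x) = tmap f f (fcomul HP x),
    eps (f x) = 0 & fanti HQ (f x) = f (fanti HP x)]) ->
  hopf_morphism (hopf_of HP) (hopf_of HQ) (lrmorphism_of fM).
Proof.
move=> H; split.
- exact: fhom_continuous.
- exists (tmap f f); first exact: tmap_tensor_map.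
  apply: (@alg_fmult_eq R P _ (fcomp (fcomul HQ) f) (fcomp (tmap f f) (fcomul HP))).
  + exact: fcomp_mult (fcomul_mult HQ) fM.
  + exact: fcomp_mult (tmap_mult fM fM) (fcomul_mult HP).
  + by move=> g; case: (H g).
- by apply: (eps_fmult (faug HP) (faug HQ) fM) => g; case: (H g).
(* Read in the opposite algebra, both sides are multiplicative, so generators suffice for the
   antipode too. *)
- apply: (@alg_fmult_eq R P (fop (alg Q)) (fcomp (fanti HQ) f)
    (fcomp (fopmap f) (fanti HP))).
  + exact: fcomp_mult (fanti_mult HQ) fM.
  + exact: fcomp_mult (fopmap_mult fM) (fanti_mult HP).
  + by move=> g; case: (H g).
Qed.

(* The Hopf axioms hold on the image of a bialgebra map that commutes with the
   candidate antipode. *)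
Section Transport.
Variables (R : realType) (P T : pres R) (H : fhopf P) (augT : augmented T).
Variables (D : fhom (alg T) (alg (ctens T T))) (S : fhom (alg T) (fop (alg T))).
Variable i : fhom (alg P) (alg T).
Hypotheses (iM : fmult i) (iD : forall x, D (i x) = tmap i i (fcomul H x)).
Hypotheses (iS : forall x, S (i x) = i (fanti H x)).
Hypothesis ie : forall x, eps (i x) = eps x.

Lemma transport_axioms x : eps x = 0 ->
  hopf_axioms_at augT D S (i x).
Proof.
move=> x0; rewrite /hopf_axioms_at !iD; set t := fcomul H x; split.
- rewrite (@tmap_square _ _ _ _ _ _ _ _ _ _ _ (fcomul H) (tmap i i) _ _
    (fid _) i)//; rewrite tassoc_nat fcoassoc.
  by rewrite (@tmap_square _ _ _ _ _ _ _ _ _ i (fid _) (fid _) i _ _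
    (fcomul H) (tmap i i)).
- rewrite (@tlift_tmap _ _ _ _ _ _ _ _ _ _ _ i (feps (faug H) (alg P)) (fid _)).
    by rewrite fcounitl.
  by move=> a b; rewrite iM.2 !fepsE ie fhZ iM.1.
- rewrite (@tlift_tmap _ _ _ _ _ _ _ _ _ _ _ i (fid _) (feps (faug H) (alg P))).
    by rewrite fcounitr.
  by move=> a b; rewrite iM.2 !fepsE ie fhZ iM.1.
- rewrite (@tlift_tmap _ _ _ _ _ _ _ _ _ _ _ i (funop (fanti H)) (fid _)).
    by rewrite fantil x0 scale0r fh0.
  by move=> a b; rewrite iM.2 !funopE iS.
- rewrite (@tlift_tmap _ _ _ _ _ _ _ _ _ _ _ i (fid _) (funop (fanti H))).
    by rewrite fantir x0 scale0r fh0.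
  by move=> a b; rewrite iM.2 !funopE iS.
Qed.

End Transport.

(** * The tensor product of two Hopf algebras *)

Section TensorHopf.
Variables (R : realType) (P Q : pres R) (HP : fhopf P) (HQ : fhopf Q).
Let T := ctens P Q.

Lemma rename_nil (X Y : finType) (r : X -> Y) (f : ncs R X) :
  f [::] = 0 -> rename r f [::] = 0.
Proof. by move=> f0; rewrite /rename big1// => v _; rewrite tuple0. Qed.

Lemma ctens_augmented : augmented T.
Proof.
move=> h [[[f Pf <-]|[g Qg <-]]|[x [y ->]]].
- by apply: rename_nil; exact: faug.
- by apply: rename_nil; exact: faug.
- transitivity ((gen (inl x) * gen (inr y) : ncs R (pgen T)) [::] -
    (gen (inr y) * gen (inl x) : ncs R (pgen T)) [::]) => //.
  by rewrite !ncs_mul_nil !mul0r subrr.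
Qed.

(** The two partial coproducts land in commuting subalgebras of the tensor square, so their product
    is the usual coproduct with the flip of the middle factors built in. *)
Definition tens_comul : fhom (alg T) (alg (ctens T T)) :=
  tlift (fcomp (tmap tinl tinl) (fcomul HP)) (fcomp (tmap tinr tinr) (fcomul HQ)).

Definition tens_anti : fhom (alg T) (fop (alg T)) :=
  tlift (fcomp (fopmap tinl) (fanti HP)) (fcomp (fopmap tinr) (fanti HQ)).

Lemma tens_comul_mult : fmult tens_comul.
Proof.
have M1 := @tinl_mult R P Q; have M2 := @tinr_mult R P Q.
apply: tlift_mult => [||x y].
- exact: fcomp_mult (tmap_mult M1 M1) (fcomul_mult HP).
- exact: fcomp_mult (tmap_mult M2 M2) (fcomul_mult HQ).
- rewrite !fcompE; move: (fcomul HP x) (fcomul HQ y) => s t; move: s.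
  apply: (@tens_fhom_eq R P P _
    (fcomp (fmulr (tmap tinr tinr t)) (tmap tinl tinl))
    (fcomp (fmull (tmap tinr tinr t)) (tmap tinl tinl))) => a b; move: t.
  apply: (@tens_fhom_eq R Q Q _
    (fcomp (fmull (tmap tinl tinl (a \ox b))) (tmap tinr tinr))
    (fcomp (fmulr (tmap tinl tinl (a \ox b))) (tmap tinr tinr))) => c d.
  by rewrite !(fcompE, fmullE, fmulrE) !tmapE !tensM !tinlr_comm.
Qed.

Lemma tens_anti_mult : fmult tens_anti.
Proof.
apply: tlift_mult => [||x y].
- exact: fcomp_mult (fopmap_mult (@tinl_mult R P Q)) (fanti_mult HP).
- exact: fcomp_mult (fopmap_mult (@tinr_mult R P Q)) (fanti_mult HQ).
- exact/esym/(@tinlr_comm R P Q).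
Qed.

Lemma tens_comul_inl x : tens_comul (tinl x) = tmap tinl tinl (fcomul HP x).
Proof.
rewrite -tensx1 tliftE !fcompE (fcomul_mult HQ).1 (tmap_mult _ _).1 ?mulr1//;
exact: tinr_mult.
Qed.

Lemma tens_comul_inr y : tens_comul (tinr y) = tmap tinr tinr (fcomul HQ y).
Proof.
rewrite -tens1x tliftE !fcompE (fcomul_mult HP).1 (tmap_mult _ _).1 ?mul1r//;
exact: tinl_mult.
Qed.

Lemma tens_antiE x y : tens_anti (x \ox y) = fanti HP x \ox fanti HQ y.
Proof. by rewrite tliftE tensE; exact/esym/(@tinlr_comm R P Q). Qed.

Lemma tens_anti_inl x : tens_anti (tinl x) = tinl (fanti HP x).
Proof. by rewrite -tensx1 tens_antiE (fanti_mult HQ).1 tensx1. Qed.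

Lemma tens_anti_inr y : tens_anti (tinr y) = tinr (fanti HQ y).
Proof. by rewrite -tens1x tens_antiE (fanti_mult HP).1 tens1x. Qed.

Lemma eps_tinl (x : alg P) : eps (tinl x : alg T) = eps x.
Proof.
apply: (eps_fmult (faug HP) ctens_augmented (@tinl_mult R P Q)) => g.
by rewrite tinl_agen (eps_agen ctens_augmented).
Qed.

Lemma eps_tinr (y : alg Q) : eps (tinr y : alg T) = eps y.
Proof.
apply: (eps_fmult (faug HQ) ctens_augmented (@tinr_mult R P Q)) => g.
by rewrite tinr_agen (eps_agen ctens_augmented).
Qed.

Lemma tens_fhopf : exists HT : fhopf T, [/\ fcomul HT = tens_comul,
  fanti HT = tens_anti & is_tensor_hopf (hopf_of HP) (hopf_of HQ) (hopf_of HT)].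
Proof.
have [HT [HD HS]] : exists HT : fhopf T, fcomul HT = tens_comul /\ fanti HT = tens_anti.
  apply: (fhopf_of_generators (augP := ctens_augmented)).
  - exact: tens_comul_mult.
  - exact: tens_anti_mult.
  - case=> g; rewrite -?tinl_agen -?tinr_agen.
      apply: (transport_axioms (H := HP)).
      + exact: tinl_mult.
      + exact: tens_comul_inl.
      + exact: tens_anti_inl.
      + exact: eps_tinl.
      + exact: (eps_agen (faug HP)).
    apply: (transport_axioms (H := HQ)).
    + exact: tinr_mult.
    + exact: tens_comul_inr.
    + exact: tens_anti_inr.
    + exact: eps_tinr.
    + exact: (eps_agen (faug HQ)).
exists HT; split=> //; split.
(* Multiplying the images of the two tensor squares inside that of [T] regroups the four factors,
   which is the flip. *)
- exists (tlift (tmap tinl tinl) (tmap tinr tinr)); split.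
  + exact: fhom_continuous.
  + move=> x x' y y'; rewrite tliftE !tmapE tensM.
    by rewrite -!tensE.
  + move=> x y; by rewrite !hopf_of_comul HD [LHS]tliftE [RHS]tliftE.
- move=> x y; rewrite !hopf_of_counit tensE (eps_monoid ctens_augmented).2.
  by rewrite eps_tinl eps_tinr.
- by move=> x y; rewrite !hopf_of_antipode HS; exact: tens_antiE.
Qed.

End TensorHopf.

(** * The Poincare relations in light-cone coordinates *)

Section AbelianReflection.

(** Syntax for identities between sums and opposites of atoms: they hold in every abelian group once
    the integer coefficients of each atom agree, which is decided by computation. *)
Inductive zexpr := ZVar of nat | ZAdd of zexpr & zexpr | ZOpp of zexpr | ZZero.

Fixpoint zden (V : zmodType) (env : seq V) (e : zexpr) : V :=
  match e with
  | ZVar i => env`_i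
  | ZAdd e f => zden env e + zden env f
  | ZOpp e => - zden env e
  | ZZero => 0
  end.

Fixpoint zcoef (e : zexpr) (i : nat) : int :=
  match e with
  | ZVar j => if i == j then Posz 1 else Posz 0
  | ZAdd e f => (zcoef e i + zcoef f i)%R
  | ZOpp e => (- zcoef e i)%R
  | ZZero => Posz 0
  end.

Lemma zdenE (V : zmodType) (env : seq V) e :
  zden env e = \sum_(i < size env) env`_i *~ zcoef e i.
Proof.
elim: e => [j|e IHe f IHf|e IHe|] /=.
- have [jn|nj] := ltnP j (size env).
    rewrite (bigD1 (Ordinal jn)) //= eqxx mulr1z big1 ?addr0// => i ij.
    by rewrite ifN//; apply: contraNneq ij => ij; apply/eqP/val_inj.
  (* An index beyond the environment denotes 0, and no summand on the right has that index. *)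
  rewrite nth_default// big1// => i _; rewrite ifN//.
  by apply: contraTneq (ltn_ord i) => ->; rewrite -leqNgt.
- by rewrite IHe IHf -big_split; apply: eq_bigr => i _; rewrite mulrzDr.
- by rewrite IHe -sumrN; apply: eq_bigr => i _; rewrite mulrNz.
- by rewrite big1.
Qed.

Lemma zmod_reflect (V : zmodType) (env : seq V) e f :
  all (fun i => zcoef e i == zcoef f i) (iota 0 (size env)) ->
  zden env e = zden env f.
Proof.
move=> /allP ef; rewrite !zdenE; apply: eq_bigr => i _.
by rewrite (eqP (ef i _))// mem_iota add0n ltn_ord.
Qed.

End AbelianReflection.

(* Equal atoms may differ by the algebraic structures they are typed with. *)
Ltac zsame x y :=
  match constr:((x, y)) with
  | (?z, ?z) => constr:(true)
  | ((?a * ?b)%R, (?c * ?d)%R) =>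
      match zsame a c with true => zsame b d | false => constr:(false) end
  | ((?a *: ?b)%R, (?c *: ?d)%R) =>
      match zsame a c with true => zsame b d | false => constr:(false) end
  | (1%R, 1%R) => constr:(true)
  | ((- ?a)%R, (- ?b)%R) => zsame a b
  | (fexp ?a, fexp ?b) => zsame a b
  | (?a \ox ?b, ?c \ox ?d) =>
      match zsame a c with true => zsame b d | false => constr:(false) end
  | _ => constr:(false)
  end.
Ltac zfind x env :=
  lazymatch env with
  | ?y :: ?e =>
      lazymatch zsame x y with
      | true => constr:(0%N)
      | false => let n := zfind x e in constr:(S n)
      end
  end.
Ltac zmember x env :=
  lazymatch env with
  | ?y :: ?e =>
      lazymatch zsame x y with true => constr:(true) | false => zmember x e end
  | _ => constr:(false)
  end.
Ltac zatoms t env :=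
  lazymatch t with
  | (?x + ?y)%R => let e := zatoms x env in zatoms y e
  | (- ?x)%R => zatoms x env
  | 0%R => env
  | ?x => match zmember x env with true => env | false => constr:(x :: env) end
  end.
Ltac zquote t env :=
  lazymatch t with
  | (?x + ?y)%R =>
      let a := zquote x env in let b := zquote y env in constr:(ZAdd a b)
  | (- ?x)%R => let a := zquote x env in constr:(ZOpp a)
  | 0%R => constr:(ZZero)
  | ?x => let n := zfind x env in constr:(ZVar n)
  end.
Ltac abel :=
  lazymatch goal with
  | |- @eq ?T ?l ?r =>
      let e0 := zatoms l (@nil T) in let env := zatoms r e0 in
      let a := zquote l env in let b := zquote r env in
      apply: (@zmod_reflect _ env a b); vm_compute; reflexivity
  end.

Section PoincareRelations.
Variable R : realType.

Section Relations.
Variable B : filAlgType R.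
Implicit Types (t a p m psi chi : B).

(** One predicate covers all three presentations: [t] is [theta] for the extended group, [a0] for
    the kappa-Poincare group, and [theta + a0] for the new coordinates. *)
Definition erel t a0 a1 chi : Prop :=
  [/\ bracket a0 a1 = alpha *: t, bracket t a0 = 0 & bracket t a1 = alpha *: t] /\
  [/\ bracket chi t = alpha *: (cosh chi - 1),
      bracket chi a0 = alpha *: (cosh chi - 1) &
      bracket chi a1 = alpha *: sinh chi].

(* The same relations in the light-cone coordinates p = a0 + a1, m = a0 - a1
   and psi = t - a0, with psi central. *)
Definition krel psi p m chi : Prop :=
  [/\ bracket chi p = alpha *: (fexp chi - 1),
      bracket chi m = alpha *: (fexp (- chi) - 1) &
      bracket p m = - (alpha *: (psi + psi + p + m))] /\
  [/\ bracket psi p = 0, bracket psi m = 0 & bracket chi psi = 0].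

Lemma erel_krel t a0 a1 chi : fil 1 chi ->
  erel t a0 a1 chi <-> krel (t - a0) (a0 + a1) (a0 - a1) chi.
Proof.
move=> c1; have Ep := cosh_sinhD c1; have Em := cosh_sinhB c1.
have a01 : bracket (a0 + a1) (a0 - a1) = - (bracket a0 a1 + bracket a0 a1).
  rewrite bracketDl !bracketDr !bracketNr !bracketxx (bracketC a1 a0); abel.
split=> [[[R1 R2 R3] [R4 R5 R6]]|[[R1 R2 R3] [R4 R5 R6]]].
  split; split.
  - rewrite bracketDr R5 R6 -scalerDr -Ep; congr (_ *: _); abel.
  - rewrite bracketDr bracketNr R5 R6 -scalerBr -Em; congr (_ *: _); abel.
  - rewrite a01 R1 -scalerDr; congr (- (_ *: _)); abel.
  - by rewrite bracketDl !bracketDr !bracketNl R2 R3 bracketxx R1; abel.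
  - by rewrite bracketDl !bracketDr !bracketNr !bracketNl R2 R3 bracketxx R1; abel.
  - by rewrite bracketDr bracketNr R4 R5 subrr.
have tE : t = (t - a0) + a0 by abel.
(* Conversely each relation is obtained twice over from sums and differences of light-cone
   relations, then halved. *)
have R1' : bracket a0 a1 = alpha *: t.
  apply: (@addxx_inj R B); apply: oppr_inj; rewrite -a01 R3 -scalerDr.
  by congr (- (_ *: _)); abel.
have z0 : bracket (t - a0) a0 = 0.
  apply: (@addxx_inj R B); rewrite -!bracketDr (_ : a0 + a0 = (a0 + a1) + (a0 - a1)).
    by rewrite bracketDr R4 R5.
  by abel.
have z1 : bracket (t - a0) a1 = 0.
  apply: (@addxx_inj R B); rewrite -!bracketDr (_ : a1 + a1 = (a0 + a1) - (a0 - a1)).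
    by rewrite bracketDr bracketNr R4 R5 subrr addr0.
  by abel.
have c0 : bracket chi a0 = alpha *: (cosh chi - 1).
  apply: (@addxx_inj R B); rewrite -!bracketDr (_ : a0 + a0 = (a0 + a1) + (a0 - a1)).
    rewrite bracketDr R1 R2 -!scalerDr -Ep -Em; congr (_ *: _); abel.
  by abel.
have c1' : bracket chi a1 = alpha *: sinh chi.
  apply: (@addxx_inj R B); rewrite -!bracketDr (_ : a1 + a1 = (a0 + a1) - (a0 - a1)).
    rewrite bracketDr bracketNr R1 R2 -scalerBr -!scalerDr -Ep -Em.
    congr (_ *: _); abel.
  by abel.
split; split=> //; rewrite {1}tE.
- by rewrite bracketDl z0 bracketxx addr0.
- by rewrite bracketDl z1 R1' add0r.
- by rewrite bracketDr R6 c0 add0r.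
Qed.

Lemma bracket_powser0 c x y : fil 1 x -> bracket x y = 0 ->
  bracket (powser c x : B) y = 0.
Proof.
by move=> x1 /bracket_eq0 xy; apply/bracket_eq0/esym/powser_comm.
Qed.

Lemma bracket0C (x y : B) : bracket x y = 0 -> bracket y x = 0.
Proof. by move=> xy; rewrite bracketC xy oppr0. Qed.

Lemma krel_fexp psi p m chi : fil 1 chi -> krel psi p m chi ->
  [/\ bracket (fexp chi) p = alpha *: (fexp chi * fexp chi - fexp chi),
      bracket (fexp (- chi)) p = alpha *: (fexp (- chi) - 1),
      bracket (fexp chi) m = alpha *: (1 - fexp chi) &
      bracket (fexp (- chi)) m =
        alpha *: (fexp (- chi) - fexp (- chi) * fexp (- chi))].
Proof.
move=> c1 [[R1 R2 _] _]; have n1 := fil_N c1.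
(* The brackets of [chi] with [p] and [m] are power series in [chi] or [- chi], hence commute with
   [chi]; this is the hypothesis of [bracket_fexp]. *)
have cE (x : B) : fil 1 x -> GRing.comm chi x -> forall a : fps R,
    GRing.comm chi (a *: (fexp x - 1)).
  move=> x1 cx a; apply/bracket_eq0; rewrite bracketZr bracketDr bracketNr.
  rewrite (_ : bracket chi 1 = 0) ?subr0; last by rewrite /bracket mulr1 mul1r subrr.
  rewrite (_ : bracket chi (fexp x) = 0) ?scaler0//.
  by apply/bracket_eq0/fexp_comm.
have cN : GRing.comm chi (- chi) by rewrite /GRing.comm mulrN mulNr.
have nC y : GRing.comm chi y -> GRing.comm (- chi) y.
  by rewrite /GRing.comm mulNr mulrN => ->.
split.
- rewrite bracket_fexp// R1; last exact: cE.
  by rewrite -scalerAr mulrBr mulr1.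
- rewrite bracket_fexp//; last first.
    by rewrite bracketNl R1 -scaleNr; apply/nC/cE.
  by rewrite bracketNl R1 mulrN -scalerAr mulrBr mulr1 fexpNl// -scalerN opprB.
- rewrite bracket_fexp// R2; last exact: cE.
  by rewrite -scalerAr mulrBr mulr1 fexpNr.
- rewrite bracket_fexp//; last first.
    by rewrite bracketNl R2 -scaleNr; apply/nC/cE.
  by rewrite bracketNl R2 mulrN -scalerAr mulrBr mulr1 -scalerN opprB.
Qed.

(** The two families stand for the two tensor factors; only their mutual commutation matters, so the
    computation takes place in a single algebra. *)
Lemma krel_comul psi p m chi psi' p' m' chi' :
  fil 1 chi -> fil 1 chi' -> krel psi p m chi -> krel psi' p' m' chi' ->
  (forall x y, x \in [:: psi; p; m; chi] -> y \in [:: psi'; p'; m'; chi'] ->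
    bracket x y = 0) ->
  krel (psi + psi') (p + fexp chi * p') (m + fexp (- chi) * m') (chi + chi').
Proof.
move=> c1 c1' K K' xy.
have [_ Emp Epm _] := krel_fexp c1 K.
have [[R1 R2 R3] [R4 R5 R6]] := K; have [[R1' R2' R3'] [R4' R5' R6']] := K'.
have yx x y : x \in [:: psi; p; m; chi] -> y \in [:: psi'; p'; m'; chi'] ->
    bracket y x = 0 by move=> xi yi; apply/bracket0C/xy.
have inL : [&& psi \in [:: psi; p; m; chi], p \in [:: psi; p; m; chi],
  m \in [:: psi; p; m; chi] & chi \in [:: psi; p; m; chi]].
  by rewrite !inE !eqxx !orbT.
have inR : [&& psi' \in [:: psi'; p'; m'; chi'], p' \in [:: psi'; p'; m'; chi'],
  m' \in [:: psi'; p'; m'; chi'] & chi' \in [:: psi'; p'; m'; chi']].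
  by rewrite !inE !eqxx !orbT.
move: inL inR => /and4P[L1 L2 L3 L4] /and4P[M1 M2 M3 M4].
have n1 := fil_N c1; have n1' := fil_N c1'.
have Ey y : bracket chi y = 0 -> bracket (fexp chi) y = 0.
  by move=> cy; exact: bracket_powser0.
have Emy y : bracket chi y = 0 -> bracket (fexp (- chi)) y = 0.
  by move=> cy; apply: bracket_powser0 => //; rewrite bracketNl cy oppr0.
have cE : bracket chi (fexp chi) = 0 by apply/bracket0C/Ey/bracketxx.
have cEm : bracket chi (fexp (- chi)) = 0 by apply/bracket0C/Emy/bracketxx.
split; split.
- rewrite fexpD//; last by apply/bracket_eq0/xy.
  rewrite bracketDl !bracketDr R1 !bracketMr R1' cE (xy chi p')// (yx p chi')//.
  rewrite (bracket0C (Ey _ (xy _ _ L4 M4))) mulr0 !mul0r !addr0 !add0r.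
  rewrite -scalerAr -scalerDr mulrBr mulr1; congr (_ *: _). abel.
- rewrite opprD fexpD//; last first.
    by apply/bracket_eq0; rewrite bracketNl bracketNr xy ?oppr0.
  rewrite bracketDl !bracketDr R2 !bracketMr R2' cEm (xy chi m')// (yx m chi')//.
  rewrite (bracket0C (Emy _ (xy _ _ L4 M4))) mulr0 !mul0r !addr0 !add0r.
  rewrite -scalerAr -scalerDr mulrBr mulr1; congr (_ *: _). abel.
(* The exponentials cancel in the bracket of the two twisted terms, leaving [bracket p' m']; its
   untwisted [p'] and [m'] then cancel against the constant parts of the two mixed brackets. *)
- have -> : bracket (p + fexp chi * p') (m + fexp (- chi) * m') =
      bracket p m + bracket p (fexp (- chi)) * m' + bracket (fexp chi) m * p' +
      bracket p' m'.
    have H1 : bracket (fexp chi * p') m = bracket (fexp chi) m * p'.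
      by rewrite bracketMl (yx m p')// mulr0 add0r.
    have H2 : bracket p (fexp (- chi) * m') = bracket p (fexp (- chi)) * m'.
      by rewrite bracketMr (xy p m')// mulr0 add0r.
    have H3 : bracket (fexp chi * p') (fexp (- chi) * m') = bracket p' m'.
      rewrite bracketMl (bracketMr (fexp chi)) (Ey _ cEm) (Ey m' (xy _ _ L4 M3)).
      rewrite mulr0 mul0r addr0 mul0r addr0 bracketMr.
      rewrite (bracket0C (Emy _ (xy _ _ L4 M2))) mul0r addr0.
      by rewrite mulrA fexpNr// mul1r.
    by rewrite bracketDl !bracketDr H1 H2 H3; abel.
  rewrite (bracketC p (fexp _)) Emp Epm R3 R3' mulNr -!scalerAl -!scalerN -!scalerDr.
  by congr (_ *: _); rewrite !mulrBl !mul1r; abel.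
- rewrite bracketDl !bracketDr R4 !bracketMr R4' (xy psi p')// (yx p psi')//.
  rewrite (bracket0C (Ey _ (bracket0C (bracket0C R6)))).
  rewrite (bracket0C (Ey _ (xy _ _ L4 M1))) !mulr0 !mul0r; abel.
- rewrite bracketDl !bracketDr R5 !bracketMr R5' (xy psi m')// (yx m psi')//.
  rewrite (bracket0C (Emy _ R6)).
  rewrite (bracket0C (Emy _ (xy _ _ L4 M1))) !mulr0 !mul0r; abel.
- rewrite bracketDl !bracketDr R6 R6' (xy chi psi')// (yx psi chi')//; abel.
Qed.

End Relations.

Lemma fop_fexpE (B : filAlgType R) (x : B) : fil 1 x ->
  fexp (x : fop B) = fexp x :> B.
Proof. exact: fop_powserE. Qed.

Lemma krel_anti (B : filAlgType R) (psi p m chi : B) :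
  fil 1 chi -> krel psi p m chi ->
  @krel (fop B) (- psi : B) (- (fexp (- chi) * p) : B) (- (fexp chi * m) : B)
    (- chi : B).
Proof.
move=> c1 K; have [[R1 R2 R3] [R4 R5 R6]] := K; have n1 := fil_N c1.
have [Epp Emp Epm Emm] := krel_fexp c1 K.
have Ey y : bracket chi y = 0 -> bracket (fexp chi) y = 0.
  by move=> cy; exact: bracket_powser0.
have Emy y : bracket chi y = 0 -> bracket (fexp (- chi)) y = 0.
  by move=> cy; apply: bracket_powser0 => //; rewrite bracketNl cy oppr0.
have cE : bracket chi (fexp chi) = 0 by apply/bracket0C/Ey/bracketxx.
have cEm : bracket chi (fexp (- chi)) = 0 by apply/bracket0C/Emy/bracketxx.
have E1 : fexp (- chi : fop B) = fexp (- chi) := fop_fexpE n1.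
have E2 : fexp (- - chi : fop B) = fexp chi.
  transitivity (fexp (chi : fop B)); last exact: (@fop_fexpE B chi c1).
  by congr fexp; exact: opprK.
(* A bracket of the opposite algebra is a bracket of [B] with its arguments exchanged; the relations
   are established in this exchanged form. *)
have H1 : bracket (- (fexp (- chi) * p)) (- chi) = alpha *: (fexp (- chi) - 1).
  rewrite bracketNl bracketNr opprK bracketC bracketMr cEm mul0r addr0 R1.
  by rewrite -scalerAr mulrBr fexpNl// mulr1 -scalerN opprB.
have H2 : bracket (- (fexp chi * m)) (- chi) = alpha *: (fexp chi - 1).
  rewrite bracketNl bracketNr opprK bracketC bracketMr cE mul0r addr0 R2.
  by rewrite -scalerAr mulrBr fexpNr// mulr1 -scalerN opprB.
have H3 : bracket (- (fexp chi * m)) (- (fexp (- chi) * p)) =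
    - (alpha *: (- psi - psi - fexp (- chi) * p - fexp chi * m)).
  rewrite bracketNl bracketNr opprK.
  have -> : bracket (fexp chi * m) (fexp (- chi) * p) =
      bracket m p - fexp chi * bracket (fexp (- chi)) m * p +
      fexp (- chi) * bracket (fexp chi) p * m.
    rewrite bracketMl !bracketMr (Ey _ cEm) mul0r addr0 mulrDr mulrA fexpNr// mul1r.
    by rewrite (bracketC m (fexp _)) mulNr mulrN mulrA.
  rewrite bracketC R3 opprK Emm Epp -!scalerAr -!scalerAl -scalerN -!scalerDr.
  rewrite -scalerN; congr (_ *: _).
  rewrite !mulrBr !mulrA fexpNr// fexpNl// !mul1r !mulrBl !mul1r; abel.
have H4 : bracket (- (fexp (- chi) * p)) (- psi) = 0.
  rewrite bracketNl bracketNr opprK.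
  by rewrite bracketMl (bracket0C R4) (Emy _ R6) mulr0 mul0r addr0.
have H5 : bracket (- (fexp chi * m)) (- psi) = 0.
  rewrite bracketNl bracketNr opprK.
  by rewrite bracketMl (bracket0C R5) (Ey _ R6) mulr0 mul0r addr0.
have H6 : bracket (- psi) (- chi) = 0.
  by rewrite bracketNl bracketNr opprK; apply: bracket0C.
split; split.
- rewrite E1. exact: H1.
- rewrite E2. exact: H2.
- exact: H3.
- exact: H4.
- exact: H5.
- exact: H6.
Qed.

End PoincareRelations.

Section PoincareTensor.
Variable R : realType.

Lemma fmult_cosh (A B : filAlgType R) (h : fhom A B) x : fmult h -> fil 1 x ->
  h (cosh x) = cosh (h x).
Proof. exact: fmult_powser. Qed.

Lemma fmult_sinh (A B : filAlgType R) (h : fhom A B) x : fmult h -> fil 1 x ->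
  h (sinh x) = sinh (h x).
Proof. exact: fmult_powser. Qed.

Lemma fmult_fexp (A B : filAlgType R) (h : fhom A B) x : fmult h -> fil 1 x ->
  h (fexp x) = fexp (h x).
Proof. exact: fmult_powser. Qed.

Lemma krel_fmult (A B : filAlgType R) (h : fhom A B) psi p m chi : fmult h ->
  fil 1 chi -> krel psi p m chi -> krel (h psi) (h p) (h m) (h chi).
Proof.
move=> hM c1 [[R1 R2 R3] [R4 R5 R6]]; have n1 := fil_N c1.
split; split; rewrite -!fmult_bracket//.
- by rewrite R1 fhZ fhB hM.1 fmult_fexp.
- by rewrite R2 fhZ fhB hM.1 fmult_fexp// fhN.
- by rewrite R3 fhN fhZ !fhD.
- by rewrite R4 fh0.
- by rewrite R5 fh0.
- by rewrite R6 fh0.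
Qed.

Lemma erel_tens (P Q : pres R) (t a0 a1 chi : alg P) (t' a0' a1' chi' : alg Q) :
  fil 1 chi -> fil 1 chi' -> erel t a0 a1 chi -> erel t' a0' a1' chi' ->
  erel (t \ox 1 + 1 \ox t' + (cosh chi - 1) \ox a0' + sinh chi \ox a1')
    (a0 \ox 1 + cosh chi \ox a0' + sinh chi \ox a1')
    (a1 \ox 1 + cosh chi \ox a1' + sinh chi \ox a0')
    (chi \ox 1 + 1 \ox chi').
Proof.
move=> c1 c1' /(erel_krel _ _ _ c1) K /(erel_krel _ _ _ c1') K'.
have M1 := @tinl_mult R P Q; have M2 := @tinr_mult R P Q.
have K1 := krel_fmult M1 c1 K; have K2 := krel_fmult M2 c1' K'.
have i1 : fil 1 (tinl chi : alg (ctens P Q)) by exact: fhP.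
have i2 : fil 1 (tinr chi' : alg (ctens P Q)) by exact: fhP.
rewrite !tensx1 !tens1x; apply/erel_krel; first exact: fil_D.
have H : krel (tinl (t - a0) + tinr (t' - a0'))
    (tinl (a0 + a1) + (cosh chi + sinh chi) \ox (a0' + a1'))
    (tinl (a0 - a1) + (cosh chi - sinh chi) \ox (a0' - a1'))
    (tinl chi + tinr chi').
  rewrite cosh_sinhD// cosh_sinhB// !tensE !fmult_fexp//; last exact: fil_N.
  rewrite fhN; apply: krel_comul => // x y; rewrite !inE => xi yi.
  have [u ->] : exists u, x = tinl u by case/or4P: xi => /eqP ->; eexists.
  have [v ->] : exists v, y = tinr v by case/or4P: yi => /eqP ->; eexists.
  by apply/bracket_eq0; exact: tinlr_comm.
rewrite (_ : _ - _ = tinl (t - a0) + tinr (t' - a0')); last first.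
  by rewrite tensBl (tens1x P a0') !fhB; abel.
rewrite (_ : _ + (tinl a1 + _ + _) =
    tinl (a0 + a1) + (cosh chi + sinh chi) \ox (a0' + a1')); last first.
  by rewrite !tensDl !tensDr !fhD; abel.
rewrite (_ : _ - (tinl a1 + _ + _) =
    tinl (a0 - a1) + (cosh chi - sinh chi) \ox (a0' - a1')) //.
by rewrite !tensBl !tensBr !fhB; abel.
Qed.

(** The formulas are half-sums and half-differences of the light-cone antipodes:
    [- fexp (- chi) * p] for [p] and [- fexp chi * m] for [m], with [- psi] added to the value at
    [a0] to give the value at [t]. *)
Lemma erel_anti (B : filAlgType R) (t a0 a1 chi : B) :
  fil 1 chi -> erel t a0 a1 chi ->
  @erel R (fop B) (- (t - a0) - (cosh chi * a0 - sinh chi * a1) : B)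
    (- (cosh chi * a0 - sinh chi * a1) : B)
    (- (cosh chi * a1 - sinh chi * a0) : B) (- chi : B).
Proof.
move=> c1 /(erel_krel _ _ _ c1) K; apply/erel_krel; first exact: (@fil_N R B).
have := krel_anti c1 K; rewrite -(cosh_sinhB c1) -(cosh_sinhD c1).
set a := - (t - a0); set b := - (_ * _); set c := - (_ * _).
have E1 : - (t - a0) - (cosh chi * a0 - sinh chi * a1) -
   - (cosh chi * a0 - sinh chi * a1) = a by rewrite /a; abel.
have E2 : - (cosh chi * a0 - sinh chi * a1) + - (cosh chi * a1 - sinh chi * a0) = b.
  by rewrite /b !mulrDl !mulrDr !mulNr; abel.
have E3 : - (cosh chi * a0 - sinh chi * a1) - - (cosh chi * a1 - sinh chi * a0) = c.
  by rewrite /c !mulrDl !mulrBr; abel.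
(* The three equalities live in [B] while the relations live in [fop B]; passing through [G] lets
   conversion identify the two carriers. *)
have G (u v w u' v' w' : fop B) : u' = u -> v' = v -> w' = w ->
    @krel R (fop B) u v w (- chi : B) -> @krel R (fop B) u' v' w' (- chi : B).
  by move=> -> -> ->.
exact: (G _ _ _ _ _ _ E1 E2 E3).
Qed.

End PoincareTensor.

(** * Hopf axioms for primitive and skew-primitive elements *)

Section HopfAxioms.
Variables (R : realType) (P : pres R) (augP : augmented P).
Variables (D : fhom (alg P) (alg (ctens P P))) (S : fhom (alg P) (fop (alg P))).
Hypotheses (DM : fmult D) (SM : fmult S).
Local Notation ax := (hopf_axioms_at augP D S).
Implicit Types x y g : alg P.

Lemma hopf_axiomsD x y : ax x -> ax y -> ax (x + y).
Proof.
move=> [x1 x2 x3 x4 x5] [y1 y2 y3 y4 y5]; rewrite /hopf_axioms_at !fhD.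
by rewrite x1 x2 x3 x4 x5 y1 y2 y3 y4 y5 addr0.
Qed.

Lemma hopf_axiomsB x y : ax x -> ax y -> ax (x - y).
Proof.
move=> [x1 x2 x3 x4 x5] [y1 y2 y3 y4 y5]; rewrite /hopf_axioms_at !fhB.
by rewrite x1 x2 x3 x4 x5 y1 y2 y3 y4 y5 subrr.
Qed.

Lemma hopf_axioms_half x : ax (x + x) -> ax x.
Proof.
rewrite /hopf_axioms_at !fhD => -[x1 x2 x3 x4 x5].
by split; apply: addxx_inj; rewrite ?addr0.
Qed.

(** For [x] skew-primitive over a group-like [g] with inverse [g'], the antipode axioms reduce to
    [- g' x + g' x = 0] and [x - g g' x = 0]. *)
Lemma hopf_axioms_skew g g' x : eps x = 0 -> D x = x \ox 1 + g \ox x ->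
  funop S x = - (g' * x) -> eps g = 1 -> D g = g \ox g -> funop S g = g' ->
  g * g' = 1 -> ax x.
Proof.
move=> ex Dx Sx eg Dg Sg gg; split; rewrite ?Dx.
- have L : tmap D (fid _) (D x) = D x \ox 1 + D g \ox x.
    by rewrite {1}Dx fhD (tmapE D (fid _) x 1) (tmapE D (fid _) g x).
  have Rr : tmap (fid _) D (D x) = x \ox D 1 + g \ox D x.
    by rewrite {1}Dx fhD (tmapE (fid _) D x 1) (tmapE (fid _) D g x).
  rewrite Dx in L Rr; rewrite L Rr Dg DM.1 (tensDl (x \ox 1)) !(fhD (tassoc P P P)).
  by rewrite !tassocE tens11 tensDr addrA.
- by rewrite fhD !tliftE !fepsE ex eg scale0r mul0r add0r scale1r mul1r.
- rewrite fhD !tliftE !fepsE ex scale0r mulr0 addr0.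
  by rewrite (eps_monoid augP).1 scale1r mulr1.
- by rewrite fhD !tliftE Sx Sg mulr1 addNr.
- by rewrite fhD !tliftE Sx funopE SM.1 mulrN mulrA gg mul1r mulr1 subrr.
Qed.

Lemma hopf_axioms_primitive x : eps x = 0 -> D x = x \ox 1 + 1 \ox x ->
  funop S x = - x -> ax x.
Proof.
move=> ex Dx Sx; apply: (@hopf_axioms_skew 1 1) => //.
- by rewrite mul1r.
- exact: (eps_monoid augP).1.
- by rewrite DM.1 tens11.
- by rewrite funopE SM.1.
- by rewrite mul1r.
Qed.

(** The axioms are additive, so they are checked on [chi], [a0 + a1], [a0 - a1] and [t - a0], all
    primitive or skew-primitive, and carried back by sums, differences and halving. *)
Lemma hopf_axioms_poincare (t a0 a1 chi : alg P) :
  fil 1 chi -> eps t = 0 -> eps a0 = 0 -> eps a1 = 0 -> eps chi = 0 ->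
  [/\ D t = t \ox 1 + 1 \ox t + (cosh chi - 1) \ox a0 + sinh chi \ox a1,
      D a0 = a0 \ox 1 + cosh chi \ox a0 + sinh chi \ox a1,
      D a1 = a1 \ox 1 + cosh chi \ox a1 + sinh chi \ox a0 &
      D chi = chi \ox 1 + 1 \ox chi] ->
  [/\ funop S t = - (t - a0) - (cosh chi * a0 - sinh chi * a1),
      funop S a0 = - (cosh chi * a0 - sinh chi * a1),
      funop S a1 = - (cosh chi * a1 - sinh chi * a0) &
      funop S chi = - chi] ->
  [/\ ax t, ax a0, ax a1 & ax chi].
Proof.
move=> c1 et e0 e1 ec [Dt D0 D1 Dc] [St S0 S1 Sc].
have n1 := fil_N c1.
have eD x y : eps (x + y) = eps x + eps y.
  by rewrite -[x]scale1r (eps_linear augP) mul1r scale1r.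
have eN x : eps (- x) = - eps x.
  by rewrite -scaleN1r -[_ *: x]addr0 (eps_linear augP) (eps0 augP) mulN1r addr0.
(* The exponential of a primitive element is group-like, because [x \ox 1] and [1 \ox x] commute. *)
have group x : fil 1 x -> eps x = 0 -> D x = x \ox 1 + 1 \ox x -> funop S x = - x ->
    [/\ eps (fexp x) = 1, D (fexp x) = fexp x \ox fexp x &
      funop S (fexp x) = fexp (- x)].
  move=> x1 ex Dx Sx; split.
  - rewrite -[LHS](eps_scalar augP) -(fepsE augP) fmult_fexp//; last exact: feps_mult.
    by rewrite fepsE ex scale0r fexp0 (eps_monoid augP).1.
  - rewrite fmult_fexp// Dx tensx1 tens1x fexpD; [|exact: fhP|exact: fhP|].
      by rewrite tensE !fmult_fexp//; [exact: tinr_mult|exact: tinl_mult].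
    exact: tinlr_comm.
  - rewrite funopE fmult_fexp//.
    have -> : S x = (- x : alg P) := Sx.
    exact: (@fop_fexpE R (alg P) (- x) (fil_N x1)).
have [E1 E2 E3] := group chi c1 ec Dc Sc.
have [F1 F2 F3] : [/\ eps (fexp (- chi)) = 1,
    D (fexp (- chi)) = fexp (- chi) \ox fexp (- chi) &
    funop S (fexp (- chi)) = fexp chi].
  rewrite -[in X in _ = fexp X](opprK chi); apply: group => //.
  - by rewrite eN ec oppr0.
  - by rewrite fhN Dc opprD tensNl tensNr.
  - by rewrite fhN Sc.
have Ep := cosh_sinhD c1; have Em := cosh_sinhB c1.
have axc : ax chi by exact: hopf_axioms_primitive.
have axp : ax (a0 + a1).
  apply: (@hopf_axioms_skew (fexp chi) (fexp (- chi))) => //.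
  - by rewrite eD e0 e1 addr0.
  - by rewrite fhD D0 D1 -Ep !tensDl !tensDr; abel.
  - by rewrite fhD S0 S1 -Em !mulrDl !mulrDr !mulNr; abel.
  - exact: fexpNr.
have axm : ax (a0 - a1).
  apply: (@hopf_axioms_skew (fexp (- chi)) (fexp chi)) => //.
  - by rewrite eD eN e0 e1 subrr.
  - by rewrite fhB D0 D1 -Em !tensDl !tensDr !tensNl !tensNr; abel.
  - by rewrite fhB S0 S1 -Ep !mulrDl !mulrBr; abel.
  - exact: fexpNl.
have axpsi : ax (t - a0).
  apply: hopf_axioms_primitive.
  - by rewrite eD eN et e0 subrr.
  - by rewrite fhB Dt D0 !tensBl !tensBr; abel.
  - by rewrite fhB St S0; abel.
have ax0 : ax a0.
  apply: hopf_axioms_half; rewrite (_ : a0 + a0 = (a0 + a1) + (a0 - a1)); last by abel.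
  exact: hopf_axiomsD.
have ax1 : ax a1.
  apply: hopf_axioms_half; rewrite (_ : a1 + a1 = (a0 + a1) - (a0 - a1)); last by abel.
  exact: hopf_axiomsB.
by split=> //; rewrite (_ : t = (t - a0) + a0); [exact: hopf_axiomsD|abel].
Qed.

End HopfAxioms.

(** * Hopf structures on the extended group, the kappa-Poincare group and the line *)

Section Presentations.
Variable R : realType.

Lemma powser_nil (X : finType) c (f : ncs R X) : fil 1 f -> f [::] = 0 ->
  powser c f [::] = fpsC (c 0%N).
Proof.
move=> f1 f0; apply/funext => k.
have fk j : (f ^+ j.+1) [::] = 0 by rewrite exprS ncs_mul_nil f0 mul0r.
have := powserP c k.+1 f1; set s := psum c f k.+1 => /(_ [::] k).
rewrite add0n ltnSn => /(_ isT) H.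
transitivity (s [::] k).
  by apply/eqP; rewrite -subr_eq0; apply/eqP.
congr (_ k); rewrite /s /psum ncs_sumE big_ord_recl big1.
  transitivity (fpsC (c 0%N) * 1 + 0); first by [].
  by rewrite mulr1 addr0.
move=> i _; transitivity (fpsC (c i.+1) * (f ^+ i.+1) [::]); first by [].
by rewrite fk mulr0.
Qed.

Lemma bracket_nil (X : finType) (f g : ncs R X) : (bracket f g) [::] = 0.
Proof.
transitivity ((f * g) [::] - (g * f) [::]) => //.
by rewrite !ncs_mul_nil mulrC subrr.
Qed.

Lemma nilB (X : finType) (f g : ncs R X) : (f - g) [::] = f [::] - g [::].
Proof. by []. Qed.
Lemma nilD (X : finType) (f g : ncs R X) : (f + g) [::] = f [::] + g [::].
Proof. by []. Qed.
Lemma nilZ (X : finType) a (f : ncs R X) : (a *: f) [::] = a * f [::].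
Proof. by []. Qed.

Lemma cosh_nil (X : finType) (x : X) : (cosh (gen x : ncs R X) - 1) [::] = 0.
Proof.
rewrite nilB /cosh powser_nil//; last exact: fil_gen.
by rewrite invr1 fpsC1 subrr.
Qed.

Lemma sinh_nil (X : finType) (x : X) : (sinh (gen x : ncs R X)) [::] = 0.
Proof. by rewrite /sinh powser_nil//; [rewrite fpsC0|exact: fil_gen]. Qed.

Local Notation nilE :=
  (nilB, nilD, nilZ, bracket_nil, cosh_nil, sinh_nil, mulr0, subrr, addr0).

Lemma ext_augmented : augmented (ext_pres R).
Proof. by move=> r [[[[[->|->]|->]|->]|->]|->]; rewrite !nilE. Qed.

Lemma kappa_augmented : augmented (kappa_pres R).
Proof. by move=> r [[->|->]|->]; rewrite !nilE. Qed.

Lemma line_augmented : augmented (line_pres R). Proof. by []. Qed.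

Definition ext_gens (T : Type) (t a0 a1 chi : T) (x : ext_gen) : T :=
  match x with Etheta => t | Ea0 => a0 | Ea1 => a1 | Echi => chi end.

Definition kappa_gens (T : Type) (a0 a1 chi : T) (x : kappa_gen) : T :=
  match x with Ka0 => a0 | Ka1 => a1 | Kchi => chi end.

Lemma fmult_rel (A B : filAlgType R) (h : fhom A B) x y z : fmult h ->
  h (bracket x y - alpha *: z) = bracket (h x) (h y) - alpha *: h z.
Proof. by move=> hM; rewrite [LHS]fhB fhZ fmult_bracket. Qed.

Section Lifts.
Variables (B : filAlgType R) (t a0 a1 chi : B).
Hypotheses (t1 : fil 1 t) (a01 : fil 1 a0) (a11 : fil 1 a1) (c1 : fil 1 chi).

Let ext_fil x : fil 1 (ext_gens t a0 a1 chi x). Proof. by case: x. Qed.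
Let kappa_fil x : fil 1 (kappa_gens a0 a1 chi x). Proof. by case: x. Qed.

Lemma ext_lift : erel t a0 a1 chi ->
  exists h : fhom (alg (ext_pres R)) B, fmult h /\
    forall x, h (agen (ext_pres R) x) = ext_gens t a0 a1 chi x.
Proof.
move=> [[R1 R2 R3] [R4 R5 R6]]; apply: (@alg_lift R (ext_pres R) B _ ext_fil).
have M := fext_mult ext_fil; have g1 := fil_gen R Echi.
move=> r [[[[[->|->]|->]|->]|->]|->];
  rewrite ?(fmult_rel _ _ _ M) ?(fmult_bracket _ _ M) ?fhB ?M.1
    ?fmult_cosh ?fmult_sinh// !fext_gen.
- by rewrite R1 subrr.
- by rewrite R2.
- by rewrite R3 subrr.
- by rewrite R4 subrr.
- by rewrite R5 subrr.
- by rewrite R6 subrr.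
Qed.

Lemma kappa_lift : erel a0 a0 a1 chi ->
  exists h : fhom (alg (kappa_pres R)) B, fmult h /\
    forall x, h (agen (kappa_pres R) x) = kappa_gens a0 a1 chi x.
Proof.
move=> [[R1 R2 R3] [R4 R5 R6]]; apply: (@alg_lift R (kappa_pres R) B _ kappa_fil).
have M := fext_mult kappa_fil; have g1 := fil_gen R Kchi.
move=> r [[->|->]|->];
  rewrite ?(fmult_rel _ _ _ M) ?(fmult_bracket _ _ M) ?fhB ?M.1
    ?fmult_cosh ?fmult_sinh// !fext_gen.
- by rewrite R1 subrr.
- by rewrite R5 subrr.
- by rewrite R6 subrr.
Qed.

Lemma tilde_lift : erel (t + a0) a0 a1 chi ->
  exists h : fhom (alg (tilde_pres R)) B, fmult h /\
    forall x, h (agen (tilde_pres R) x) = ext_gens t a0 a1 chi x.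
Proof.
move=> E; have [[R1 R2 R3] [R4 R5 R6]] := E; apply: (@alg_lift R (tilde_pres R) B _ ext_fil).
have M := fext_mult ext_fil; have g1 := fil_gen R Echi.
move=> r [[[[[->|->]|->]|->]|->]|->];
  rewrite ?(fmult_rel _ _ _ M) ?(fmult_bracket _ _ M) ?fhB ?fhD ?M.1
    ?fmult_cosh ?fmult_sinh// !fext_gen.
- by rewrite R1 subrr.
(* The next three relations, for [t] alone, are those for [t + a0] minus those for [a0]. *)
- by move: R2; rewrite bracketDl bracketxx addr0.
- by move: R3; rewrite bracketDl R1 scalerDr -[RHS]add0r => /addIr.
- by move: R4; rewrite bracketDr R5 -[RHS]add0r => /addIr.
- by rewrite R5 subrr.
- by rewrite R6 subrr.
Qed.

End Lifts.

Lemma line_lift (B : filAlgType R) (z : B) : fil 1 z ->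
  exists h : fhom (alg (line_pres R)) B, fmult h /\ h (agen (line_pres R) tt) = z.
Proof.
move=> z1; have [|h [hM hz]] := @alg_lift R (line_pres R) B _ (fun _ : unit => z1).
  by [].
by exists h.
Qed.

Lemma alg_rel (P : pres R) (x : pgen P) (y z : ncs R (pgen P)) :
  @prel R P (bracket (gen x) y - alpha *: z) ->
  bracket (agen P x) (alg_pi y) = alpha *: (alg_pi z : alg P).
Proof.
move=> /alg_pi_rel; rewrite -[alg_pi _]/(fpi P _) fhB fhZ fmult_bracket; last exact: fpi_mult.
by move=> /subr0_eq.
Qed.

Lemma alg_rel0 (P : pres R) (x y : pgen P) :
  @prel R P (bracket (gen x) (gen y)) -> bracket (agen P x) (agen P y) = 0.
Proof.
by move=> /alg_pi_rel; rewrite -[alg_pi _]/(fpi P _) fmult_bracket; last exact: fpi_mult.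
Qed.

Lemma agen_cosh (P : pres R) (x : pgen P) :
  alg_pi (cosh (gen x) - 1) = cosh (agen P x) - 1.
Proof.
rewrite -[LHS]/(fpi P _) fhB (fpi_mult P).1 fmult_cosh//; first exact: fpi_mult.
exact: fil_gen.
Qed.

Lemma agen_sinh (P : pres R) (x : pgen P) : alg_pi (sinh (gen x)) = sinh (agen P x).
Proof.
rewrite -[LHS]/(fpi P _) fmult_sinh//; first exact: fpi_mult.
exact: fil_gen.
Qed.

Lemma ext_erel : erel (agen (ext_pres R) Etheta) (agen (ext_pres R) Ea0)
  (agen (ext_pres R) Ea1) (agen (ext_pres R) Echi).
Proof.
split; split.
- by apply: alg_rel; do 5 left.
- by apply: alg_rel0; do 4 left; right.
- by apply: alg_rel; do 3 left; right.
- by rewrite -agen_cosh; apply: alg_rel; do 2 left; right.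
- by rewrite -agen_cosh; apply: alg_rel; left; right.
- by rewrite -agen_sinh; apply: alg_rel; right.
Qed.

Lemma kappa_erel : erel (agen (kappa_pres R) Ka0) (agen (kappa_pres R) Ka0)
  (agen (kappa_pres R) Ka1) (agen (kappa_pres R) Kchi).
Proof.
have R1 : bracket (agen (kappa_pres R) Ka0) (agen (kappa_pres R) Ka1) =
    alpha *: agen (kappa_pres R) Ka0.
  by apply: alg_rel; do 2 left.
have R2 : bracket (agen (kappa_pres R) Kchi) (agen (kappa_pres R) Ka0) =
    alpha *: (cosh (agen (kappa_pres R) Kchi) - 1).
  by rewrite -agen_cosh; apply: alg_rel; left; right.
split; split=> //; first exact: bracketxx.
by rewrite -agen_sinh; apply: alg_rel; right.
Qed.

Lemma tilde_erel (P := tilde_pres R) : erel (agen P Etheta + agen P Ea0) (agen P Ea0)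
  (agen P Ea1) (agen P Echi).
Proof.
have R1 : bracket (agen P Ea0) (agen P Ea1) = alpha *: (agen P Etheta + agen P Ea0).
  by rewrite -[_ + _](raddfD (@alg_pi R P)); apply: alg_rel; do 5 left.
have R2 : bracket (agen P Etheta) (agen P Ea0) = 0.
  by apply: alg_rel0; do 4 left; right.
have R3 : bracket (agen P Etheta) (agen P Ea1) = 0.
  by apply: alg_rel0; do 3 left; right.
have R4 : bracket (agen P Echi) (agen P Etheta) = 0.
  by apply: alg_rel0; do 2 left; right.
have R5 : bracket (agen P Echi) (agen P Ea0) = alpha *: (cosh (agen P Echi) - 1).
  by rewrite -agen_cosh; apply: alg_rel; left; right.
split; split=> //.
- by rewrite bracketDl R2 bracketxx addr0.
- by rewrite bracketDl R3 R1 add0r.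
- by rewrite bracketDr R4 R5 add0r.
- by rewrite -agen_sinh; apply: alg_rel; right.
Qed.

Lemma tens_formula_fil (P : pres R) (t a0 a1 chi : alg P) :
  fil 1 t -> fil 1 a0 -> fil 1 a1 -> fil 1 chi ->
  [/\ fil 1 (t \ox 1 + 1 \ox t + (cosh chi - 1) \ox a0 + sinh chi \ox a1),
      fil 1 (a0 \ox 1 + cosh chi \ox a0 + sinh chi \ox a1),
      fil 1 (a1 \ox 1 + cosh chi \ox a1 + sinh chi \ox a0) &
      fil 1 (chi \ox 1 + 1 \ox chi)].
Proof.
move=> t1 a01 a11 c1.
have L (x y : alg P) : fil 1 x -> fil 1 (x \ox y) by exact: tens_fill.
have Rr (x y : alg P) : fil 1 y -> fil 1 (x \ox y) by exact: tens_filr.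
by split; do ?apply: fil_D; do ?[by apply: L]; do ?[by apply: Rr].
Qed.

Lemma anti_formula_fil (B : filAlgType R) (t a0 a1 chi : B) :
  fil 1 t -> fil 1 a0 -> fil 1 a1 -> fil 1 chi ->
  [/\ fil 1 (- (t - a0) - (cosh chi * a0 - sinh chi * a1)),
      fil 1 (- (cosh chi * a0 - sinh chi * a1)),
      fil 1 (- (cosh chi * a1 - sinh chi * a0)) & fil 1 (- chi)].
Proof.
move=> t1 a01 a11 c1.
have H x y : fil 1 x -> fil 1 y -> fil 1 (- (cosh chi * x - sinh chi * y)).
  by move=> x1 y1; apply: fil_N; apply: fil_B; exact: fil_Ml.
split; [|exact: H|exact: H|exact: fil_N].
by apply: fil_D; [apply: fil_N; exact: fil_B|exact: H].
Qed.

Lemma ext_fhopf (P := ext_pres R) (t := agen P Etheta) (a0 := agen P Ea0)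
    (a1 := agen P Ea1) (chi := agen P Echi) :
  exists H : fhopf P,
    [/\ fcomul H t = t \ox 1 + 1 \ox t + (cosh chi - 1) \ox a0 + sinh chi \ox a1,
        fcomul H a0 = a0 \ox 1 + cosh chi \ox a0 + sinh chi \ox a1,
        fcomul H a1 = a1 \ox 1 + cosh chi \ox a1 + sinh chi \ox a0 &
        fcomul H chi = chi \ox 1 + 1 \ox chi] /\
    [/\ funop (fanti H) t = - (t - a0) - (cosh chi * a0 - sinh chi * a1),
        funop (fanti H) a0 = - (cosh chi * a0 - sinh chi * a1),
        funop (fanti H) a1 = - (cosh chi * a1 - sinh chi * a0) &
        funop (fanti H) chi = - chi].
Proof.
have [t1 a01 a11 c1] : [/\ fil 1 t, fil 1 a0, fil 1 a1 & fil 1 chi].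
  by split; exact: agen_fil.
have [F1 F2 F3 F4] := tens_formula_fil t1 a01 a11 c1.
have [G1 G2 G3 G4] := anti_formula_fil t1 a01 a11 c1.
have [D [DM DE]] := ext_lift F1 F2 F3 F4 (erel_tens c1 c1 ext_erel ext_erel).
have [S [SM SE]] := @ext_lift (fop (alg P)) _ _ _ _ G1 G2 G3 G4 (erel_anti c1 ext_erel).
have Ds := And4 (DE Etheta) (DE Ea0) (DE Ea1) (DE Echi).
have Ss := And4 (SE Etheta) (SE Ea0) (SE Ea1) (SE Echi).
have [X1 X2 X3 X4] := hopf_axioms_poincare ext_augmented DM SM c1
  (eps_agen ext_augmented _) (eps_agen ext_augmented _) (eps_agen ext_augmented _)
  (eps_agen ext_augmented _) Ds Ss.
have [|H [HD HS]] := fhopf_of_generators (augP := ext_augmented) DM SM.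
  by case.
by exists H; rewrite HD HS.
Qed.

Lemma kappa_fhopf (P := kappa_pres R) (a0 := agen P Ka0)
    (a1 := agen P Ka1) (chi := agen P Kchi) :
  exists H : fhopf P,
    [/\ fcomul H a0 = a0 \ox 1 + cosh chi \ox a0 + sinh chi \ox a1,
        fcomul H a1 = a1 \ox 1 + cosh chi \ox a1 + sinh chi \ox a0 &
        fcomul H chi = chi \ox 1 + 1 \ox chi] /\
    [/\ funop (fanti H) a0 = - (cosh chi * a0 - sinh chi * a1),
        funop (fanti H) a1 = - (cosh chi * a1 - sinh chi * a0) &
        funop (fanti H) chi = - chi].
Proof.
have [a01 a11 c1] : [/\ fil 1 a0, fil 1 a1 & fil 1 chi].
  by split; exact: agen_fil.
(* For [theta = a0] the formulas for [theta] collapse to those for [a0], so the kappa-Poincare case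
   is an instance of the extended one. *)
have ED : a0 \ox 1 + 1 \ox a0 + (cosh chi - 1) \ox a0 + sinh chi \ox a1 =
    a0 \ox 1 + cosh chi \ox a0 + sinh chi \ox a1.
  by rewrite tensBl; abel.
have ES : - (a0 - a0) - (cosh chi * a0 - sinh chi * a1) =
    - (cosh chi * a0 - sinh chi * a1) by abel.
have [_ F2 F3 F4] := tens_formula_fil a01 a01 a11 c1.
have [_ G2 G3 G4] := anti_formula_fil a01 a01 a11 c1.
have E1 := erel_tens c1 c1 kappa_erel kappa_erel; rewrite ED in E1.
have E2 := erel_anti c1 kappa_erel; rewrite ES in E2.
have [D [DM DE]] := kappa_lift F2 F3 F4 E1.
have [S [SM SE]] := @kappa_lift (fop (alg P)) _ _ _ G2 G3 G4 E2.
have aug := kappa_augmented; have e := eps_agen aug.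
have [_ X2 X3 X4] := hopf_axioms_poincare aug DM SM c1 (e Ka0) (e Ka0) (e Ka1) (e Kchi)
  (And4 (eq_trans (DE Ka0) (esym ED)) (DE Ka0) (DE Ka1) (DE Kchi))
  (And4 (eq_trans (SE Ka0) (esym ES)) (SE Ka0) (SE Ka1) (SE Kchi)).
have [|H [HD HS]] := fhopf_of_generators (augP := aug) DM SM.
  by case.
exists H; rewrite HD HS; split; split;
  first [exact: (DE Ka0)|exact: (DE Ka1)|exact: (DE Kchi)
        |exact: (SE Ka0)|exact: (SE Ka1)|exact: (SE Kchi)].
Qed.

Lemma line_fhopf (z := agen (line_pres R) tt) :
  exists H : fhopf (line_pres R),
    fcomul H z = z \ox 1 + 1 \ox z /\ funop (fanti H) z = - z.
Proof.
have z1 : fil 1 z by exact: agen_fil.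
have F : fil 1 (z \ox 1 + 1 \ox z).
  by apply: fil_D; [exact: tens_fill|exact: tens_filr].
have [D [DM DE]] := line_lift F.
have [S [SM SE]] := @line_lift (fop (alg (line_pres R))) (- z : alg (line_pres R)) (fil_N z1).
have aug := line_augmented.
have [|H [HD HS]] := fhopf_of_generators (augP := aug) DM SM.
  by case; apply: hopf_axioms_primitive => //; exact: (eps_agen aug).
by exists H; rewrite HD HS.
Qed.

End Presentations.

(** * Non-triviality *)

Section ContinuousMorphism.
Variables (R : realType) (P : pres R) (B : filAlgType R).

Lemma ncs_fmult_eq (X : finType) (g h : fhom (ncs R X) B) :
  fmult g -> fmult h -> (forall x, g (gen x) = h (gen x)) -> g =1 h.
Proof.
move=> gM hM gh; apply: ncs_fhom_eq => w; rewrite !fmult_mono//.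
by apply: eq_bigr => x _; exact: gh.
Qed.

(** On words [f] agrees with the free extension of its values on generators, and by continuity on
    all series; that extension preserves the filtration. *)
Lemma lrmorphism_fhom (f : {lrmorphism alg P -> B}) :
  fil_continuous fil fil f -> (forall x, fil 1 (f (agen P x))) ->
  exists2 h : fhom (alg P) B, fmult h & h =1 f.
Proof.
move=> fc f1; have hM := fext_mult f1; set h := fext f1 in hM.
have fM : fmult f by split; [exact: rmorph1|exact: rmorphM].
have fw w : f (alg_word w) = h (mono w).
  rewrite fext_mono /alg_word; elim: w => [|x w IHw]; first by rewrite !big_nil rmorph1.
  by rewrite !big_cons fM.2 IHw.
have fh u : f (alg_pi u) = h u.
  apply: fil_eq => n; have [m mn] := fc n.
  (* The truncation must be good to order [m] for the continuity of [f] and to order [n] for the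
     filtered map [h]. *)
  pose k := maxn m n; set s := lsum mono u k.
  have us : fil k (u - s) by exact: mono_dense.
  apply: (@fil_trans _ _ _ _ (f (alg_pi s))).
    rewrite -raddfB -raddfB; apply: mn; apply: filW (alg_pi_fil us).
    exact: leq_maxl.
  have -> : f (alg_pi s) = h s.
    rewrite /s /lsum fh_sum !raddf_sum; apply: eq_bigr => j _.
    rewrite fh_sum !raddf_sum; apply: eq_bigr => w _.
    rewrite fhZ -fw -alg_pi_mono.
    transitivity (f (u w *: (alg_pi (mono w) : alg P))); last exact: linearZZ.
    by congr (f _); exact: linearZZ.
  rewrite -fhB -opprB fhN; apply: fil_N; apply: fhP.
  by apply: filW us; exact: leq_maxr.
have ff n x : fil n x -> fil n (f x).
  by move=> [u un <-]; rewrite fh; exact: fhP.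
by exists (@FHom R _ _ f ff).
Qed.

End ContinuousMorphism.

(** * Functionals of total degree two *)

Section Quadratic.
Variables (R : realType) (X : finType) (c : X -> X -> R) (d : X -> R).
Local Notation F := (ncs R X).
Implicit Types f g : F.

(* Modulo total degree three, the ideal of a presentation with relations of
   degree two is spanned by these relations, so such a functional descends to
   the presented algebra as soon as it kills them. *)
Definition q2 f : R :=
  \sum_i d i * f [:: i] 1%N + \sum_i \sum_j c i j * f [:: i; j] 0%N.

Lemma ncsD_coef f g w k : (f + g) w k = f w k + g w k. Proof. by []. Qed.
Lemma ncsN_coef f w k : (- f) w k = - f w k. Proof. by []. Qed.

Lemma q2D f g : q2 (f + g) = q2 f + q2 g.
Proof.
rewrite /q2 addrACA; congr (_ + _); rewrite -big_split; apply: eq_bigr => i _ /=.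
  by rewrite ncsD_coef mulrDr.
by rewrite -big_split; apply: eq_bigr => j _ /=; rewrite ncsD_coef mulrDr.
Qed.

Lemma q2N f : q2 (- f) = - q2 f.
Proof.
rewrite /q2 opprD -!sumrN; congr (_ + _); apply: eq_bigr => i _.
  by rewrite ncsN_coef mulrN.
by rewrite -sumrN; apply: eq_bigr => j _; rewrite ncsN_coef mulrN.
Qed.

Lemma q2B f g : q2 (f - g) = q2 f - q2 g.
Proof. by rewrite q2D q2N. Qed.

Lemma q2_fil3 f : fil 3 f -> q2 f = 0.
Proof.
move=> f3; rewrite /q2 !big1 ?addr0// => i _; last by rewrite f3 ?mulr0.
by rewrite big1// => j _; rewrite f3 ?mulr0.
Qed.

Lemma q2_const (a : R) f : q2 (fpsC a *: f) = a * q2 f.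
Proof.
have E w k : (fpsC a *: f) w k = a * f w k.
  transitivity ((fpsC a * f w) k) => //.
  rewrite fpsE_mul big_ord_recl /= subn0 big1 ?addr0// => i _.
  by rewrite /= mul0r.
rewrite /q2 mulrDr !mulr_sumr; congr (_ + _); apply: eq_bigr => i _.
  by rewrite E mulrCA.
by rewrite mulr_sumr; apply: eq_bigr => j _; rewrite E mulrCA.
Qed.

Lemma ncs_const_fil f : fil 1 (f - fpsC (f [::] 0%N) *: 1).
Proof.
move=> w k; rewrite ltnS leqn0 addn_eq0 size_eq0 => /andP[/eqP -> /eqP ->].
transitivity (f [::] 0%N - (fpsC (f [::] 0%N) * 1) 0%N) => //.
by rewrite mulr1 subrr.
Qed.

(** Multiplying an element of order two by [x] only sees the scalar [x [::] 0]: the rest of [x] has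
    order one and pushes the product to order three, where [q2] vanishes. *)
Lemma q2_ideal : closed_ideal [set f | fil 2 f /\ q2 f = 0].
Proof.
have H (x y : F) : fil 2 y -> q2 y = 0 -> q2 (x * y) = 0 /\ q2 (y * x) = 0.
  move=> y2 y0; set a := x [::] 0%N.
  have xE : x = (x - fpsC a *: 1) + fpsC a *: 1 by rewrite subrK.
  rewrite xE mulrDl mulrDr !q2D -scalerAl -scalerAr mul1r mulr1 q2_const y0 mulr0.
  rewrite !addr0; split; apply: q2_fil3.
    by rewrite -[3%N]/(1 + 2)%N; apply: fil_M => //; exact: ncs_const_fil.
  by rewrite -[3%N]/(2 + 1)%N; apply: fil_M => //; exact: ncs_const_fil.
split=> [|x y [x2 x0] [y2 y0]|x y [y2 y0]|x clx].
- by split; [exact: fil_0|apply: q2_fil3; exact: fil_0].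
- by split; [exact: fil_B|rewrite q2B x0 y0 subrr].
- by have [] := H x y y2 y0; split; split=> //; [exact: fil_Ml|exact: fil_Mr].
- have [y [y2 y0] xy] := clx 3; rewrite -[x](subrK y); split.
    by apply: fil_D => //; exact: filW xy.
  by rewrite q2D y0 addr0; exact: q2_fil3.
Qed.

Lemma q2_alpha f : q2 (alpha *: f) = \sum_i d i * f [:: i] 0%N.
Proof.
have E0 w : (alpha *: f) w 0%N = 0 by exact: fps_alphaM0.
have E1 w : (alpha *: f) w 1%N = f w 0%N by exact: (fps_alphaMS (f w) 0).
rewrite /q2 [X in _ + X]big1 ?addr0 => [|i _].
  by apply: eq_bigr => i _; rewrite E1.
by rewrite big1// => j _; rewrite E0 mulr0.
Qed.

Lemma q2M f g : f [::] = 0 -> g [::] = 0 ->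
  q2 (f * g) = \sum_i \sum_j c i j * (f [:: i] 0%N * g [:: j] 0%N).
Proof.
move=> f0 g0; rewrite /q2 big1 ?add0r => [|i _].
  apply: eq_bigr => i _; apply: eq_bigr => j _; congr (_ * _).
  rewrite ncs_mulE !big_ord_recl big_ord0 /= f0 g0 mul0r mulr0 add0r !addr0.
  exact: fpsE_mul0.
rewrite ncs_mulE !big_ord_recl big_ord0 /= f0 g0 mul0r mulr0 !addr0.
exact: mulr0.
Qed.

Lemma gen_coef x y k : (gen x : F) [:: y] k = ((y == x) && (k == 0%N))%:R.
Proof.
rewrite /gen eqseq_cons andbT; by case: (y == x) => //=.
Qed.

Lemma q2_gens x y : q2 (gen x * gen y) = c x y.
Proof.
rewrite q2M// (bigD1 x) //= (bigD1 y) //= !gen_coef !eqxx !mulr1.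
rewrite big1 ?addr0 => [|j jy]; last by rewrite !gen_coef (negPf jy) !mulr0.
rewrite big1 ?addr0// => i ix; rewrite big1// => j _.
by rewrite !gen_coef (negPf ix) mul0r mulr0.
Qed.

Lemma q2_bracket x y : q2 (bracket (gen x) (gen y)) = c x y - c y x.
Proof. by rewrite q2B !q2_gens. Qed.

End Quadratic.

Definition quadratic (R : realType) (P : pres R) (c : pgen P -> pgen P -> R)
    (d : pgen P -> R) : Prop := forall r, @prel R P r -> fil 2 r /\ q2 c d r = 0.

Section QuadraticAlg.
Variables (R : realType) (P : pres R).
Variables (c : pgen P -> pgen P -> R) (d : pgen P -> R).
Hypotheses (augP : augmented P) (qP : quadratic c d).
Implicit Types x y : alg P.

Lemma quadratic_ideal f : @alg_ideal_set R P f -> fil 2 f /\ q2 c d f = 0.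
Proof.
move=> /(_ [set g | fil 2 g /\ q2 c d g = 0]); apply; split; last exact: qP.
exact: q2_ideal.
Qed.

Definition aq2 x : R := q2 c d (repr x : ncs R (pgen P)).
Definition lin (i : pgen P) x : R := (repr x : ncs R (pgen P)) [:: i] 0%N.

Lemma aq2E f : aq2 (alg_pi f) = q2 c d f.
Proof.
apply: subr0_eq; rewrite -q2B; exact: (quadratic_ideal (alg_repr_pi f)).2.
Qed.

Lemma linE i f : lin i (alg_pi f) = f [:: i] 0%N.
Proof.
apply: subr0_eq.
by have [/(_ [:: i] 0%N isT)] := quadratic_ideal (alg_repr_pi f).
Qed.

Lemma linD i x y : lin i (x + y) = lin i x + lin i y.
Proof. by rewrite -(alg_pi_repr x) -(alg_pi_repr y) -raddfD !linE. Qed.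

Lemma aq2D x y : aq2 (x + y) = aq2 x + aq2 y.
Proof. by rewrite -(alg_pi_repr x) -(alg_pi_repr y) -raddfD !aq2E q2D. Qed.

Lemma aq2B x y : aq2 (x - y) = aq2 x - aq2 y.
Proof. by rewrite -(alg_pi_repr x) -(alg_pi_repr y) -raddfB !aq2E q2B. Qed.

Lemma aq2_fil3 x : fil 3 x -> aq2 x = 0.
Proof. by move=> [f f3 <-]; rewrite aq2E; exact: q2_fil3. Qed.

Lemma aq2_alpha x : aq2 (alpha *: x) = \sum_i d i * lin i x.
Proof.
rewrite -(alg_pi_repr x) -linearZ aq2E q2_alpha.
by apply: eq_bigr => i _; rewrite linE.
Qed.

Lemma aq2M x y : eps x = 0 -> eps y = 0 ->
  aq2 (x * y) = \sum_i \sum_j c i j * (lin i x * lin j y).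
Proof.
rewrite -(alg_pi_repr x) -(alg_pi_repr y) -rmorphM aq2E !epsE// => x0 y0.
rewrite q2M//; apply: eq_bigr => i _; apply: eq_bigr => j _.
by rewrite !linE.
Qed.

Lemma aq2_bracket x y : eps x = 0 -> eps y = 0 ->
  aq2 (bracket x y) =
  \sum_i \sum_j c i j * (lin i x * lin j y - lin i y * lin j x).
Proof.
move=> x0 y0; rewrite aq2B !aq2M// -sumrB; apply: eq_bigr => i _.
by rewrite -sumrB; apply: eq_bigr => j _; rewrite -mulrBr.
Qed.

Lemma lin_fil2 i x y : fil 2 (x - y) -> lin i x = lin i y.
Proof.
move=> [f f2 fE]; apply: subr0_eq; have -> : x = alg_pi (f + repr y).
  by rewrite raddfD /= fE alg_pi_repr subrK.
rewrite -{2}(alg_pi_repr y) !linE ncsD_coef addrK.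
exact: f2.
Qed.

(** Counit zero removes the powers of [alpha] on the empty word, so only the linear coefficients are
    left below degree two. *)
Lemma fil2_of_lin x : eps x = 0 -> (forall i, lin i x = 0) -> fil 2 x.
Proof.
rewrite -(alg_pi_repr x) epsE// => x0 l0; apply: alg_pi_fil => -[|i [|j w]] k //.
  by rewrite x0.
by case: k => // _; rewrite -(linE i) l0.
Qed.

Lemma lin_agen i j : lin i (agen P j) = (i == j)%:R.
Proof. by rewrite linE gen_coef andbT. Qed.

Lemma agen_not_fil2 i : ~ fil 2 (agen P i).
Proof.
move=> i2; have := @lin_fil2 i (agen P i) 0; rewrite subr0 => /(_ i2).
rewrite lin_agen eqxx -(raddf0 (@alg_pi R P)) linE => /eqP.
by rewrite oner_eq0.
Qed.

End QuadraticAlg.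

Section ExtQuadratic.
Variable R : realType.
Local Notation E := (ext_pres R).

Lemma sum_ext_gen (V : nmodType) (G : ext_gen -> V) :
  \sum_i G i = G Etheta + (G Ea0 + (G Ea1 + G Echi)).
Proof.
rewrite (bigD1 Etheta) // (bigD1 Ea0); last exact/eqP.
rewrite (bigD1 Ea1); last by do ?[apply/andP; split]; apply/eqP.
rewrite (bigD1 Echi); last by do ?[apply/andP; split]; apply/eqP.
rewrite big1 => [|x]; first by rewrite /= addr0.
by case: x; rewrite ?eqxx ?andbF.
Qed.

Lemma ncs_lin_fil2 (X : finType) (f g : ncs R X) i :
  fil 2 (f - g) -> f [:: i] 0%N = g [:: i] 0%N.
Proof. by move=> fg; apply: subr0_eq; exact: (fg [:: i] 0%N). Qed.

Lemma sum_gen (X : finType) (d : X -> R) x :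
  \sum_i d i * (gen x : ncs R X) [:: i] 0%N = d x.
Proof.
rewrite (bigD1 x) //= gen_coef eqxx mulr1 big1 ?addr0// => i ix.
by rewrite gen_coef (negPf ix) mulr0.
Qed.

Lemma fil2_rel (X : finType) (x y : X) (z : ncs R X) : fil 1 z ->
  fil 2 (bracket (gen x) (gen y) - alpha *: z).
Proof.
move=> z1; have g2 (a b : X) : fil 2 (gen a * gen b : ncs R X).
  by rewrite -[2%N]/(1 + 1)%N; apply: fil_M; exact: fil_gen.
apply: fil_B; first exact: fil_B.
by rewrite -[2%N]/(1 + 1)%N; apply: fil_scale_fps => // -[].
Qed.

(** The leading structure constants, dualized: [[a0, a1]] and [[theta, a1]] have linear part [theta]
    and [[chi, a1]] has [chi]. No bracket has a linear part on [a0] or [a1], so the weights [d0] and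
    [d1] remain free below. *)
Definition ext_c (dt dx : R) (i j : ext_gen) : R :=
  match i, j with
  | Ea0, Ea1 => dt | Etheta, Ea1 => dt | Echi, Ea1 => dx | _, _ => 0
  end.

Lemma ext_quadratic dt d0 d1 dx :
  @quadratic R E (ext_c dt dx) (ext_gens dt d0 d1 dx).
Proof.
have c1 : fil 1 (gen Echi : ncs R ext_gen) by exact: fil_gen.
have t1 : fil 1 (gen Etheta : ncs R ext_gen) by exact: fil_gen.
have ch1 : fil 1 (cosh (gen Echi) - 1 : ncs R ext_gen).
  by apply: filW (cosh_fil c1).
have sh1 : fil 1 (sinh (gen Echi) : ncs R ext_gen) by exact: sinh_fil.
have z1 : fil 1 (0 : ncs R ext_gen) by exact: fil_0.
have ch0 (d : ext_gen -> R) :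
    \sum_i d i * (cosh (gen Echi) - 1 : ncs R ext_gen) [:: i] 0%N = 0.
  rewrite big1// => i _; rewrite (@ncs_lin_fil2 _ _ 0) ?subr0 ?mulr0//.
  exact: cosh_fil.
have sh0 (d : ext_gen -> R) :
    \sum_i d i * (sinh (gen Echi) : ncs R ext_gen) [:: i] 0%N = d Echi.
  rewrite -(sum_gen d Echi); apply: eq_bigr => i _; congr (_ * _).
  by apply: ncs_lin_fil2; exact: sinh_fil2.
have zz (d : ext_gen -> R) : \sum_i d i * (0 : ncs R ext_gen) [:: i] 0%N = 0.
  by rewrite big1// => i _; exact: mulr0.
set c := ext_c dt dx; set d := ext_gens dt d0 d1 dx.
have rel x y (z : ncs R ext_gen) v : fil 1 z ->
    \sum_i d i * z [:: i] 0%N = v -> c x y - c y x = v ->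
    fil 2 (bracket (gen x) (gen y) - alpha *: z) /\
    q2 c d (bracket (gen x) (gen y) - alpha *: z) = 0.
  by move=> z1' <- cv; rewrite q2B q2_bracket q2_alpha cv subrr; split=> //; exact: fil2_rel.
have rel0 x y : c x y - c y x = 0 ->
    fil 2 (bracket (gen x) (gen y) : ncs R ext_gen) /\ q2 c d (bracket (gen x) (gen y)) = 0.
  move=> cxy; rewrite (_ : bracket _ _ = bracket (gen x) (gen y) - alpha *: 0).
    by apply: rel cxy; rewrite ?zz.
  by rewrite scaler0 subr0.
move=> r [[[[[->|->]|->]|->]|->]|->].
- by apply: rel (sum_gen _ _) _; rewrite //= subr0.
- by apply: rel0; rewrite /= subrr.
- by apply: rel (sum_gen _ _) _; rewrite //= subr0.
- by apply: rel (ch0 _) _; rewrite //= subrr.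
- by apply: rel (ch0 _) _; rewrite //= subrr.
- by apply: rel (sh0 _) _; rewrite //= subr0.
Qed.

Lemma kappa_prel_fil2 r : @prel R (kappa_pres R) r -> fil 2 r.
Proof.
have c1 : fil 1 (gen Kchi : ncs R kappa_gen) by exact: fil_gen.
case=> [[->|->]|->]; apply: fil2_rel.
- exact: fil_gen.
- exact: filW (cosh_fil c1).
- exact: sinh_fil.
Qed.

Lemma ext_prel_fil2 r : @prel R E r -> fil 2 r.
Proof. by move=> /(@ext_quadratic 0 0 0 0)[]. Qed.

End ExtQuadratic.

(** * The mixed quadratic part of the coproduct *)

Section TensorQuadratic.
Variables (R : realType) (P : pres R) (H : fhopf P) (C : pgen P -> pgen P -> R).
Hypothesis P2 : forall r, @prel R P r -> fil 2 r.
Local Notation X := (pgen P).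
Local Notation T := (ctens P P).

(** The value does not depend on the order of the two letters, which kills the commutation
    relations, and is zero on pairs from one factor, which kills the relations of both factors. *)
Definition cross (s t : X + X) : R :=
  match s, t with
  | inl i, inr j => C i j
  | inr j, inl i => C i j
  | _, _ => 0
  end.
Definition dzero (s : X + X) : R := 0.

Lemma rename_out (Y Z : finType) (r : Y -> Z) (f : ncs R Y) w :
  (forall v, map r v <> w) -> rename r f w = 0.
Proof. by move=> vw; rewrite /rename big_pred0// => v; apply/negbTE/eqP. Qed.

Lemma rename_map (Y Z : finType) (r : Y -> Z) (f : ncs R Y) v : injective r ->
  rename r f (map r v) = f v.
Proof.
move=> rI; rewrite /rename big_mkcond /=.
rewrite (@sum_tuple_eq _ _
  (fun u => if map r u == map r v then f u else 0) v) => [|u uv].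
  by rewrite size_map !eqxx.
by rewrite (inj_eq (inj_map rI)) (negPf uv).
Qed.

Lemma cross_inl (f : ncs R X) : q2 cross dzero (rename inl f) = 0.
Proof.
rewrite /q2 big1 ?add0r => [|i _]; last exact: mul0r.
rewrite big1// => -[i|i] _; rewrite big1// => -[j|j] _; rewrite /cross ?mul0r//;
by rewrite rename_out ?mulr0// => -[|? [|? []]].
Qed.

Lemma cross_inr (f : ncs R X) : q2 cross dzero (rename inr f) = 0.
Proof.
rewrite /q2 big1 ?add0r => [|i _]; last exact: mul0r.
rewrite big1// => -[i|i] _; rewrite big1// => -[j|j] _; rewrite /cross ?mul0r//;
by rewrite rename_out ?mulr0// => -[|? [|? []]].
Qed.

Lemma cross_quadratic : @quadratic R T cross dzero.
Proof.
move=> r [[[f Pf <-]|[g Pg <-]]|[x [y ->]]].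
- by split; [exact/fil_rename/P2|exact: cross_inl].
- by split; [exact/fil_rename/P2|exact: cross_inr].
- split; last by rewrite q2_bracket subrr.
  have := @fil2_rel R (X + X)%type (inl x) (inr y) 0 (fil_0 _).
  by rewrite scaler0 subr0.
Qed.

Definition crossing : alg T -> R := @aq2 R T cross dzero.

Lemma crossing_tinl x : crossing (tinl x) = 0.
Proof.
rewrite -(alg_pi_repr x) [tinl _]adescE fcompE.
by rewrite [LHS](aq2E cross_quadratic) cross_inl.
Qed.

Lemma crossing_tinr x : crossing (tinr x) = 0.
Proof.
rewrite -(alg_pi_repr x) [tinr _]adescE fcompE.
by rewrite [LHS](aq2E cross_quadratic) cross_inr.
Qed.

Lemma quadratic0 : @quadratic R P (fun _ _ => 0) (fun _ => 0).
Proof.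
move=> r Pr; split; first exact: P2.
rewrite /q2 !big1 ?addr0// => i _; last by rewrite mul0r.
by rewrite big1// => j _; rewrite mul0r.
Qed.

Lemma lin_tinl s x : lin s (tinl x : alg T) = if s is inl i then lin i x else 0.
Proof.
rewrite -(alg_pi_repr x) [tinl _]adescE fcompE (linE cross_quadratic).
case: s => i; last by rewrite frenameE rename_out// => -[|? []].
by rewrite (linE quadratic0) frenameE (@rename_map _ _ inl _ [:: i])// => ? ? [].
Qed.

Lemma lin_tinr s x : lin s (tinr x : alg T) = if s is inr i then lin i x else 0.
Proof.
rewrite -(alg_pi_repr x) [tinr _]adescE fcompE (linE cross_quadratic).
case: s => i; first by rewrite frenameE rename_out// => -[|? []].
by rewrite (linE quadratic0) frenameE (@rename_map _ _ inr _ [:: i])// => ? ? [].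
Qed.

Let augT := ctens_augmented H H.

Lemma crossing_tens x y : eps x = 0 -> eps y = 0 ->
  crossing (x \ox y) = \sum_i \sum_j C i j * (lin i x * lin j y).
Proof.
move=> x0 y0; rewrite tensE /crossing (aq2M augT cross_quadratic); last first.
- by rewrite (eps_tinr H H).
- by rewrite (eps_tinl H H).
rewrite big_sumType /= [X in _ + X]big1 ?addr0 => [|i _]; last first.
  by rewrite big1// => j _; rewrite lin_tinl mul0r mulr0.
apply: eq_bigr => i _; rewrite big_sumType /= big1 ?add0r => [|j _]; last exact: mul0r.
by apply: eq_bigr => j _; rewrite lin_tinl lin_tinr.
Qed.

Lemma crossing_scale a t : crossing (a *: t) = a 0%N * crossing t.
Proof.
rewrite -(alg_pi_repr t) -linearZ /crossing !(aq2E cross_quadratic) /q2.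
rewrite big1 => [|i _]; last exact: mul0r.
rewrite [in RHS]big1 => [|i _]; last exact: mul0r.
rewrite !add0r mulr_sumr; apply: eq_bigr => i _; rewrite mulr_sumr.
apply: eq_bigr => j _; rewrite mulrCA; congr (_ * _); exact: fpsE_mul0.
Qed.

Lemma crossingD s t : crossing (s + t) = crossing s + crossing t.
Proof. exact: (aq2D cross_quadratic). Qed.

Lemma crossing_fil3 t : fil 3 t -> crossing t = 0.
Proof. exact: (aq2_fil3 cross_quadratic). Qed.

(* The coproduct of an element of the augmentation ideal is cocommutative up
   to its linear part, and [crossing] is antisymmetric. *)
Lemma crossing_comul u : (forall i j, C j i = - C i j) ->
  (forall x, fil 2 (fcomul H (agen P x) - (agen P x \ox 1 + 1 \ox agen P x))) ->
  (forall x, eps (fcomul H (agen P x)) = 0) ->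
  eps u = 0 ->
  crossing (fcomul H u) = \sum_x lin x u * crossing (fcomul H (agen P x)).
Proof.
move=> CN Hprim eD.
have lD s x : lin s (fcomul H (agen P x)) =
    lin s (tinl (agen P x) : alg T) + lin s (tinr (agen P x) : alg T).
  by rewrite -(linD cross_quadratic) -tensx1 -tens1x; exact: (lin_fil2 cross_quadratic).
have linl i x : lin (inl i : pgen T) (fcomul H (agen P x)) = (i == x)%:R.
  by rewrite lD lin_tinl lin_tinr addr0 (lin_agen quadratic0).
have linr i x : lin (inr i : pgen T) (fcomul H (agen P x)) = (i == x)%:R.
  by rewrite lD lin_tinl lin_tinr add0r (lin_agen quadratic0).
rewrite -(alg_pi_repr u); move: (repr u) => f {u}.
rewrite (epsE (faug H)) => f0.
pose psi (g : ncs R X) := crossing (fcomul H (alg_pi g)).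
have psiD g h : psi (g + h) = psi g + psi h.
  by rewrite /psi raddfD fhD crossingD.
have psiZ a g : psi (a *: g) = a 0%N * psi g.
  rewrite /psi -crossing_scale -fhZ; congr (crossing (fcomul H _)); exact: linearZZ.
have psi0 : psi 0 = 0 by rewrite -[0 in LHS](scale0r 0) psiZ; exact: mul0r.
have psi3 g : fil 3 g -> psi g = 0.
  by move=> g3; apply: crossing_fil3; exact/fhP/alg_pi_fil.
have psi_sum n : psi (\sum_(w : n.-tuple X) f w *: mono w) =
    \sum_(w : n.-tuple X) f w 0%N * psi (mono w).
  rewrite (big_morph psi psiD psi0); apply: eq_bigr => w _.
  exact: psiZ.
(* At leading order the mixed part of the coproduct of [x y] is [x (x) y + y (x) x], on which the
   pairing is [C x y + C y x = 0]. *)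
have psi2 x y : psi (mono [:: x; y]) = 0.
  rewrite /psi alg_pi_mono /alg_word !big_cons big_nil mulr1 (fcomul_mult H).2.
  rewrite /crossing (aq2M augT cross_quadratic)//.
  rewrite big_sumType /=; set I := \sum_i _; set J := \sum_i _.
  have -> : I = C x y.
    rewrite /I (bigD1 x) //= big_sumType /= big1 ?add0r => [|j _]; last exact: mul0r.
    rewrite (bigD1 y) //= !linl !linr !eqxx !mulr1 big1 ?addr0 => [|j jy]; last first.
      by rewrite linr (negPf jy) !mulr0.
    rewrite big1 ?addr0// => i ix; rewrite big_sumType /= !big1 ?addr0// => j _.
      by rewrite linl (negPf ix) mul0r mulr0.
    exact: mul0r.
  have -> : J = C y x.
    rewrite /J (bigD1 x) //= big_sumType /= [X in _ + X + _]big1 ?addr0;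
      last by move=> j _; exact: mul0r.
    rewrite (bigD1 y) //= !linl !linr !eqxx !mulr1 big1 ?addr0 => [|j jy]; last first.
      by rewrite linl (negPf jy) !mulr0.
    rewrite big1 ?addr0// => i ix; rewrite big_sumType /= !big1 ?addr0// => j _.
      exact: mul0r.
    by rewrite linr (negPf ix) mul0r mulr0.
  by rewrite (CN x y) subrr.
(* Only one-letter words contribute: the remainder has order three, the empty word has coefficient
   zero, and two-letter words vanish by [psi2]. *)
rewrite -/(psi f) -[f in LHS](subrK (lsum mono f 3)) psiD psi3 ?add0r; last first.
  exact: mono_dense.
rewrite /lsum !big_ord_recr big_ord0 /= add0r !psiD !psi_sum.
rewrite [X in X + _ + _]big1 ?add0r => [|w _]; last first.
  by rewrite tuple0 f0 mul0r.
rewrite [X in _ + X]big1 ?addr0 => [|w _]; last first.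
  by case/tupleP: w => x w; case/tupleP: w => y w; rewrite tuple0 psi2 mulr0.
rewrite (reindex (fun x => [tuple x])) /=; last first.
  exists (@thead 0 X) => [x _|w _]; first by [].
  by case/tupleP: w => x w; apply: val_inj; rewrite tuple0.
apply: eq_bigr => x _; rewrite (linE quadratic0); congr (_ * _).
Qed.

End TensorQuadratic.

(** * The obstruction to an isomorphism *)

Section NonTriviality.
Variable R : realType.
Local Notation E := (ext_pres R).
Local Notation K := (kappa_pres R).
Local Notation L := (line_pres R).
Local Notation T := (ctens K L).
Variables (HE : fhopf E) (HK : fhopf K) (HL : fhopf L) (HT : fhopf T).
Let t := agen E Etheta.
Let a0 := agen E Ea0.
Let a1 := agen E Ea1.
Let chi := agen E Echi.
Hypothesis HED :
  [/\ fcomul HE t = t \ox 1 + 1 \ox t + (cosh chi - 1) \ox a0 + sinh chi \ox a1,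
      fcomul HE a0 = a0 \ox 1 + cosh chi \ox a0 + sinh chi \ox a1,
      fcomul HE a1 = a1 \ox 1 + cosh chi \ox a1 + sinh chi \ox a0 &
      fcomul HE chi = chi \ox 1 + 1 \ox chi].
Hypothesis HKD : fcomul HK (agen K Ka1) = agen K Ka1 \ox 1 +
  cosh (agen K Kchi) \ox agen K Ka1 + sinh (agen K Kchi) \ox agen K Ka0.
Hypothesis HTD : fcomul HT = tens_comul HK HL.

(** Among the coproducts of the generators only that of [a1], through [sinh chi \ox a0], has a
    component here, so pairing it with a coproduct reads off the coefficient on [a1]. *)
Definition wedge_chi_a0 (i j : ext_gen) : R :=
  match i, j with Echi, Ea0 => 1 | Ea0, Echi => -1 | _, _ => 0 end.

Let E2 := @ext_prel_fil2 R.
Local Notation lin := (@lin R E).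
Let linq := quadratic0 E2.
Let cr := @crossing R E wedge_chi_a0.

Let crD s u : cr (s + u) = cr s + cr u.
Proof. exact: crossingD. Qed.
Let cr_inl x : cr (tinl x) = 0.
Proof. exact: crossing_tinl. Qed.
Let cr_inr x : cr (tinr x) = 0.
Proof. exact: crossing_tinr. Qed.
Let cr3 s : fil 3 s -> cr s = 0.
Proof. exact: crossing_fil3. Qed.

Let augE := faug HE.
Let e1 (x : pgen E) : fil 1 (agen E x) := @agen_fil R E x.

Let eps_prod (x y : alg E) : eps (x \ox y) = eps x * eps y.
Proof.
rewrite tensE (eps_monoid (ctens_augmented HE HE)).2; congr (_ * _).
  exact: (eps_tinl HE HE).
exact: (eps_tinr HE HE).
Qed.

Lemma crossing_wedge x y : eps x = 0 -> eps y = 0 ->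
  cr (x \ox y) = lin Echi x * lin Ea0 y - lin Ea0 x * lin Echi y.
Proof.
move=> x0 y0; rewrite /cr (crossing_tens HE wedge_chi_a0 E2)// sum_ext_gen !sum_ext_gen /=.
by rewrite !mul0r !mul1r mulN1r !addr0 !add0r addrC.
Qed.

(** Up to order three, [cosh x \ox u] is [1 \ox u], which is not mixed, and [sinh x] has the linear
    part of [x]; only the last term is seen. *)
Lemma crossing_skew x u v : fil 1 x -> eps (sinh x) = 0 -> fil 1 u -> eps v = 0 ->
  cr (u \ox 1 + cosh x \ox u + sinh x \ox v) =
  lin Echi x * lin Ea0 v - lin Ea0 x * lin Echi v.
Proof.
move=> x1 sx u1 v0; rewrite !crD tensx1 cr_inl add0r.
rewrite -[cosh x](subrK 1) tensDl crD tens1x.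
rewrite cr_inr addr0 cr3; last first.
  by rewrite -[3%N]/(2 + 1)%N; apply: tens_fil => //; exact: cosh_fil.
have sl i : lin i (sinh x) = lin i x by apply: (lin_fil2 linq); exact: sinh_fil2.
by rewrite add0r crossing_wedge// !sl.
Qed.

Let eps_sinh x : fil 1 x -> eps x = 0 -> eps (sinh x : alg E) = 0.
Proof.
move=> x1 x0; rewrite -[LHS](eps_scalar augE) -(fepsE augE) fmult_sinh//;
  last exact: feps_mult.
rewrite fepsE x0 scale0r.
have -> : sinh (0 : alg E) = 0.
  rewrite /sinh; apply: powser_uniq; first exact: fil_0.
  move=> n; rewrite /psum big1 ?subrr; first exact: fil_0.
  by move=> [[|k] kn] _; rewrite ?fpsC0 ?scale0r//= expr0n scaler0.
exact: (eps0 augE).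
Qed.

Lemma crossing_ext_comul u : eps u = 0 -> cr (fcomul HE u) = lin Ea1 u.
Proof.
have [Dt D0 D1 Dc] := HED; have ea x : eps (agen E x) = 0 by exact: (eps_agen augE).
have es : eps (sinh chi) = 0 by exact: eps_sinh (e1 Echi) (ea Echi).
have s1 : fil 1 (sinh chi) by exact: sinh_fil (e1 Echi).
have c2 : fil 2 (cosh chi - 1) by exact: cosh_fil (e1 Echi).
have w2 x (y : alg E) : fil 1 x -> fil 1 y -> fil 2 (x \ox y).
  by move=> x1 y1; rewrite -[2%N]/(1 + 1)%N; exact: tens_fil.
have w1 (y : alg E) : fil 2 (cosh chi \ox y - 1 \ox y).
  by rewrite -tensBl; exact: tens_fill.
have prim x : fil 2 (fcomul HE (agen E x) - (agen E x \ox 1 + 1 \ox agen E x)).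
  case: x => /=; rewrite -/t -/a0 -/a1 -/chi ?Dt ?D0 ?D1 ?Dc.
  - rewrite (_ : _ - _ = (cosh chi - 1) \ox a0 + sinh chi \ox a1); last by abel.
    by apply: fil_D; [exact: (tens_fill _ c2)|exact: w2 s1 (e1 Ea1)].
  - rewrite (_ : _ - _ = (cosh chi \ox a0 - 1 \ox a0) + sinh chi \ox a1); last by abel.
    by apply: fil_D; [exact: w1|exact: w2 s1 (e1 Ea1)].
  - rewrite (_ : _ - _ = (cosh chi \ox a1 - 1 \ox a1) + sinh chi \ox a0); last by abel.
    by apply: fil_D; [exact: w1|exact: w2 s1 (e1 Ea0)].
  - by rewrite subrr; exact: fil_0.
have epsTD (x y : alg (ctens E E)) : eps (x + y) = eps x + eps y.
  rewrite -[x in LHS]scale1r (eps_linear (ctens_augmented HE HE)) mul1r//.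
have eD x : eps (fcomul HE (agen E x)) = 0.
  case: x => /=; rewrite -/t -/a0 -/a1 -/chi ?Dt ?D0 ?D1 ?Dc !epsTD !eps_prod !ea;
  by rewrite ?es ?mul0r ?mulr0 ?addr0.
move=> u0; rewrite /cr (crossing_comul E2 (H := HE))//;
  last by case=> -[] /=; rewrite ?oppr0 ?opprK.
rewrite sum_ext_gen -/t -/a0 -/a1 -/chi -/cr.
have l i j : lin i (agen E j) = (i == j)%:R by exact: (lin_agen linq).
have lne i j : i <> j -> lin i (agen E j) = 0 by rewrite l => /eqP/negPf ->.
have c0 : cr (fcomul HE a0) = 0.
  rewrite D0 (crossing_skew (e1 Echi) es (e1 Ea0) (ea Ea1)).
  by rewrite (lne Ea0 Ea1)// (lne Echi Ea1)// !mulr0 subrr.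
(* The coproducts of [t] and [a0] differ by that of the primitive [t - a0], which has no mixed
   part. *)
have ct : cr (fcomul HE t) = 0.
  rewrite Dt -(subrK (fcomul HE a0) (_ + _ + _ + _)) crD c0 addr0 D0.
  rewrite (_ : _ - _ = tinl (t - a0) + tinr (t - a0)).
    by rewrite crD cr_inl cr_inr addr0.
  by rewrite tensBl !fhB -!tensx1 -!tens1x; abel.
have c1 : cr (fcomul HE a1) = 1.
  rewrite D1 (crossing_skew (e1 Echi) es (e1 Ea1) (ea Ea0)).
  by rewrite (lne Ea0 Echi)// !l !eqxx mulr1 mul0r subr0.
have cc : cr (fcomul HE chi) = 0.
  by rewrite Dc crD tensx1 tens1x cr_inl cr_inr addr0.
by rewrite c0 ct c1 cc !mulr0 mulr1 !add0r addr0.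
Qed.

Lemma not_isomorphic : ~ hopf_isomorphic (hopf_of HE) (hopf_of HT).
Proof.
have augT := faug HT; have T2 r : @prel R T r -> fil 2 r.
  case=> [[[h Kh <-]|[h [] //]]|[y [z ->]]].
    exact/fil_rename/kappa_prel_fil2.
  have := @fil2_rel R (pgen T) (inl y) (inr z) 0 (fil_0 _).
  by rewrite scaler0 subr0.
move=> [f [g [[fc _ fe _] [gc [gg [_ ggE] gD] ge _] fK gK]]].
(* Compatibility with the counits puts the images of generators in order one, which upgrades the
   continuous isomorphisms to filtered maps. *)
have g1 x : fil 1 (g (agen T x)).
  apply: (eps_fil1 augE); have := ge (agen T x); rewrite !hopf_of_counit => ->.
  exact: (eps_agen augT).
have f1 x : fil 1 (f (agen E x)).
  apply: (eps_fil1 augT); have := fe (agen E x); rewrite !hopf_of_counit => ->.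
  exact: (eps_agen augE).
have [g' gM gE] := lrmorphism_fhom gc g1.
have [f' fM fE] := lrmorphism_fhom fc f1.
pose A0 := tinl (agen K Ka0) : alg T.
pose A1 := tinl (agen K Ka1) : alg T.
pose X := tinl (agen K Kchi) : alg T.
have M := @tinl_mult R K L.
set u0 := g' A0; set u1 := g' A1; set x := g' X.
have eps0 i : eps (g' (tinl (agen K i) : alg T)) = 0.
  rewrite gE; have := ge (tinl (agen K i)); rewrite !hopf_of_counit => ->.
  by rewrite tinl_agen; exact: (eps_agen augT).
have [[R1 _ _] [_ _ R6]] := kappa_erel R.
have k1 := @agen_fil R K Kchi.
have B1 : bracket u0 u1 = alpha *: u0.
  by rewrite -(fmult_bracket _ _ gM) -(fmult_bracket _ _ M) R1 !fhZ.
have B2 : bracket x u1 = alpha *: sinh x.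
  rewrite -(fmult_bracket _ _ gM) -(fmult_bracket _ _ M) R6 !fhZ.
  by rewrite (fmult_sinh M)// (fmult_sinh gM)//; exact: fhP.
have x1 : fil 1 x by apply: fhP; exact: fhP.
have u11 : fil 1 u1 by apply: fhP; apply: fhP; exact: agen_fil.
have e0 : eps u0 = 0 := eps0 Ka0.
have e1' : eps u1 = 0 := eps0 Ka1.
have ex : eps x = 0 := eps0 Kchi.
have D1 : fcomul HE u1 = u1 \ox 1 + cosh x \ox u1 + sinh x \ox u0.
  have := gD A1; rewrite -gE hopf_of_comul => ->.
  rewrite hopf_of_comul HTD tens_comul_inl HKD !fhD !tmapE.
  have ggD a b : gg (a + b) = gg a + gg b := raddfD gg a b.
  rewrite !ggD !ggE -!gE.
  rewrite (M.1) gM.1; congr (_ + _ \ox _ + _ \ox _).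
    by rewrite (fmult_cosh M)// (fmult_cosh gM)//; exact: fhP.
  by rewrite (fmult_sinh M)// (fmult_sinh gM)//; exact: fhP.
(* Testing a relation against the whole family of quadratic functionals; each choice of weights
   below isolates one linear coefficient of [w]. *)
have Q dt d0 d1 dx (v w : alg E) : eps v = 0 -> eps w = 0 -> bracket v u1 = alpha *: w ->
  dt * (lin Etheta v * lin Ea1 u1 - lin Etheta u1 * lin Ea1 v) +
  (dt * (lin Ea0 v * lin Ea1 u1 - lin Ea0 u1 * lin Ea1 v) +
   dx * (lin Echi v * lin Ea1 u1 - lin Echi u1 * lin Ea1 v)) =
  dt * lin Etheta w + (d0 * lin Ea0 w + (d1 * lin Ea1 w + dx * lin Echi w)).
  move=> v0 w0 vw; have q := @ext_quadratic R dt d0 d1 dx.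
  have := aq2_bracket augE q v0 e1'; rewrite vw (aq2_alpha q) !sum_ext_gen /=.
  by move=> ->; rewrite !mul0r !addr0 !add0r.
have es := eps_sinh x1 ex.
(* With only [d0] or only [d1] nonzero the left side of [Q] vanishes, since brackets have no linear
   part on [a0] or [a1]. *)
have p0 : lin Ea0 u0 = 0.
  by have := Q 0 1 0 0 u0 u0 e0 e0 B1; rewrite !mul0r mul1r !addr0 !add0r => <-.
have q0 : lin Ea1 u0 = 0.
  by have := Q 0 0 1 0 u0 u0 e0 e0 B1; rewrite !mul0r mul1r !addr0 !add0r => <-.
have px : lin Ea0 x = 0.
  have := Q 0 1 0 0 x (sinh x) ex es B2; rewrite !mul0r mul1r !addr0 !add0r.
  by rewrite (lin_fil2 linq Ea0 (sinh_fil2 x1)) => <-.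
(* The coefficient is read off the coproduct of [u1]; each of the two products in the antisymmetric
   pairing contains a factor already known to vanish. *)
have q1 : lin Ea1 u1 = 0.
  rewrite -crossing_ext_comul// D1 crossing_skew// p0 px.
  by rewrite mulr0 mul0r subrr.
have t0 : lin Etheta u0 = 0.
  have := Q 1 0 0 0 u0 u0 e0 e0 B1.
  by rewrite q0 q1 !mulr0 !mul0r !subrr !mulr0 !addr0 mul1r => <-.
have r0 : lin Echi u0 = 0.
  have := Q 0 0 0 1 u0 u0 e0 e0 B1.
  by rewrite q0 q1 !mulr0 !mul0r !subrr !mulr0 !add0r mul1r => <-.
have u02 : fil 2 u0 by apply: (fil2_of_lin augE linq e0); case.
(* The inverse is filtered as well, so it would place the generator [a0] of the tensor product in
   order two, against its linear coefficient 1 on itself. *)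
apply: (agen_not_fil2 (quadratic0 T2) (i := inl Ka0)).
rewrite -tinl_agen -/A0; have -> : A0 = f' u0 by rewrite fE /u0 gE gK.
exact: fhP.
Qed.

End NonTriviality.

(** * The coordinates of the central extension *)

Section Coordinates.
Variable R : realType.
Local Notation E := (ext_pres R).
Local Notation K := (kappa_pres R).
Local Notation L := (line_pres R).
Local Notation W := (tilde_pres R).
Let t := agen E Etheta.
Let a0 := agen E Ea0.
Let a1 := agen E Ea1.
Let chi := agen E Echi.
Let e1 x : fil 1 (agen E x) := @agen_fil R E x.

Lemma ttheta_brackets :
  [/\ bracket (t - a0) a0 = 0, bracket (t - a0) a1 = 0 & bracket chi (t - a0) = 0].
Proof.
have [[R1 R2 R3] [R4 R5 R6]] := ext_erel R.
split; first by rewrite bracketDl bracketNl R2 bracketxx subr0.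
  by rewrite bracketDl bracketNl R3 R1 subrr.
by rewrite bracketDr bracketNr R4 R5 subrr.
Qed.

Lemma ttheta_central x : (t - a0) * x = x * (t - a0).
Proof.
have [B1 B2 B3] := ttheta_brackets.
apply: (@fmult_comm R E _ (fid (alg E))) => // g; rewrite !fidE; apply/bracket_eq0.
case: g => //; last by rewrite bracketC B3 oppr0.
have -> : agen E Etheta = (t - a0) + a0 by rewrite subrK.
by rewrite bracketDr bracketxx add0r.
Qed.

Lemma tilde_iso : exists (f : {lrmorphism alg W -> alg E}) (g : {lrmorphism alg E -> alg W}),
  [/\ fil_continuous fil fil f, fil_continuous fil fil g, cancel f g, cancel g f &
      [/\ f (agen W Etheta) = t - a0, f (agen W Ea0) = a0, f (agen W Ea1) = a1 &
          f (agen W Echi) = chi]].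
Proof.
have w1 x : fil 1 (agen W x) by exact: agen_fil.
have ft : fil 1 (t - a0) by apply: fil_B; exact: e1.
have [|f [fM fE]] := @tilde_lift R _ (t - a0) a0 a1 chi ft (e1 _) (e1 _) (e1 _).
  by rewrite subrK; exact: ext_erel.
have gt : fil 1 (agen W Etheta + agen W Ea0) by apply: fil_D; exact: w1.
have [g [gM gE]] := ext_lift gt (w1 _) (w1 _) (w1 _) (tilde_erel R).
exists (lrmorphism_of fM), (lrmorphism_of gM); split.
- exact: fhom_continuous.
- exact: fhom_continuous.
- apply: (@alg_fmult_eq R W _ (fcomp g f) (fid _)) => [||x]; first exact: fcomp_mult.
    exact: fid_mult.
  rewrite fcompE fidE fE; case: x => /=; rewrite ?fhB !gE//=.
  by rewrite addrK.
- apply: (@alg_fmult_eq R E _ (fcomp f g) (fid _)) => [||x]; first exact: fcomp_mult.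
    exact: fid_mult.
  rewrite fcompE fidE gE; case: x => /=; rewrite ?fhD !fE//=.
  by rewrite subrK.
- by split; exact: fE.
Qed.

Lemma ttheta_comul (D : fhom (alg E) (alg (ctens E E))) :
  [/\ D t = t \ox 1 + 1 \ox t + (cosh chi - 1) \ox a0 + sinh chi \ox a1,
      D a0 = a0 \ox 1 + cosh chi \ox a0 + sinh chi \ox a1,
      D a1 = a1 \ox 1 + cosh chi \ox a1 + sinh chi \ox a0 &
      D chi = chi \ox 1 + 1 \ox chi] ->
  D (t - a0) = (t - a0) \ox 1 + 1 \ox (t - a0).
Proof. by case=> Dt D0 _ _; rewrite fhB Dt D0 !tensBl !tensBr; abel. Qed.

Lemma ttheta_anti (S : fhom (alg E) (alg E)) :
  [/\ S t = - (t - a0) - (cosh chi * a0 - sinh chi * a1),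
      S a0 = - (cosh chi * a0 - sinh chi * a1),
      S a1 = - (cosh chi * a1 - sinh chi * a0) & S chi = - chi] ->
  S (t - a0) = - (t - a0).
Proof. by case=> St S0 _ _; rewrite fhB St S0; abel. Qed.

Lemma ttheta_quotient (HE : fhopf E) (HK : fhopf K)
    (ka0 := agen K Ka0) (ka1 := agen K Ka1) (kchi := agen K Kchi) :
  [/\ fcomul HE t = t \ox 1 + 1 \ox t + (cosh chi - 1) \ox a0 + sinh chi \ox a1,
      fcomul HE a0 = a0 \ox 1 + cosh chi \ox a0 + sinh chi \ox a1,
      fcomul HE a1 = a1 \ox 1 + cosh chi \ox a1 + sinh chi \ox a0 &
      fcomul HE chi = chi \ox 1 + 1 \ox chi] ->
  [/\ funop (fanti HE) t = - (t - a0) - (cosh chi * a0 - sinh chi * a1),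
      funop (fanti HE) a0 = - (cosh chi * a0 - sinh chi * a1),
      funop (fanti HE) a1 = - (cosh chi * a1 - sinh chi * a0) &
      funop (fanti HE) chi = - chi] ->
  [/\ fcomul HK ka0 = ka0 \ox 1 + cosh kchi \ox ka0 + sinh kchi \ox ka1,
      fcomul HK ka1 = ka1 \ox 1 + cosh kchi \ox ka1 + sinh kchi \ox ka0 &
      fcomul HK kchi = kchi \ox 1 + 1 \ox kchi] ->
  [/\ funop (fanti HK) ka0 = - (cosh kchi * ka0 - sinh kchi * ka1),
      funop (fanti HK) ka1 = - (cosh kchi * ka1 - sinh kchi * ka0) &
      funop (fanti HK) kchi = - kchi] ->
  exists p : {lrmorphism alg E -> alg K},
     [/\ hopf_morphism (hopf_of HE) (hopf_of HK) p,
         [/\ p a0 = ka0, p a1 = ka1 & p chi = kchi],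
         (forall y, exists x, p x = y),
         (forall n, exists m, fil m `<=` p @` fil n) &
         [set x | p x = 0] = closed_ideal_of [set t - a0]].
Proof.
move=> [Dt D0 D1 Dc] [St S0 S1 Sc] [KD0 KD1 KDc] [KS0 KS1 KSc].
have k1 x : fil 1 (agen K x) by exact: agen_fil.
have [p [pM pE]] := ext_lift (k1 _) (k1 _) (k1 _) (k1 _) (kappa_erel R).
have pt : p t = ka0 by exact: pE. have p0 : p a0 = ka0 by exact: pE.
have p1 : p a1 = ka1 by exact: pE. have pc : p chi = kchi by exact: pE.
have pcosh : p (cosh chi) = cosh kchi by rewrite fmult_cosh ?pc//; exact: e1.
have psinh : p (sinh chi) = sinh kchi by rewrite fmult_sinh ?pc//; exact: e1.
(* The section [s] lives on the free algebra only, since [[a0, a1] = alpha a0] fails in the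
   extension; this is enough for surjectivity and for the openness of [p]. *)
have s1 x : fil 1 (kappa_gens a0 a1 chi x) by case: x; exact: e1.
pose s := fext s1; have sM : fmult s := fext_mult s1.
have ps : fcomp p s =1 @fpi R K.
  apply: ncs_fmult_eq; [exact: fcomp_mult|exact: fpi_mult|case].
  - by rewrite fcompE fext_gen.
  - by rewrite fcompE fext_gen.
  - by rewrite fcompE fext_gen.
exists (lrmorphism_of pM); split.
- apply: hopf_of_morphism; case; (split;
    [|by rewrite pE /=; exact: (eps_agen (faug HK))|]).
  + rewrite -/t pt KD0 Dt !fhD !tmapE fhB !pM.1 pcosh psinh p0 p1 pt tensBl.
    by abel.
  + rewrite -/t pt -!funopE KS0 St !fhD !fhN !fhB !pM.2 pcosh psinh p0 p1 pt.
    by abel.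
  + by rewrite -/a0 p0 KD0 D0 !fhD !tmapE !pM.1 pcosh psinh p0 p1.
  + by rewrite -/a0 p0 -!funopE KS0 S0 fhN fhB !pM.2 pcosh psinh p0 p1.
  + by rewrite -/a1 p1 KD1 D1 !fhD !tmapE !pM.1 pcosh psinh p0 p1.
  + by rewrite -/a1 p1 -!funopE KS1 S1 fhN fhB !pM.2 pcosh psinh p0 p1.
  + by rewrite -/chi pc KDc Dc !fhD !tmapE !pM.1 pc.
  + by rewrite -/chi pc -!funopE KSc Sc fhN pc.
- by [].
- by move=> y; exists (s (repr y)); rewrite -[RHS](alg_pi_repr y); exact: ps.
- by move=> n; exists n => y [f fn <-]; exists (s f); [exact: fhP|exact: ps].
- apply/seteqP; split=> [x /= px0|x]; last first.
    apply; split; first exact: (closed_ideal_preimage pM (@closed_ideal_zero R (alg K))).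
    by move=> _ ->; rewrite /preimage /= fhB pt p0 subrr.
  (* Modulo any closed ideal [J] containing [t - a0], an element [x] equals [s (q (repr x))], where
     [q] identifies [theta] with [a0] in the free algebras. If [p x = 0], then [q (repr x)] lies in
     the ideal of the kappa-Poincare relations, which [s] maps into [J]. *)
  move=> J [Jid Jt]; have [J0 JB JM Jcl] := Jid.
  have JD x1 x2 : J x1 -> J x2 -> J (x1 + x2).
    by move=> j1 j2; rewrite -[x2]opprK -[- x2]sub0r; apply: (JB) => //; exact: (JB).
  have q1 x' : fil 1 (ext_gens (gen Ka0) (gen Ka0) (gen Ka1) (gen Kchi) x' : ncs R kappa_gen).
    by case: x'; exact: fil_gen.
  pose q := fext q1; have qM : fmult q := fext_mult q1.
  have pq : fcomp (@fpi R K) q =1 fcomp p (@fpi R E).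
    apply: ncs_fmult_eq; [exact: fcomp_mult (@fpi_mult R K) qM
                         |exact: fcomp_mult pM (@fpi_mult R E)|].
    by move=> g; rewrite !fcompE fext_gen [p _]pE; case: g.
  (* The congruence holds on words by induction on their length, and passes to series because [J] is
     closed. *)
  have sqJ (f : ncs R (pgen E)) : J ((alg_pi f : alg E) - s (q f)).
    apply: Jcl => n.
    exists (\sum_(k < n) \sum_(w : k.-tuple ext_gen)
        f w *: (alg_word (w : seq (pgen E)) - s (q (mono w)))).
      have JZ a y : J y -> J (a *: y).
        by move=> Jy; rewrite -[y]mul1r scalerAl; apply: (JM _ _ Jy).1.
      have Jw (w : seq (pgen E)) : J (alg_word w - s (q (mono w))).
        elim: w => [|g w IHw].
          by rewrite /alg_word big_nil qM.1 sM.1 subrr.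
        rewrite /alg_word big_cons mono_cons qM.2 sM.2 -/(alg_word w).
        set u := alg_word w in IHw *; set v := s _ in IHw *.
        have -> : agen E g * u - s (q (gen g)) * v =
            agen E g * (u - v) + (agen E g - s (q (gen g))) * v.
          by rewrite mulrBr mulrBl addrA subrK.
        apply: JD; first exact: (JM _ _ IHw).1.
        apply: (fun h => (JM _ _ h).2); rewrite fext_gen.
        have sg y : s (gen y) = kappa_gens a0 a1 chi y := fext_gen s1 y.
        case: g; rewrite /ext_gens sg /kappa_gens ?subrr//.
        exact: Jt.
      elim/big_ind: _ => [||k _]; [exact: J0|exact: JD|].
      by elim/big_ind: _ => [||w _]; [exact: J0|exact: JD|exact: JZ].
    pose fs := lsum mono f n.
    have fE : fil n (f - fs) by exact: mono_dense.
    have -> : \sum_(k < n) \sum_(w : k.-tuple ext_gen)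
        f w *: (alg_word (w : seq (pgen E)) - s (q (mono w))) =
        @fpi R E fs - s (q fs).
      rewrite /fs /lsum !fh_sum -sumrB; apply: eq_bigr => k _.
      rewrite !fh_sum -sumrB; apply: eq_bigr => w _.
      by rewrite !fhZ [fpi _ _]alg_pi_mono scalerBr.
    rewrite -[alg_pi f]/(fpi E f).
    rewrite (_ : _ - _ - _ = fpi E (f - fs) - s (q (f - fs))); last by rewrite !fhB; abel.
    by apply: fil_B; [exact: fhP|exact/fhP/fhP].
  have sJ : alg_ideal_set (q (repr x) : ncs R (pgen K)) -> J (s (q (repr x))).
    move=> /(_ (s @^-1` J)); apply; split; first exact: (closed_ideal_preimage sM Jid).
    move=> r Kr; suff : J (s r) by [].
    have sg y : s (gen y) = kappa_gens a0 a1 chi y := fext_gen s1 y.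
    have [[R1 R2 R3] [R4 R5 R6]] := ext_erel R.
    have c1 : fil 1 (gen Kchi : ncs R kappa_gen) by exact: fil_gen.
    case: Kr => [[->|->]|->];
      rewrite (fmult_rel _ _ _ sM) ?fhB ?sM.1 ?(fmult_cosh sM)// ?(fmult_sinh sM)// !sg.
    (* The relation [[a0, a1] = alpha a0] goes to [alpha] times [t - a0]; the other two hold exactly
       in the extension. *)
    - have := (JM (alpha *: 1) _ (Jt _ erefl)).1.
      by rewrite -scalerAl mul1r scalerBr R1.
    - by rewrite R5 subrr.
    - by rewrite R6 subrr.
  rewrite -(alg_pi_repr x) -[alg_pi _](subrK (s (q (repr x)))).
  apply: JD; first exact: sqJ.
  apply: sJ; have : alg_pi (q (repr x) : ncs R (pgen K)) = alg_pi 0.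
    have := pq (repr x); rewrite !fcompE [fpi E _]alg_pi_repr => E1.
    by rewrite raddf0 -px0 -E1.
  by move/alg_pi_eq; rewrite subr0.
Qed.

Lemma ttheta_line (HE : fhopf E) (HL : fhopf L) (z := agen L tt) :
  fcomul HE (t - a0) = (t - a0) \ox 1 + 1 \ox (t - a0) ->
  funop (fanti HE) (t - a0) = - (t - a0) ->
  fcomul HL z = z \ox 1 + 1 \ox z -> funop (fanti HL) z = - z ->
  exists i : {lrmorphism alg L -> alg E},
    [/\ hopf_morphism (hopf_of HL) (hopf_of HE) i, injective i & i z = t - a0].
Proof.
move=> DE SE DL SL.
have z1 : fil 1 z by exact: agen_fil.
have ft : fil 1 (t - a0) by apply: fil_B; exact: e1.
have [i [iM iz]] := line_lift ft.
have f0 : fil 1 (0 : alg L) by exact: fil_0.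
(* Injectivity comes from a retraction that sends [a0] to [- z] and the other generators to 0, hence
   [t - a0] to [z]. Sending [theta] to 0 is compatible with [[a0, a1] = alpha theta] in this
   commutative target. *)
have E0 : erel 0 (- z) 0 (0 : alg L).
  have b0 x : bracket 0 x = 0 :> alg L by rewrite /bracket mul0r mulr0 subrr.
  have b0' x : bracket x 0 = 0 :> alg L by rewrite /bracket mul0r mulr0 subrr.
  have cs : cosh (0 : alg L) + sinh 0 = 1 by rewrite cosh_sinhD// fexp0.
  have cs' : cosh (0 : alg L) - sinh 0 = 1 by rewrite cosh_sinhB// oppr0 fexp0.
  have s0 : sinh (0 : alg L) = 0.
    have : cosh (0 : alg L) + sinh 0 = cosh 0 - sinh 0 by rewrite cs.
    by move/addrI => s0; apply: addxx_inj; rewrite addr0 {1}s0 addNr.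
  have c0 : cosh (0 : alg L) = 1 by rewrite -cs s0 addr0.
  by split; split; rewrite ?b0 ?b0' ?s0 ?c0 ?subrr ?scaler0.
have [r [rM rE]] := ext_lift f0 (fil_N z1) f0 f0 E0.
exists (lrmorphism_of iM); split.
- apply: hopf_of_morphism; case; split; rewrite iz -?/z.
  + by rewrite DE DL fhD !tmapE iM.1 iz.
  + have augE := faug HE.
    rewrite -[t - a0]addrC -scaleN1r (eps_linear augE) !(eps_agen augE).
    by rewrite mulr0 addr0.
  + by rewrite -!funopE SE SL fhN iz.
- apply: (can_inj (g := r)).
  apply: (@alg_fmult_eq R L _ (fcomp r i) (fid _)); [exact: fcomp_mult|exact: fid_mult|].
  by case; rewrite fcompE iz fhB !rE /= sub0r opprK.
- exact: iz.
Qed.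

End Coordinates.

Theorem mainTheorem6 (R : realType) :
  exists (HA : hopf (ext_pres R)) (HK : hopf (kappa_pres R))
         (HC : hopf (line_pres R)) (HT : hopf (ctens (kappa_pres R) (line_pres R))),
  let theta := agen (ext_pres R) Etheta in
  let a0 := agen (ext_pres R) Ea0 in
  let a1 := agen (ext_pres R) Ea1 in
  let chi := agen (ext_pres R) Echi in
  let ka0 := agen (kappa_pres R) Ka0 in
  let ka1 := agen (kappa_pres R) Ka1 in
  let kchi := agen (kappa_pres R) Kchi in
  let z := agen (line_pres R) tt in
  (* the centrally extended Poincare quantum group *)
  [/\ comul HA theta = theta \ox 1 + 1 \ox theta
                       + (cosh chi - 1) \ox a0 + sinh chi \ox a1,
      comul HA a0 = a0 \ox 1 + cosh chi \ox a0 + sinh chi \ox a1,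
      comul HA a1 = a1 \ox 1 + cosh chi \ox a1 + sinh chi \ox a0 &
      comul HA chi = chi \ox 1 + 1 \ox chi] /\
  (* the spacelike kappa-Poincare quantum group *)
  [/\ comul HK ka0 = ka0 \ox 1 + cosh kchi \ox ka0 + sinh kchi \ox ka1,
      comul HK ka1 = ka1 \ox 1 + cosh kchi \ox ka1 + sinh kchi \ox ka0 &
      comul HK kchi = kchi \ox 1 + 1 \ox kchi] /\
  (* the Hopf algebra generated by one primitive element, and its completed
     tensor product with the previous one *)
  comul HC z = z \ox 1 + 1 \ox z /\
  is_tensor_hopf HK HC HT /\
  let ttheta := theta - a0 in
  let ta0 := a0 in
  let ta1 := a1 in
  let tchi := chi in
  (* coproducts and commutation relations in the new coordinates *)
  [/\ comul HA ttheta = ttheta \ox 1 + 1 \ox ttheta,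
      comul HA ta0 = ta0 \ox 1 + cosh tchi \ox ta0 + sinh tchi \ox ta1,
      comul HA ta1 = ta1 \ox 1 + cosh tchi \ox ta1 + sinh tchi \ox ta0 &
      comul HA tchi = tchi \ox 1 + 1 \ox tchi] /\
  ([/\ bracket ta0 ta1 = alpha *: (ttheta + ta0),
       bracket ttheta ta0 = 0 &
       bracket ttheta ta1 = 0] /\
   [/\ bracket tchi ttheta = 0,
       bracket tchi ta0 = alpha *: (cosh tchi - 1) &
       bracket tchi ta1 = alpha *: sinh tchi]) /\
  (* the new coordinates, with these relations, present the same algebra *)
  (exists (f : {lrmorphism alg (tilde_pres R) -> alg (ext_pres R)})
          (g : {lrmorphism alg (ext_pres R) -> alg (tilde_pres R)}),
     [/\ fil_continuous fil fil f, fil_continuous fil fil g,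
         cancel f g, cancel g f &
         [/\ f (agen (tilde_pres R) Etheta) = ttheta,
             f (agen (tilde_pres R) Ea0) = ta0,
             f (agen (tilde_pres R) Ea1) = ta1 &
             f (agen (tilde_pres R) Echi) = tchi]]) /\
  (* ttheta is central *)
  (forall x, ttheta * x = x * ttheta) /\
  (* setting ttheta = 0 gives the kappa-Poincare quantum group *)
  (exists p : {lrmorphism alg (ext_pres R) -> alg (kappa_pres R)},
     [/\ hopf_morphism HA HK p,
         [/\ p ta0 = ka0, p ta1 = ka1 & p tchi = kchi],
         (forall y, exists x, p x = y),
         (forall n, exists m, fil m `<=` p @` fil n) &
         [set x | p x = 0] = closed_ideal_of [set ttheta]]) /\
  (* the Hopf algebra on one primitive generator is the Hopf subalgebra
     generated by ttheta *)
  (exists i : {lrmorphism alg (line_pres R) -> alg (ext_pres R)},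
     [/\ hopf_morphism HC HA i, injective i & i z = ttheta]) /\
  (* the extension is non-trivial *)
  ~ hopf_isomorphic HA HT.
Proof.
have [HE [HED HES]] := ext_fhopf R; have [HK [HKD HKS]] := kappa_fhopf R.
have [HL [HLD HLS]] := line_fhopf R; have [HT [HTD HTS HTH]] := tens_fhopf HK HL.
exists (hopf_of HE), (hopf_of HK), (hopf_of HL), (hopf_of HT).
move=> theta a0 a1 chi ka0 ka1 kchi z.
have [Dt D0 D1 Dc] := HED; have [KD0 KD1 KDc] := HKD; have [St S0 S1 Sc] := HES.
have psiD := ttheta_comul HED; have psiS := ttheta_anti HES.
have [B1 B2 B3] := ttheta_brackets R.
have [[R1 _ _] [_ R5 R6]] := ext_erel R.
split; first by split.
split; first by split.
split; first by [].
split; first by [].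
move=> ttheta ta0 ta1 tchi.
split; first by split.
split; first by split; split=> //; rewrite /ttheta subrK.
split; first exact: tilde_iso.
split; first exact: ttheta_central.
split; first exact: (ttheta_quotient HED HES HKD HKS).
split; first exact: (ttheta_line psiD psiS HLD HLS).
exact: (not_isomorphic HED KD1 HTD).
Qed.
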